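(* Let $P$ be a finite set of atomic propositions and $\widetilde\Sigma=(\Sigma_c,\Sigma_r,\Sigma_l)$ a partition of $\Sigma=2^P$. For every language of infinite words $L\subseteq\Sigma^\omega$, there exists a Büchi visibly pushdown automaton $\mathfrak A$ over $\widetilde\Sigma$ with $L(\mathfrak A)=L$ if, and only if, there exists a \text{VLDL} formula $\varphi$ over $\widetilde\Sigma$ with $L(\varphi)=L$. Moreover, there are effective translations in both directions.
   Context: Visibly pushdown systems/automata: a visibly pushdown system (VPS) $\mathcal S=(Q,\widetilde\Sigma,\Gamma,\Delta)$ has a finite state set $Q$, a finite stack alphabet $\Gamma$ containing a bottom marker $\bot$, and $\Delta \subseteq (Q\times\Sigma_c\times Q\times(\Gamma\setminus\{\bot\}))\cup(Q\times\Sigma_r\times\Gamma\times Q)\cup(Q\times\Sigma_l\times Q)$. Configurations are pairs $(q,\gamma)$ with $\gamma\in(\Gamma\setminus\{\bot\})^*\bot$. There is an $a$-labeled edge from $(q,\gamma)$ to $(q',\gamma')$ iff: $a\in\Sigma_c$, $(q,a,q',A)\in\Delta$, $\gamma'=A\gamma$; or $a\in\Sigma_r$, $(q,a,\bot,q')\in\Delta$, $\gamma=\gamma'=\bot$; or $a\in\Sigma_r$, $(q,a,A,q')\in\Delta$, $A\neq\bot$, $\gamma=A\gamma'$; or $a\in\Sigma_l$, $(q,a,q')\in\Delta$, $\gamma=\gamma'$. A run on a (finite or infinite) word is a sequence of configurations connected by edges labeled with the successive letters. A VPA $(Q,\widetilde\Sigma,\Gamma,\Delta,I,F)$ adds initial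 states $I$ and final states $F$; a run is initial if it starts in $(q,\bot)$ with $q\in I$; a finite run is accepting if its last state is in $F$. A Büchi VPA (BVPA) is the same tuple read on infinite words; an infinite run is accepting if it visits states of $F$ infinitely often, and $L(\mathfrak A)$ is the set of infinite words having an initial accepting run. \text{VLDL}: a testing VPA (TVPA) $\mathfrak A=(Q,\widetilde\Sigma,\Gamma,\Delta,I,F,t)$ is a VPA together with a function $t$ mapping each state to a \text{VLDL} formula (nesting acyclic; states without test are mapped to a tautology). \text{VLDL} formulas: $\varphi ::= p \mid \neg\varphi\mid\varphi\wedge\varphi\mid\varphi\vee\varphi\mid\langle\mathfrak A\rangle\varphi\mid[\mathfrak A]\varphi$ with $p\in P$, $\mathfrak A$ a TVPA over $\widetilde\Sigma$. For $\alpha\in\Sigma^\omega$, $k\in\mathbb N$: $(\alpha,k)\models p$ iff $p\in\alpha_k$; Boolean connectives as usual; $\mathcal R_{\mathfrak A}(\alpha)$ is the set of $(k,l)$ such that there is an initial accepting run $(q_k,\sigma_k)\cdots(q_l,\sigma_l)$ of $\mathfrak A$ on $\alpha_k\cdots\alpha_{l-1}$ with $(\alpha,m)\models t(q_m)$ for all $m\in\{k,\dots,l\}$; $(\alpha,k)\models\langle\mathfrak A\rangle\varphi$ iff some $l\ge k$ has $(k,l)\in\mathcal R_{\mathfrak A}(\alpha)$ and $(\alpha,l)\models\varphi$; $(\alpha,k)\models[\mathfrak A]\varphi$ iff all $l\ge k$ with $(k,l)\in\mathcal R_{\mathfrak A}(\alpha)$ satisfy $(\alpha,l)\models\varphi$.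 $L(\varphi)=\{\alpha\mid(\alpha,0)\models\varphi\}$.
   Formalization: The set P of atomic propositions is assumed nonempty: for empty P the grammar, whose only base case is p in P, yields no VLDL formula at all, while Büchi visibly pushdown automata exist, so the equivalence fails. *)

(* Defs.v *)
From mathcomp Require Import all_boot.

Set Implicit Arguments.
Unset Strict Implicit.
Unset Printing Implicit Defensive.

(* Letters are the sets of atomic propositions that hold; a block of the
   partition may be empty. *)
Record pushdown_alphabet (P : finType) := PushdownAlphabet {
  calls : {set {set P}};
  returns : {set {set P}};
  locals : {set {set P}};
  alphabet_cover : calls :|: returns :|: locals = [set: {set P}];
  calls_returns_disjoint : [disjoint calls & returns];
  calls_locals_disjoint : [disjoint calls & locals];
  returns_locals_disjoint : [disjoint returns & locals]
}.

Definition omega_word (P : finType) := nat -> {set P}.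

(* [Gam] is the stack alphabet without its bottom marker; the full stack
   alphabet is [option Gam], with [None] for the bottom marker. *)
Record vpa (P : finType) (S : pushdown_alphabet P) := VPA {
  state : finType;
  Gam : finType;
  call_trans : {set state * {a | a \in calls S} * state * Gam};
  ret_trans : {set state * {a | a \in returns S} * option Gam * state};
  loc_trans : {set state * {a | a \in locals S} * state};
  init : {set state};
  final : {set state}
}.

Section Runs.

Variables (P : finType) (S : pushdown_alphabet P) (A : vpa S).

(* The pair (q, w) stands for the configuration with stack content w followed
   by the bottom marker, the head of w being the topmost symbol. *)
Definition config := (state A * seq (Gam A))%type.

Inductive step : {set P} -> config -> config -> Prop :=
| StepCall q (a : {a | a \in calls S}) q' X w :
    (q, a, q', X) \in call_trans A -> step (val a) (q, w) (q', X :: w)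
| StepRetBot q (a : {a | a \in returns S}) q' :
    (q, a, None, q') \in ret_trans A -> step (val a) (q, [::]) (q', [::])
| StepRet q (a : {a | a \in returns S}) X q' w :
    (q, a, Some X, q') \in ret_trans A -> step (val a) (q, X :: w) (q', w)
| StepLoc q (a : {a | a \in locals S}) q' w :
    (q, a, q') \in loc_trans A -> step (val a) (q, w) (q', w).

Definition initial_config (c : config) := c.1 \in init A /\ c.2 = [::].

Definition bvpa_lang (alpha : omega_word P) : Prop :=
  exists r : nat -> config,
    [/\ initial_config (r 0),
        forall i, step (alpha i) (r i) (r i.+1)
      & forall n, exists2 m, n <= m & (r m).1 \in final A].

(* The relation R_A(alpha), where [test q m] says that the test attached to q
   holds at position m. Only the values r k, ..., r l of r matter. *)
Definition tvpa_rel (test : state A -> nat -> Prop) (alpha : omega_word P)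
    (k l : nat) : Prop :=
  k <= l /\
  exists r : nat -> config,
    [/\ initial_config (r k),
        forall m, k <= m < l -> step (alpha m) (r m) (r m.+1),
        (r l).1 \in final A
      & forall m, k <= m <= l -> test (r m).1 m].

End Runs.

(* A testing VPA is a VPA [A] with a map [t] from its states to formulas; that
   the type is inductive makes the nesting of tests acyclic. Atoms are the only
   base case, so the type is empty when P is. *)
Inductive vldl (P : finType) (S : pushdown_alphabet P) :=
| Atom of P
| Not of vldl S
| And of vldl S & vldl S
| Or of vldl S & vldl S
| Dia (A : vpa S) (t : state A -> vldl S) of vldl S
| Box (A : vpa S) (t : state A -> vldl S) of vldl S.

Fixpoint sat (P : finType) (S : pushdown_alphabet P) (phi : vldl S)
    (alpha : omega_word P) (k : nat) : Prop :=
  match phi with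
  | Atom p => p \in alpha k
  | Not psi => ~ sat psi alpha k
  | And psi1 psi2 => sat psi1 alpha k /\ sat psi2 alpha k
  | Or psi1 psi2 => sat psi1 alpha k \/ sat psi2 alpha k
  | @Dia _ _ A t psi => exists l,
      tvpa_rel (fun q : state A => sat (t q) alpha) alpha k l /\ sat psi alpha l
  | @Box _ _ A t psi => forall l,
      tvpa_rel (fun q : state A => sat (t q) alpha) alpha k l -> sat psi alpha l
  end.

Definition vldl_lang (P : finType) (S : pushdown_alphabet P) (phi : vldl S)
    (alpha : omega_word P) : Prop := sat phi alpha 0.

(* Effectiveness is computability in the WHILE language over binary trees
   (Jones, Computability and Complexity, 1997), here with a single variable;
   this model is Turing complete. The tree Nil plays the role of false. *)
Inductive tree := Nil | Node of tree & tree.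

Inductive prog :=
| PNil
| PId
| PHead
| PTail
| PNode of prog & prog
| PSeq of prog & prog
| PIf of prog & prog & prog
| PWhile of prog & prog.

(* [eval p x y]: on input x, p terminates with output y. *)
Inductive eval : prog -> tree -> tree -> Prop :=
| EvalNil x : eval PNil x Nil
| EvalId x : eval PId x x
| EvalHead x y : eval PHead (Node x y) x
| EvalHeadNil : eval PHead Nil Nil
| EvalTail x y : eval PTail (Node x y) y
| EvalTailNil : eval PTail Nil Nil
| EvalNode p q x y z : eval p x y -> eval q x z -> eval (PNode p q) x (Node y z)
| EvalSeq p q x y z : eval p x y -> eval q y z -> eval (PSeq p q) x z
| EvalIfTrue b p q x u v y :
    eval b x (Node u v) -> eval p x y -> eval (PIf b p q) x y
| EvalIfFalse b p q x y : eval b x Nil -> eval q x y -> eval (PIf b p q) x y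
| EvalWhileTrue b p x u v y z :
    eval b x (Node u v) -> eval p x y -> eval (PWhile b p) y z ->
    eval (PWhile b p) x z
| EvalWhileFalse b p x : eval b x Nil -> eval (PWhile b p) x x.

Definition code_list (s : seq tree) : tree := foldr Node Nil s.

Definition code_nat (n : nat) : tree := iter n (Node Nil) Nil.

(* An element of a finite type is coded by its index in the enumeration. *)
Definition code_elt (T : finType) (x : T) : tree := code_nat (enum_rank x).

Definition code_opt (T : finType) (x : option T) : tree :=
  if x is Some y then Node Nil (code_elt y) else Nil.

(* Letters are coded by their index among all letters, not within their block
   of the partition. *)
Definition code_vpa (P : finType) (S : pushdown_alphabet P) (A : vpa S) : tree :=
  code_list
    [:: code_nat #|state A|;
        code_nat #|Gam A|;
        code_list [seq let: (q, a, q', X) := d in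
            code_list [:: code_elt q; code_elt (val a); code_elt q'; code_elt X]
          | d <- enum (call_trans A)];
        code_list [seq let: (q, a, X, q') := d in
            code_list [:: code_elt q; code_elt (val a); code_opt X; code_elt q']
          | d <- enum (ret_trans A)];
        code_list [seq let: (q, a, q') := d in
            code_list [:: code_elt q; code_elt (val a); code_elt q']
          | d <- enum (loc_trans A)];
        code_list [seq code_elt q | q <- enum (init A)];
        code_list [seq code_elt q | q <- enum (final A)]].

Fixpoint code_vldl (P : finType) (S : pushdown_alphabet P) (phi : vldl S) :
    tree :=
  match phi with
  | Atom p => code_list [:: code_nat 0; code_elt p]
  | Not psi => code_list [:: code_nat 1; code_vldl psi]
  | And psi1 psi2 =>
      code_list [:: code_nat 2; code_vldl psi1; code_vldl psi2]
  | Or psi1 psi2 =>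
      code_list [:: code_nat 3; code_vldl psi1; code_vldl psi2]
  | @Dia _ _ A t psi =>
      code_list [:: code_nat 4; code_vpa A;
        code_list [seq code_vldl (t q) | q <- enum (state A)]; code_vldl psi]
  | @Box _ _ A t psi =>
      code_list [:: code_nat 5; code_vpa A;
        code_list [seq code_vldl (t q) | q <- enum (state A)]; code_vldl psi]
  end.

(* One program maps the code of every x to the code of some y with R x y. *)
Definition effective_translation (X Y : Type) (code_X : X -> tree)
    (code_Y : Y -> tree) (R : X -> Y -> Prop) : Prop :=
  exists p : prog, forall x : X, exists2 y : Y,
    eval p (code_X x) (code_Y y) & R x y.

(* Main.v *)
(* Fix a word and an automaton A. The profile of a segment [k, l) is the set of
   triples (q, b, q') such that A has a run on the segment from q with the empty
   stack to q', where b tells whether a final state is met; profiles are computed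
   by a deterministic visibly pushdown automaton. A stair is a position where the
   stack is empty, or below which the later returns never pop: profiles of
   consecutive segments between stairs compose, and there are infinitely many
   stairs. By Ramsey's theorem every
   word has stairs j_0 < j_1 < ... such that [0, j_a) has a fixed profile s and
   [j_a, j_b) a fixed profile e for all a < b, and whether A accepts can be read
   off (s, e).

   Hence Buechi visibly pushdown automata are closed under complement: guess the
   stairs and a rejecting pair (s, e). A formula <A'>f with tests is translated by
   guessing a run of A' together with the obligations that its tests create, and
   by complementing the automaton that looks for a violated obligation.

   Conversely, A accepts iff for some accepting pair (s, e) there is a stair i such
   that [0, i) has profile s and infinitely many stairs l satisfy both that [i, l)
   has profile e and that [i, m) and [l, m) have the same profile for some stair m.
   Following Thomas's proof of McNaughton's theorem, this needs no recursion and is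
   expressed by finitely many modalities over the profile automata. *)

From HB Require Import structures.
From mathcomp Require Import all_boot.
From Stdlib Require Import Classical ClassicalEpsilon.
Require Import Defs.

Set Implicit Arguments.
Unset Strict Implicit.
Unset Printing Implicit Defensive.

(** * Computable functions on trees *)

(** Effectiveness shapes the development. An automaton is a tuple of lists over types with injective
    codes, not a record over finite types, and each construction on it is composed of list
    operations that are known to be computable; finite types occur only at the two ends. Tests and
    subformulas would make the types of states and stack symbols grow with the formula, so these are
    replaced by their codes after each construction. In the other direction the program writes the
    code of a formula, by evaluating over trees the same expression that denotes the formula.

    The profile automaton is deterministic on finite segments only; acceptance of infinite words is
    never determinized. Requiring [[i, m)] and [[l, m)] to have the same profile does the work of a
    limit: whenever a stair [l' > m] is such that [[i, l')] has profile [e], so has [[l, l')].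
    Positions that are each compared with [i] alone thus yield a chain with profile [e] between
    neighbours. *)

Definition tree_eq_dec (x y : tree) : {x = y} + {x <> y}.
Proof. decide equality. Defined.

HB.instance Definition _ := comparableMixin tree_eq_dec.

Definition thd (t : tree) := if t is Node x _ then x else Nil.
Definition ttl (t : tree) := if t is Node _ y then y else Nil.
Definition tree_case (c x y : tree) := if c is Node _ _ then x else y.

(* F is total on all trees, so a program may harmlessly be run on subtrees that do
   not code an object of the expected type. *)
Definition tree_computable (F : tree -> tree) := exists p, forall t, eval p t (F t).

Lemma tcomp_id : tree_computable id.
Proof. by exists PId => t; constructor. Qed.

Lemma tcomp_nil : tree_computable (fun=> Nil).
Proof. by exists PNil => t; constructor. Qed.

Lemma tcomp_comp F G : tree_computable F -> tree_computable G ->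
  tree_computable (fun t => F (G t)).
Proof.
by move=> [p hp] [q hq]; exists (PSeq q p) => t; apply: EvalSeq (hq t) (hp _).
Qed.

Lemma tcomp_node F G : tree_computable F -> tree_computable G ->
  tree_computable (fun t => Node (F t) (G t)).
Proof.
by move=> [p hp] [q hq]; exists (PNode p q) => t; apply: EvalNode (hp t) (hq _).
Qed.

Lemma tcomp_hd F : tree_computable F -> tree_computable (fun t => thd (F t)).
Proof. by apply: tcomp_comp; exists PHead => -[|x y]; constructor. Qed.

Lemma tcomp_tl F : tree_computable F -> tree_computable (fun t => ttl (F t)).
Proof. by apply: tcomp_comp; exists PTail => -[|x y]; constructor. Qed.

Lemma tcomp_case C F G :
  tree_computable C -> tree_computable F -> tree_computable G ->
  tree_computable (fun t => tree_case (C t) (F t) (G t)).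
Proof.
move=> [c hc] [p hp] [q hq]; exists (PIf c p q) => t; move: (hc t).
case: (C t) => [|x y] /= h; first exact: EvalIfFalse h (hq t).
exact: EvalIfTrue h (hp t).
Qed.

Lemma tcomp_const u : tree_computable (fun=> u).
Proof. by elim: u => [|x hx y hy]; [exact: tcomp_nil | exact: tcomp_node]. Qed.

Ltac tcomp_tac :=
  repeat first [exact: tcomp_const | exact: tcomp_id | apply: tcomp_node
               | apply: tcomp_hd | apply: tcomp_tl | apply: tcomp_case].

Fixpoint spine (t : tree) : seq tree := if t is Node x y then x :: spine y else [::].

(** Programs have a single variable, so the loop keeps the rest of the list, the accumulator and the
    environment [e] in one tree. *)
Lemma tcomp_foldl F L I : tree_computable F -> tree_computable L -> tree_computable I ->
  tree_computable (fun e => foldl (fun acc x => F (Node x (Node acc e))) (I e) (spine (L e))).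
Proof.
move=> hF hL hI.
pose fold t := foldl (fun acc x => F (Node x (Node acc (ttl (ttl t)))))
  (thd (ttl t)) (spine (thd t)).
suff hfold : tree_computable fold.
  apply: (tcomp_comp hfold (G := fun e => Node (L e) (Node (I e) e))).
  by apply: tcomp_node => //; apply: tcomp_node => //; exact: tcomp_id.
pose body t := Node (ttl (thd t))
  (Node (F (Node (thd (thd t)) (ttl t))) (ttl (ttl t))).
have [b hb] : tree_computable body.
  apply: tcomp_node; first by tcomp_tac.
  by apply: tcomp_node; [apply: (tcomp_comp hF); tcomp_tac | tcomp_tac].
have [f hf] : tree_computable (fun t => Node (thd t) (Node (thd (ttl t)) (ttl (ttl t)))).
  by tcomp_tac.
have hloop l i e : eval (PWhile PHead b) (Node l (Node i e))
    (Node Nil (Node (foldl (fun acc x => F (Node x (Node acc e))) i (spine l)) e)).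
  elim: l i => [|x _ l IH] i /=; first by apply: EvalWhileFalse; constructor.
  apply: (EvalWhileTrue (EvalHead _ _) (hb _)); exact: IH.
exists (PSeq f (PSeq (PWhile PHead b) (PSeq PTail PHead))) => t.
apply: EvalSeq (hf t) _; apply: EvalSeq (hloop _ _ _) _.
by apply: EvalSeq; constructor.
Qed.

Fixpoint tree_fold (y : tree) (G : tree -> tree) (t : tree) : tree :=
  if t is Node a b
  then G (Node (Node a b) (Node (tree_fold y G a) (tree_fold y G b))) else y.

(* The loop runs a stack machine on pairs of a worklist and a value stack: an
   item [Node Nil t] asks for the value of t, an item [Node (Node Nil Nil) t]
   combines the values of the children of t, which are on the value stack. *)
Lemma tcomp_tree_fold y G : tree_computable G -> tree_computable (tree_fold y G).
Proof.
move=> hG.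
pose w s := ttl (thd s).
pose it s := ttl (thd (thd s)).
pose vs := ttl.
(* The left child is processed first, so its value lies below that of the right child. *)
pose body s := tree_case (thd (thd (thd s)))
  (Node (w s) (Node (G (Node (it s) (Node (thd (ttl (vs s))) (thd (vs s)))))
                    (ttl (ttl (vs s)))))
  (tree_case (it s)
     (Node (Node (Node Nil (thd (it s)))
             (Node (Node Nil (ttl (it s)))
                (Node (Node (Node Nil Nil) (it s)) (w s)))) (vs s))
     (Node (w s) (Node y (vs s)))).
have [b hb] : tree_computable body.
  rewrite /body /w /it /vs; tcomp_tac.
  by apply: (tcomp_comp hG); tcomp_tac.
(* Stated for the outcome [z] of the remaining run, so that the items which a node puts on the
   worklist can be discharged one after the other. *)
have hloop t W V z : eval (PWhile PHead b) (Node W (Node (tree_fold y G t) V)) z ->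
    eval (PWhile PHead b) (Node (Node (Node Nil t) W) V) z.
  elim: t W V => [|t1 IH1 t2 IH2] W V hz.
    by apply: EvalWhileTrue hz; [constructor | apply: hb].
  apply: EvalWhileTrue; [by constructor | exact: hb |].
  apply: IH1; apply: IH2.
  by apply: EvalWhileTrue hz; [constructor | apply: hb].
have [f hf] : tree_computable (fun t => Node (Node (Node Nil t) Nil) Nil) by tcomp_tac.
exists (PSeq f (PSeq (PWhile PHead b) (PSeq PTail PHead))) => t.
apply: EvalSeq (hf t) _; apply: EvalSeq.
  by apply: hloop; apply: EvalWhileFalse; constructor.
by apply: EvalSeq; constructor.
Qed.

Definition tree_rev (t : tree) := foldl (fun acc x => Node x acc) Nil (spine t).

Lemma tcomp_rev : tree_computable tree_rev.
Proof.
apply: (@tcomp_foldl (fun z => Node (thd z) (thd (ttl z))) id (fun=> Nil));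
  by tcomp_tac.
Qed.

Lemma trev_code s : tree_rev (code_list s) = code_list (rev s).
Proof.
have tl l : spine (code_list l) = l by elim: l => //= x l ->.
rewrite /tree_rev tl /rev -[Nil in LHS]/(code_list [::]).
by elim: s [::] => //= x s IH acc; rewrite -IH.
Qed.

Lemma tlist_code s : spine (code_list s) = s.
Proof. by elim: s => //= x s ->. Qed.

(** * Computable functions on coded data *)

Lemma code_list_inj : injective code_list.
Proof. by elim=> [|x s IH] [|y t] //= [-> /IH ->]. Qed.

Lemma code_nat_inj : injective code_nat.
Proof. by elim=> [|n IH] [|m] //= [/IH ->]. Qed.

(** Injectivity lets equality of data be tested on their codes. *)
Class Enc (T : Type) := { code : T -> tree; code_inj : injective code }.

#[export] Instance enc_tree : Enc tree.
Proof. by exists id. Defined.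

#[export] Instance enc_unit : Enc unit.
Proof. by exists (fun=> Nil) => -[] []. Defined.

#[export] Instance enc_nat : Enc nat.
Proof. by exists code_nat; exact: code_nat_inj. Defined.

#[export] Instance enc_bool : Enc bool.
Proof. by exists (fun b : bool => if b then Node Nil Nil else Nil) => -[] []. Defined.

#[export] Instance enc_prod X Y (eX : Enc X) (eY : Enc Y) : Enc (X * Y).
Proof.
exists (fun z => Node (code z.1) (code z.2)).
by move=> [a b] [c d] /= [h1 h2]; rewrite (code_inj h1) (code_inj h2).
Defined.

#[export] Instance enc_seq X (eX : Enc X) : Enc (seq X).
Proof.
exists (fun s => code_list (map code s)).
by move=> s t /code_list_inj /(inj_map code_inj).
Defined.

#[export] Instance enc_option X (eX : Enc X) : Enc (option X).
Proof.
exists (fun o => if o is Some x then Node Nil (code x) else Nil).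
by move=> [x|] [y|] // [h]; rewrite (code_inj h).
Defined.

(** In the closure lemmas the source type is an environment: a bound variable becomes a further
    component of a pair, so that terms with binders are treated compositionally. *)
Variant computable X Y {eX : Enc X} {eY : Enc Y} (f : X -> Y) : Prop :=
| Comp F of tree_computable F & (forall x, F (code x) = code (f x)).

Lemma comp_ext {E} {eE : Enc E} X {eX : Enc X} (f g : E -> X) : f =1 g ->
  computable f -> computable g.
Proof. by move=> fg [F hF h]; exists F => // x; rewrite h fg. Qed.

Lemma comp_var {E} {eE : Enc E} : computable (fun e : E => e).
Proof. by exists id => //; exact: tcomp_id. Qed.

Lemma comp_const {E} {eE : Enc E} X {eX : Enc X} (c : X) : computable (fun _ : E => c).
Proof. by exists (fun=> code c) => //; exact: tcomp_const. Qed.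

Lemma comp_comp {E} {eE : Enc E} X {eX : Enc X} Y {eY : Enc Y} (f : X -> Y) (g : E -> X) :
  computable f -> computable g -> computable (fun e => f (g e)).
Proof.
move=> [F hF hf] [G hG hg]; exists (fun t => F (G t)); first exact: tcomp_comp.
by move=> x; rewrite hg hf.
Qed.

Lemma comp_pair {E} {eE : Enc E} X {eX : Enc X} Y {eY : Enc Y} (f : E -> X) (g : E -> Y) :
  computable f -> computable g -> computable (fun e => (f e, g e)).
Proof.
move=> [F hF hf] [G hG hg]; exists (fun t => Node (F t) (G t)).
  exact: tcomp_node.
by move=> x; rewrite hf hg.
Qed.

Lemma comp_fst {E} {eE : Enc E} X {eX : Enc X} Y {eY : Enc Y} (f : E -> X * Y) :
  computable f -> computable (fun e => (f e).1).
Proof.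
by move=> [F hF hf]; exists (fun t => thd (F t)); [exact: tcomp_hd | move=> x; rewrite hf].
Qed.

Lemma comp_snd {E} {eE : Enc E} X {eX : Enc X} Y {eY : Enc Y} (f : E -> X * Y) :
  computable f -> computable (fun e => (f e).2).
Proof.
by move=> [F hF hf]; exists (fun t => ttl (F t)); [exact: tcomp_tl | move=> x; rewrite hf].
Qed.

Lemma comp_if {E} {eE : Enc E} X {eX : Enc X} (b : E -> bool) (f g : E -> X) :
  computable b -> computable f -> computable g -> computable (fun e => if b e then f e else g e).
Proof.
move=> [B hB hb] [F hF hf] [G hG hg]; exists (fun t => tree_case (B t) (F t) (G t)).
  exact: tcomp_case.
by move=> x; rewrite hf hg hb /=; case: (b x).
Qed.

Lemma comp_node {E} {eE : Enc E} (f g : E -> tree) :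
  computable f -> computable g -> computable (fun e => Node (f e) (g e)).
Proof.
move=> [F hF hf] [G hG hg]; exists (fun t => Node (F t) (G t)).
  exact: tcomp_node.
by move=> x; rewrite hf hg.
Qed.

Lemma comp_thd {E} {eE : Enc E} (f : E -> tree) : computable f ->
  computable (fun e => thd (f e)).
Proof.
by move=> [F hF hf]; exists (fun t => thd (F t)); [exact: tcomp_hd | move=> x; rewrite hf].
Qed.

Lemma comp_ttl {E} {eE : Enc E} (f : E -> tree) : computable f ->
  computable (fun e => ttl (f e)).
Proof.
by move=> [F hF hf]; exists (fun t => ttl (F t)); [exact: tcomp_tl | move=> x; rewrite hf].
Qed.

Lemma comp_code {E} {eE : Enc E} X {eX : Enc X} (f : E -> X) : computable f ->
  computable (fun e => code (f e)).
Proof. by move=> [F hF hf]; exists F. Qed.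

Lemma comp_cons {E} {eE : Enc E} X {eX : Enc X} (f : E -> X) (g : E -> seq X) :
  computable f -> computable g -> computable (fun e => f e :: g e).
Proof.
move=> [F hF hf] [G hG hg]; exists (fun t => Node (F t) (G t)).
  exact: tcomp_node.
by move=> x; rewrite hf hg.
Qed.

Lemma comp_some {E} {eE : Enc E} X {eX : Enc X} (f : E -> X) : computable f ->
  computable (fun e => Some (f e)).
Proof.
move=> [F hF hf]; exists (fun t => Node Nil (F t)); last by move=> x; rewrite hf.
by apply: tcomp_node => //; exact: tcomp_const.
Qed.

Lemma comp_succ {E} {eE : Enc E} (f : E -> nat) : computable f ->
  computable (fun e => (f e).+1).
Proof.
move=> [F hF hf]; exists (fun t => Node Nil (F t)); last by move=> x; rewrite hf.
by apply: tcomp_node => //; exact: tcomp_const.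
Qed.

Lemma comp_option {E} {eE : Enc E} X {eX : Enc X} Y {eY : Enc Y} (o : E -> option X)
    (f : X -> E -> Y) (g : E -> Y) :
  computable o -> computable (fun z : X * E => f z.1 z.2) -> computable g ->
  computable (fun e => if o e is Some x then f x e else g e).
Proof.
move=> [O hO ho] [F hF hf] [G hG hg].
exists (fun t => tree_case (O t) (F (Node (ttl (O t)) t)) (G t)).
  apply: tcomp_case => //; apply: (tcomp_comp hF); apply: tcomp_node.
    exact: tcomp_tl.
  exact: tcomp_id.
move=> x; rewrite ho hg; case: (o x) => [y|] //=.
exact: (hf (y, x)).
Qed.

Lemma comp_foldl {E} {eE : Enc E} X {eX : Enc X} Y {eY : Enc Y} (f : X -> Y -> E -> Y)
    (l : E -> seq X) (i : E -> Y) :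
  computable (fun z : X * (Y * E) => f z.1 z.2.1 z.2.2) -> computable l -> computable i ->
  computable (fun e => foldl (fun acc x => f x acc e) (i e) (l e)).
Proof.
move=> [F hF hf] [L hL hl] [I hI hi]; eexists; first exact: tcomp_foldl hF hL hI.
move=> e /=; rewrite hl hi /= tlist_code.
by elim: (l e) (i e) => //= x s IH acc; rewrite -IH (hf (x, (acc, e))).
Qed.

Lemma comp_rev {E} {eE : Enc E} X {eX : Enc X} (l : E -> seq X) : computable l ->
  computable (fun e => rev (l e)).
Proof.
move=> [L hL hl]; exists (fun t => tree_rev (L t)); first exact: tcomp_comp tcomp_rev hL.
by move=> x; rewrite hl /= trev_code map_rev.
Qed.

Lemma comp_foldr {E} {eE : Enc E} X {eX : Enc X} Y {eY : Enc Y} (f : X -> Y -> E -> Y)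
    (l : E -> seq X) (i : E -> Y) :
  computable (fun z : X * (Y * E) => f z.1 z.2.1 z.2.2) -> computable l -> computable i ->
  computable (fun e => foldr (fun x acc => f x acc e) (i e) (l e)).
Proof.
move=> hf hl hi; apply: comp_ext (comp_foldl hf (comp_rev hl) hi) => e.
by rewrite foldl_rev.
Qed.

(** A unary number has the same code as a list of that many units, so iteration is a fold. *)
Lemma comp_iter {E} {eE : Enc E} Y {eY : Enc Y} (f : Y -> E -> Y) (n : E -> nat) (i :
  E -> Y) :
  computable (fun z : Y * E => f z.1 z.2) -> computable n -> computable i ->
  computable (fun e => iter (n e) (fun y => f y e) (i e)).
Proof.
move=> hf [N hN hn] hi.
have hu : computable (fun e => nseq (n e) tt).
  exists N => // e; rewrite hn /=; elim: (n e) => //= k -> //.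
have hf' : computable (fun z : unit * (Y * E) => f z.2.1 z.2.2).
  exact: (comp_comp (f := fun z : Y * E => f z.1 z.2) hf (comp_snd comp_var)).
apply: comp_ext (comp_foldr (f := fun _ => f) hf' hu hi) => e.
by elim: (n e) => //= k ->.
Qed.

Ltac comp_basic :=
  first
  [ exact: comp_var
  | exact: comp_const
  | eassumption
  | apply: comp_fst | apply: comp_snd | apply: comp_pair
  | apply: comp_cons | apply: comp_some | apply: comp_succ | apply: comp_node
  | apply: comp_if | apply: comp_option
  | apply: comp_thd | apply: comp_ttl ].

Ltac comp_more := fail.
Ltac comp_step := first [comp_basic | comp_more].
Ltac comp_tac := repeat comp_step.

Lemma comp_map {E} {eE : Enc E} X {eX : Enc X} Y {eY : Enc Y} (f : X -> E -> Y) (l :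
  E -> seq X) :
  computable (fun z : X * E => f z.1 z.2) -> computable l ->
  computable (fun e => [seq f x e | x <- l e]).
Proof.
move=> hf hl.
apply: comp_ext (comp_foldr (f := fun x acc e => f x e :: acc) _ hl
   (comp_const [::])) => [e|].
  by elim: (l e) => //= x s ->.
apply: comp_cons; last by comp_tac.
by apply: (comp_comp hf (g := fun z : X * (seq Y * E) => (z.1, z.2.2))); comp_tac.
Qed.

Lemma comp_cat {E} {eE : Enc E} X {eX : Enc X} (f g : E -> seq X) :
  computable f -> computable g -> computable (fun e => f e ++ g e).
Proof.
move=> hf hg.
apply: comp_ext (comp_foldr (f := fun x acc _ => x :: acc) _ hf hg) => [e|].
  by elim: (f e) => //= x s ->.
by comp_tac.
Qed.

Lemma comp_behead {E} {eE : Enc E} X {eX : Enc X} (f : E -> seq X) :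
  computable f -> computable (fun e => behead (f e)).
Proof.
move=> [F hF hf]; exists (fun t => ttl (F t)); first exact: tcomp_tl.
by move=> e; rewrite hf; case: (f e).
Qed.

Lemma comp_head {E} {eE : Enc E} X {eX : Enc X} (d : E -> X) (f : E -> seq X) :
  computable d -> computable f -> computable (fun e => head (d e) (f e)).
Proof.
move=> [D hD hd] [F hF hf]; exists (fun t => tree_case (F t) (thd (F t)) (D t)).
  by apply: tcomp_case => //; exact: tcomp_hd.
by move=> e; rewrite hf hd; case: (f e).
Qed.

Lemma comp_nilp {E} {eE : Enc E} X {eX : Enc X} (f : E -> seq X) :
  computable f -> computable (fun e => nilp (f e)).
Proof.
move=> [F hF hf]; exists (fun t => tree_case (F t) Nil (Node Nil Nil)).
  by apply: tcomp_case => //; exact: tcomp_const.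
by move=> e; rewrite hf; case: (f e).
Qed.

Lemma comp_andb {E} {eE : Enc E} (f g : E -> bool) : computable f -> computable g ->
  computable (fun e => f e && g e).
Proof. by move=> hf hg; apply: comp_if => //; exact: comp_const. Qed.

Lemma comp_orb {E} {eE : Enc E} (f g : E -> bool) : computable f -> computable g ->
  computable (fun e => f e || g e).
Proof. by move=> hf hg; apply: comp_if => //; exact: comp_const. Qed.

Lemma comp_negb {E} {eE : Enc E} (f : E -> bool) : computable f ->
  computable (fun e => ~~ f e).
Proof. by move=> hf; apply: comp_if => //; exact: comp_const. Qed.

Lemma comp_nth {E} {eE : Enc E} X {eX : Enc X} (d : E -> X) (l : E -> seq X) (n : E ->
  nat) :
  computable d -> computable l -> computable n -> computable (fun e => nth (d e) (l e) (n e)).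
Proof.
move=> hd hl hn.
apply: comp_ext (comp_head hd
  (comp_iter (f := fun s _ => behead s) _ hn hl)) => [e|].
  rewrite -nth0; elim: (n e) (l e) => //= k IH s.
  by rewrite -iterS iterSr IH nth_behead.
by apply: comp_behead; comp_tac.
Qed.

Lemma comp_size {E} {eE : Enc E} X {eX : Enc X} (l : E -> seq X) : computable l ->
  computable (fun e => size (l e)).
Proof.
move=> hl; apply: comp_ext (comp_foldr (f := fun _ n _ => n.+1) _ hl
  (comp_const 0)) => [e|]; last by comp_tac.
by elim: (l e) => //= x s ->.
Qed.

Lemma comp_iota0 {E} {eE : Enc E} (n : E -> nat) : computable n ->
  computable (fun e => iota 0 (n e)).
Proof.
move=> hn; apply: comp_ext (comp_iter
  (f := fun s _ => rcons s (size s)) _ hn (comp_const [::])) => [e|].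
  by elim: (n e) => // k IH; rewrite iterS IH size_iota -addn1 iotaD cats1.
apply: (comp_ext (f := fun z : seq nat * E => z.1 ++ [:: size z.1])) => [z|].
  by rewrite cats1.
by apply: comp_cat; [comp_tac | apply: comp_cons; [apply: comp_size|]; comp_tac].
Qed.

Lemma comp_flatten {E} {eE : Enc E} X {eX : Enc X} (l : E -> seq (seq X)) :
  computable l -> computable (fun e => flatten (l e)).
Proof.
move=> hl; apply: comp_ext (comp_foldr (f := fun x acc _ => x ++ acc) _ hl
  (comp_const [::])) => [//|].
by apply: comp_cat; comp_tac.
Qed.

Lemma comp_filter {E} {eE : Enc E} X {eX : Enc X} (f : X -> E -> bool) (l : E -> seq X) :
  computable (fun z : X * E => f z.1 z.2) -> computable l ->
  computable (fun e => [seq x <- l e | f x e]).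
Proof.
move=> hf hl.
apply: comp_ext (comp_foldr (f := fun x acc e => if f x e then x :: acc else acc) _
  hl (comp_const [::])) => [e|].
  by elim: (l e) => //= x s ->.
apply: comp_if; [|by comp_tac..].
by apply: (comp_comp hf (g := fun z : X * (seq X * E) => (z.1, z.2.2))); comp_tac.
Qed.

Lemma comp_has {E} {eE : Enc E} X {eX : Enc X} (f : X -> E -> bool) (l : E -> seq X) :
  computable (fun z : X * E => f z.1 z.2) -> computable l ->
  computable (fun e => has (fun x => f x e) (l e)).
Proof.
move=> hf hl.
apply: comp_ext (comp_foldr (f := fun x acc e => f x e || acc) _
  hl (comp_const false)) => [e|].
  by elim: (l e) => //= x s ->.
apply: comp_orb; last by comp_tac.
by apply: (comp_comp hf (g := fun z : X * (bool * E) => (z.1, z.2.2))); comp_tac.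
Qed.

(* A prefix-free code, which reduces equality of trees to equality of bit lists. *)
Fixpoint tree_bits (t : tree) : seq bool :=
  if t is Node a b then true :: tree_bits a ++ tree_bits b else [:: false].

Lemma tree_bits_inj_cat t u x y : tree_bits t ++ x = tree_bits u ++ y -> t = u /\ x = y.
Proof.
elim: t u x y => [|a IHa b IHb] [|c d] x y //=; first by case.
case; rewrite -!catA => /IHa [-> /IHb [-> ->]].
by [].
Qed.

Lemma comp_tree_bits : computable tree_bits.
Proof.
have [C hC hc] : computable (fun z : seq bool * seq bool => true :: z.1 ++ z.2).
  by apply: comp_cons; [comp_tac | apply: comp_cat; comp_tac].
exists (tree_fold (code [:: false]) (fun t => C (ttl t))).
  by apply: tcomp_tree_fold; apply: (tcomp_comp hC); exact: tcomp_tl tcomp_id.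
by elim=> //= a IHa b IHb; rewrite [X in Node X]IHa [X in Node _ X]IHb (hc (_, _)).
Qed.

(** A fold over the first list consumes the second one and notes whether the bits agreed; the lists
    are equal when they did and nothing is left over. *)
Lemma comp_eqbits {E} {eE : Enc E} (f g : E -> seq bool) : computable f ->
  computable g -> computable (fun e => f e == g e).
Proof.
move=> hf hg.
pose F (x : bool) (a : seq bool * bool) (_ : E) :=
  (behead a.1, a.2 && (~~ nilp a.1 && (if x then head true a.1 else ~~ head true a.1))).
have hF : computable (fun z : bool * ((seq bool * bool) * E) => F z.1 z.2.1 z.2.2).
  apply: comp_pair; first by apply: comp_behead; comp_tac.
  apply: comp_andb; first by comp_tac.
  apply: comp_andb; first by apply: comp_negb; apply: comp_nilp; comp_tac.
  by apply: comp_if; [|apply: comp_head|apply: comp_negb; apply: comp_head]; comp_tac.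
have := comp_foldl hF hf (comp_pair hg (comp_const true)) => h.
have {}h := comp_andb (comp_snd h) (comp_nilp (comp_fst h)).
apply: comp_ext h => e; rewrite /=.
have -> b : (foldl (fun acc x => F x acc e) (g e, b) (f e)).2 &&
       nilp (foldl (fun acc x => F x acc e) (g e, b) (f e)).1 = b && (f e == g e).
  elim: (f e) (g e) b => [|x s IH] [|y t] b //=; rewrite IH /=.
    by rewrite !andbF.
  by rewrite eqseq_cons andbA; congr (_ && _ && _); case: x y => [] [].
by [].
Qed.

Lemma comp_eq {E} {eE : Enc E} (X : eqType) {eX : Enc X} (f g : E -> X) :
  computable f -> computable g -> computable (fun e => f e == g e).
Proof.
move=> hf hg.
have hs (h : E -> X) : computable h -> computable (fun e => tree_bits (code (h e))).
  move=> H; apply: (comp_comp comp_tree_bits (g := fun e => code (h e))).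
  exact: comp_code.
apply: comp_ext (comp_eqbits (hs _ hf) (hs _ hg)) => e /=.
apply/eqP/eqP => [|-> //] h; apply: code_inj.
by have /tree_bits_inj_cat [] : tree_bits (code (f e)) ++ [::] = tree_bits (code (g e)) ++ [::] by rewrite h.
Qed.

Lemma comp_mem {E} {eE : Enc E} (X : eqType) {eX : Enc X} (f : E -> X) (l : E -> seq X) :
  computable f -> computable l -> computable (fun e => f e \in l e).
Proof.
move=> hf hl.
apply: comp_ext (comp_has (f := fun x e => x == f e) _ hl) => [e|].
  by rewrite -(eq_has (a1 := pred1 (f e))) ?has_pred1.
apply: comp_eq; first by comp_tac.
by apply: (comp_comp hf (g := fun z : X * E => z.2)); comp_tac.
Qed.

Ltac comp_more ::= first
  [ apply: comp_map | apply: comp_filter | apply: comp_cat | apply: comp_flatten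
  | apply: comp_andb | apply: comp_orb | apply: comp_negb | apply: comp_eq
  | apply: comp_mem | apply: comp_has | apply: comp_iota0 | apply: comp_size
  | apply: comp_nth | apply: comp_foldr | apply: comp_iter ].

(** * Infinite combinatorics *)

Definition truth (Q : Prop) : bool := if excluded_middle_informative Q then true else false.

Lemma truthP Q : reflect Q (truth Q).
Proof. by rewrite /truth; case: excluded_middle_informative => h; constructor. Qed.

Lemma choiceP T U (R : T -> U -> Prop) :
  (forall x, exists y, R x y) -> exists f, forall x, R x (f x).
Proof.
move=> h; exists (fun x => proj1_sig (constructive_indefinite_description _ (h x))).
by move=> x; exact: proj2_sig.
Qed.

Lemma dep_choice T (I : nat -> T -> Prop) (R : nat -> T -> T -> Prop) x0 :
  I 0 x0 -> (forall n x, I n x -> exists y, I n.+1 y /\ R n x y) ->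
  exists f, [/\ f 0 = x0, forall n, I n (f n) & forall n, R n (f n) (f n.+1)].
Proof.
move=> h0 hs.
have [|g hg] := @choiceP (nat * T) T
    (fun z y => I z.1 z.2 -> I z.1.+1 y /\ R z.1 z.2 y).
  move=> [n x]; case: (classic (I n x)) => [/hs [y hy]|h].
    by exists y.
  (* Outside the invariant any value will do; this makes the choice function total. *)
  by exists x.
pose f := fix f n := if n is k.+1 then g (k, f k) else x0.
have hI n : I n (f n) by elim: n => //= n /(hg (n, _)) [].
by exists f; split=> // n; have [] := hg (n, _) (hI n).
Qed.

Definition unbounded (X : nat -> Prop) := forall n, exists2 m, n <= m & X m.

Lemma unbounded_seq X : unbounded X ->
  exists g : nat -> nat, (forall a, g a < g a.+1) /\ forall a, X (g a).
Proof.
move=> hX; have [x0 _ hx0] := hX 0.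
have [f [_ h1 h2]] := @dep_choice nat (fun _ => X) (fun _ x y => x < y) x0 hx0
  (fun n x _ => let: ex_intro2 y h1 h2 := hX x.+1 in ex_intro _ y (conj h2 h1)).
by exists f.
Qed.

Lemma incr_lt (g : nat -> nat) : (forall a, g a < g a.+1) -> {homo g : a b / a < b}.
Proof. by move=> h; apply: homo_ltn => // x y z; exact: ltn_trans. Qed.

Lemma incr_le (g : nat -> nat) : (forall a, g a < g a.+1) -> {homo g : a b / a <= b}.
Proof. by move=> h; apply: homo_leq => //; [exact: leq_trans | move=> a; exact: ltnW]. Qed.

Lemma incr_ge (g : nat -> nat) : (forall a, g a < g a.+1) -> forall a, a <= g a.
Proof. by move=> h; elim=> // a IH; exact: leq_ltn_trans IH (h a). Qed.

Lemma pigeonhole (C : eqType) (l : seq C) (f : nat -> C) X :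
  unbounded X -> (forall n, X n -> f n \in l) ->
  exists c, unbounded (fun m => X m /\ f m = c).
Proof.
elim: l X => [|c l IH] X hX hl.
  by have [m _ /hl] := hX 0.
case: (classic (unbounded (fun m => X m /\ f m = c))) => [h|]; first by exists c.
move=> /not_all_ex_not [N hN].
have [|n [hn hXn]|d hd] := IH (fun m => N <= m /\ X m).
- move=> n; have [m] := hX (maxn n N); rewrite geq_max => /andP[h1 h2] h3.
  by exists m.
- have := hl _ hXn; rewrite inE => /orP[/eqP e|//].
  by case: hN; exists n.
by exists d => n; have [m h1 [[_ h2] h3]] := hd n; exists m.
Qed.

(** Each triple [t a] holds a point, a colour and an unbounded set of later points joined to the
    point by that colour; the next triple is chosen inside this set. Pairs with a common first point
    then have one colour, and a pigeonhole on these colours leaves a homogeneous subsequence. *)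
Lemma ramsey (C : eqType) (l : seq C) (f : nat -> nat -> C) X :
  unbounded X -> (forall i j, f i j \in l) ->
  exists c (g : nat -> nat), [/\ forall a, g a < g a.+1, forall a, X (g a)
    & forall a b, a < b -> f (g a) (g b) = c].
Proof.
move=> hX hl; have [x0 _ hx0] := hX 0.
pose T := (nat * C * (nat -> Prop))%type.
pose I (t : T) := [/\ X t.1.1, unbounded t.2,
  forall y, t.2 y -> t.1.1 < y /\ X y & forall y, t.2 y -> f t.1.1 y = t.1.2].
pose R (t u : T) := t.2 u.1.1 /\ forall y, u.2 y -> t.2 y.
have next (Y : nat -> Prop) : unbounded Y -> (forall y, Y y -> X y) ->
    exists t : T, [/\ I t, Y t.1.1 & forall y, t.2 y -> Y y].
  move=> hY YX; have [x _ hx] := hY 0.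
  have [|y [xy hy]|c hc] := @pigeonhole C l (f x) (fun y => x < y /\ Y y); last 1 first.
  - exists (x, c, fun m => (x < m /\ Y m) /\ f x m = c); split=> //=; last by move=> y [[]].
    by split=> //=; [exact: YX | move=> y [[h1 /YX]] | move=> y []].
  - by move=> n; have [m h1 h2] := hY (maxn n x.+1);
      exists m; move: h1; rewrite geq_max => /andP[].
  exact: hl.
have [t0 [ht0 _ _]] := next X hX (fun _ => id).
have [|t [_ hI hR]] := @dep_choice T (fun _ => I) (fun _ => R) t0 ht0.
  move=> _ u [h1 h2 h3 h4]; have [v [hv1 hv2 hv3]] := next u.2 h2 (fun y hy => (h3 y hy).2).
  by exists v.
have hsub a b y : a <= b -> (t b).2 y -> (t a).2 y.
  by move=> /subnK <-; elim: (b - a) => //= n IH h; apply: IH; apply: (hR _).2.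
have hin a b : a < b -> (t a).2 (t b).1.1.
  by case: b => // b; rewrite ltnS => ab; apply: hsub ab _; exact: (hR b).1.
have [|n _|c hc] := @pigeonhole C l (fun a => (t a).1.2) (fun _ => True).
- by move=> n; exists n.
- case: (hI n) => _ hu _ h; have [y _ hy] := hu 0.
  by rewrite -(h _ hy).
have [g [g1 g2]] := unbounded_seq hc.
exists c, (fun a => (t (g a)).1.1); split.
- by move=> a; case: (hI (g a)) => _ _ h _; apply: (h _ _).1; exact: hin.
- by move=> a; case: (hI (g a)).
move=> a b ab; case: (hI (g a)) => _ _ _ ->; first exact: (g2 a).2.
exact/hin/incr_lt.
Qed.

(** * Automata and their runs *)

Inductive kind := Kcall | Kret | Kloc.

(* An automaton is given by the lists of its initial states, final states, call,
   return and local transitions: with lists over nat, say, it is a datum that a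
   program can process. The kind of a letter is a separate parameter, and
   transitions that do not match the kind of their letter are never taken. *)
Notation aut L Q G := (seq Q * seq Q * seq (Q * L * Q * G) *
  seq (Q * L * option G * Q) * seq (Q * L * Q))%type.
Notation ini A := A.1.1.1.1 (only parsing).
Notation fin A := A.1.1.1.2 (only parsing).
Notation cal A := A.1.1.2 (only parsing).
Notation ret A := A.1.2 (only parsing).
Notation loc A := A.2 (only parsing).

Section Semantics.

Variables (L Q G : eqType) (kd : L -> kind) (A : aut L Q G).
Implicit Types (w : nat -> L) (c : Q * seq G) (k l m : nat).

Definition astep (a : L) c c' : Prop :=
  match kd a with
  | Kcall => exists X, c'.2 = X :: c.2 /\ (c.1, a, c'.1, X) \in cal A
  | Kret =>
      if c.2 is X :: u then c'.2 = u /\ (c.1, a, Some X, c'.1) \in ret A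
      else c'.2 = [::] /\ (c.1, a, None, c'.1) \in ret A
  | Kloc => c'.2 = c.2 /\ (c.1, a, c'.1) \in loc A
  end.

Definition arun w (r : nat -> Q * seq G) := forall i, astep (w i) (r i) (r i.+1).

Definition acc w c := exists r, [/\ r 0 = c, arun w r
  & unbounded (fun m => (r m).1 \in fin A)].

Definition alang w := exists2 q, q \in ini A & acc w (q, [::]).

(* The flag records whether a final state occurs before the last position. *)
Inductive apath w k c : nat -> Q * seq G -> bool -> Prop :=
| PathNil : apath w k c k c false
| PathStep l c' c'' b : apath w k c l c' b -> astep (w l) c' c'' ->
    apath w k c l.+1 c'' (b || (c'.1 \in fin A)).

Lemma apath_le w k c l c' b : apath w k c l c' b -> k <= l.
Proof. by elim=> // *; exact: leqW. Qed.

Lemma apath_nilE w k c c' b : apath w k c k c' b -> c = c' /\ b = false.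
Proof.
move e: {2}k => l h; case: h e => // l' c1 c2 b' /apath_le kl _ e.
by move: kl; rewrite e ltnn.
Qed.

Lemma apath_stepE w k c l c'' b : apath w k c l.+1 c'' b -> k <= l ->
  exists c' b', [/\ apath w k c l c' b', astep (w l) c' c'' & b = b' || (c'.1 \in fin A)].
Proof.
move e: l.+1 => l' h; case: h e => [<-|l1 c1 c2 b' h1 h2 [e] _]; first by rewrite ltnn.
by subst l1; exists c1, b'.
Qed.

Lemma apath_cat w k l m c c' c'' b1 b2 :
  apath w k c l c' b1 -> apath w l c' m c'' b2 -> apath w k c m c'' (b1 || b2).
Proof.
move=> h1; elim=> [|m' d d' b h IH s]; first by rewrite orbF.
by rewrite orbA; apply: PathStep IH s.
Qed.

Lemma apath_split w k l m c c'' b : apath w k c m c'' b -> k <= l <= m ->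
  exists c' b1 b2, [/\ apath w k c l c' b1, apath w l c' m c'' b2 & b = b1 || b2].
Proof.
elim=> [|m' d d' b' h IH s]; last first.
  case/andP=> kl; rewrite leq_eqVlt => /orP[/eqP -> |].
    exists d', (b' || (d.1 \in fin A)), false; split; [exact: PathStep h s|exact: PathNil|].
    by rewrite orbF.
  rewrite ltnS => lm; have [|c' [b1 [b2 [h1 h2 ->]]]] := IH; first by rewrite kl.
  exists c', b1, (b2 || (d.1 \in fin A)); split=> //; first exact: PathStep h2 s.
  by rewrite orbA.
rewrite -eqn_leq => /eqP <-; exists c, false, false; split=> //; exact: PathNil.
Qed.

Lemma apath_run w (r : nat -> Q * seq G) k l : arun w r -> k <= l ->
  exists b, [/\ apath w k (r k) l (r l) b &
    forall m, k <= m < l -> (r m).1 \in fin A -> b].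
Proof.
move=> hr; elim: l => [|l IH]; rewrite ?leqn0.
  by move=> /eqP ->; exists false; split; [exact: PathNil | case].
rewrite leq_eqVlt => /orP[/eqP <-|].
  exists false; split; first exact: PathNil.
  by move=> m; case: ltngtP.
rewrite ltnS => /IH [b [h1 h2]]; exists (b || ((r l).1 \in fin A)); split.
  exact: PathStep h1 (hr l).
move=> m /andP[km]; rewrite ltnS leq_eqVlt => /orP[/eqP -> ->|ml hm]; first by rewrite orbT.
by rewrite (h2 m) // km.
Qed.

Lemma path_run w k c l c' b : apath w k c l c' b ->
  exists r : nat -> Q * seq G, [/\ r k = c, r l = c',
    forall i, k <= i < l -> astep (w i) (r i) (r i.+1)
    & b -> exists2 m, k <= m < l & (r m).1 \in fin A].
Proof.
elim=> [|m d d' b' h [r [h1 h2 h3 h4]] s].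
  by exists (fun=> c); split=> // i; case: ltngtP.
have km := apath_le h.
have E i : i <= m -> (i == m.+1) = false by move=> im; rewrite ltn_eqF.
exists (fun i => if i == m.+1 then d' else r i); split.
- by rewrite E.
- by rewrite eqxx.
- move=> i /andP[ki]; rewrite ltnS => im; rewrite E // eqSS.
  move: im; rewrite leq_eqVlt => /orP[/eqP ->|im]; first by rewrite eqxx h2.
  by rewrite (ltn_eqF im); apply: h3; rewrite ki.
case/orP=> [/h4 [n /andP[kn nm] hn]|hd].
  by exists n; rewrite ?kn 1?ltnW // E // ltnW.
by exists m; rewrite ?km ?ltnS ?leqnn // E // h2.
Qed.

Lemma run_path w (r : nat -> Q * seq G) k l : k <= l ->
  (forall i, k <= i < l -> astep (w i) (r i) (r i.+1)) ->
  exists b, apath w k (r k) l (r l) b.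
Proof.
elim: l => [|l IH]; first by rewrite leqn0 => /eqP -> _; exists false; exact: PathNil.
rewrite leq_eqVlt => /orP[/eqP <- _|]; first by exists false; exact: PathNil.
rewrite ltnS => kl h; have [|b hb] := IH kl.
  by move=> i /andP[ki il]; apply: h; rewrite ki ltnW.
by exists (b || ((r l).1 \in fin A)); apply: PathStep hb (h _ _); rewrite kl ltnSn.
Qed.

(** For [J] increasing from 0, the index [a] with [J a <= i < J a.+1], found by counting the cuts
    passed so far. *)
Fixpoint block (J : nat -> nat) i :=
  if i is i'.+1
  then let b := block J i' in if J b.+1 == i then b.+1 else b
  else 0.

Lemma blockP (J : nat -> nat) : (forall a, J a < J a.+1) -> J 0 = 0 ->
  forall i, J (block J i) <= i < J (block J i).+1.
Proof.
move=> hJ h0; elim=> [|i /= /andP[h1 h2]]; first by have := hJ 0; rewrite /= h0.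
case: eqP => [h|/eqP h]; first by have := hJ (block J i).+1; rewrite h leqnn.
by rewrite ltn_neqAle eq_sym h h2 leqW.
Qed.

Lemma block_uniq (J : nat -> nat) : (forall a, J a < J a.+1) -> J 0 = 0 ->
  forall a m, J a <= m < J a.+1 -> block J m = a.
Proof.
move=> hJ h0 a m /andP[h1 h2]; have /andP[h3 h4] := blockP hJ h0 m.
have hlt (b c : nat) : J b <= m -> m < J c.+1 -> b <= c.
  move=> hb1 hc; rewrite -ltnS ltnNge; apply/negP => /(incr_le hJ) h.
  by have := leq_ltn_trans (leq_trans h hb1) hc; rewrite ltnn.
by apply/eqP; rewrite eqn_leq (hlt _ _ h3 h2) (hlt _ _ h1 h4).
Qed.

End Semantics.

(** The flag of a path leaves out the last position, so a final state that it reports lies within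
    the block, where the glued run follows that path. *)
Lemma apath_glue (L Q G : eqType) (kd : L -> kind) (A : aut L Q G) w
    (J : nat -> nat) (C : nat -> Q * seq G) (f : nat -> bool) :
  (forall a, J a < J a.+1) -> J 0 = 0 ->
  (forall a, apath kd A w (J a) (C a) (J a.+1) (C a.+1) (f a)) ->
  unbounded (fun a => f a) -> acc kd A w (C 0).
Proof.
move=> hJ h0 hC hf.
have [r hr] := choiceP (fun a => path_run (hC a)).
have hb := blockP hJ h0.
have hend i : r (block J i) i.+1 = r (block J i.+1) i.+1.
  rewrite /=; case: eqP => // <-.
  by case: (hr (block J i)) => _ -> _ _; case: (hr (block J i).+1) => ->.
have blockJ a m := block_uniq hJ h0 (a := a) (m := m).
exists (fun i => r (block J i) i); split.
- by rewrite /=; case: (hr 0) => <- _ _ _; rewrite h0.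
- by move=> i; rewrite -hend; case: (hr (block J i)) => _ _ h _; exact: h.
move=> n; have [a na fa] := hf n; case: (hr a) => _ _ _ /(_ fa) [m hm hF].
exists m; last by rewrite (blockJ a).
by case/andP: hm => hm _; apply: leq_trans (leq_trans na (incr_ge hJ a)) hm.
Qed.

(** * Pending calls and stairs *)

Section Pending.

Variables (L : eqType) (kd : L -> kind) (w : nat -> L).
Implicit Types k l m c i : nat.

(** The calls of [[k, l)] that are unmatched before [l], the innermost one first; a return without a
    matching call in the segment leaves the list empty. Only the word matters, not a run. *)
Fixpoint pend k l : seq nat :=
  if l is l'.+1 then
    if l' < k then [::] else
    match kd (w l') with
    | Kcall => l' :: pend k l' | Kret => behead (pend k l') | Kloc => pend k l'
    end
  else [::].

(** Expresses that no return of [[k, l)] reaches below the stack present at [k]. *)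
Definition clean k l := forall i, k <= i < l -> kd (w i) = Kret -> pend k i <> [::].

Lemma pendS k l : k <= l -> pend k l.+1 = match kd (w l) with
    | Kcall => l :: pend k l | Kret => behead (pend k l) | Kloc => pend k l end.
Proof. by rewrite /= ltnNge => ->. Qed.

Lemma pend_nil k l : l <= k -> pend k l = [::].
Proof. by case: l => //= l ->. Qed.

Arguments pend : simpl never.

Lemma clean_kk k : clean k k.
Proof. by move=> i; case: ltngtP. Qed.

Lemma cleanS k l : clean k l.+1 -> clean k l.
Proof. by move=> h i /andP[ki il]; apply: h; rewrite ki ltnW. Qed.

Lemma clean_sub k l m : l <= m -> clean k m -> clean k l.
Proof. by move=> lm h i /andP[ki il]; apply: h; rewrite ki (leq_trans il). Qed.

Lemma pend_cat k l m : k <= l -> l <= m -> clean l m -> pend k m = pend l m ++ pend k l.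
Proof.
move=> kl; elim: m => [|m IH]; first by rewrite leqn0 => /eqP e _; subst l.
rewrite leq_eqVlt => /orP[/eqP <- _|]; first by rewrite (@pend_nil l l).
rewrite ltnS => lm hc; have {}IH := IH lm (cleanS hc).
rewrite !pendS ?(leq_trans kl) // IH.
have := hc m; rewrite lm leqnn /=; case: (kd (w m)) => // /(_ isT erefl).
by case: (pend l m).
Qed.

Lemma pend_restart k l m : k <= l -> l <= m -> pend k l = [::] -> pend k m = pend l m.
Proof.
move=> kl lm h; elim: m lm => [|m IH]; first by rewrite leqn0 => /eqP e; subst l.
rewrite leq_eqVlt => /orP[/eqP <-|]; first by rewrite h pend_nil.
by rewrite ltnS => lm; rewrite !pendS ?(leq_trans kl) // IH.
Qed.

(** A return at [l] removes the top call [x]; the call below it is the top one at [x], which lies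
    before [l]. Hence the strong induction. *)
Lemma pend_cons k l c s : pend k l = c :: s ->
  [/\ k <= c < l, kd (w c) = Kcall, s = pend k c, clean c.+1 l & pend c.+1 l = [::]].
Proof.
elim/ltn_ind: l c s => -[//|l] IH c s.
case: (leqP k l) => [kl|lk]; last by rewrite pend_nil.
rewrite pendS //; case e: (kd (w l)).
- by move=> [<- <-]; split=> //; [rewrite kl /= | exact: clean_kk | rewrite pend_nil].
- case e1: (pend k l) => [//|x s1] /= es1; subst s1.
  have [/andP[kx xl] hx /esym e2 cl1 p1] := IH l (ltnSn l) _ _ e1.
  have [/andP[kc cx] hc -> cl2 p2] := IH x (leqW xl) _ _ e2.
  have px : pend c.+1 x.+1 = [:: x] by rewrite pendS // hx p2.
  have pm m : x < m <= l -> pend c.+1 m = pend x.+1 m ++ [:: x].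
    move=> /andP[h1 h2]; rewrite -px; apply: pend_cat => //; first exact: leqW.
    exact: clean_sub h2 cl1.
  split=> //; first by rewrite kc ltnS ltnW // (ltn_trans cx).
  - move=> m /andP[cm]; rewrite ltnS => ml hm.
    have [mx|xm|mx] := ltngtP m x; first by apply: cl2; rewrite ?cm.
      by rewrite pm ?xm //; case: (pend _ _).
    by move: hm; rewrite mx hx.
  - by rewrite pendS ?(leq_trans cx) 1?ltnW // e pm ?xl ?leqnn // p1.
move=> /IH [//|/andP[kc cl] hc -> cl1 p1]; split=> //.
- by rewrite kc ltnW.
- move=> m /andP[cm]; rewrite ltnS leq_eqVlt => /orP[/eqP -> |ml]; first by rewrite e.
  by apply: cl1; rewrite cm.
by rewrite pendS // e.
Qed.

Definition stair l := pend 0 l = [::] \/ forall m, clean l m.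

(** If the stack is empty only finitely often, take a position of minimal height beyond those and
    beyond [n]: a later return reaching below it would leave a smaller height. *)
Lemma unbounded_stair : unbounded stair.
Proof.
case: (classic (unbounded (fun l => pend 0 l = [::]))) => [h n|].
  by have [m h1 h2] := h n; exists m => //; left.
move=> /not_all_ex_not [N hN] n.
pose M := maxn N n.
have [l [h1 h2]] : exists l, M <= l /\ forall m, M <= m -> size (pend 0 l) <= size (pend 0 m).
  pose P s := truth (exists2 m, M <= m & size (pend 0 m) = s).
  have hP : exists s, P s by exists (size (pend 0 M)); apply/truthP; exists M.
  case: (ex_minnP hP) => s /truthP [l h1 h2] h3; exists l; split=> // m hm.
  by rewrite h2; apply: h3; apply/truthP; exists m.
exists l; first by apply: leq_trans h1; exact: leq_maxr.
right; elim=> [|m IH] i; rewrite ?ltn0 ?andbF // => /andP[li].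
rewrite ltnS leq_eqVlt => /orP[/eqP ei|im]; last by apply: IH; rewrite li.
subst i => hr hp.
have := h2 m.+1 (leq_trans h1 (leqW li)).
rewrite pendS // hr (pend_cat (leq0n l) li IH) hp cat0s.
case e: (pend 0 l) => [|x s] /=; last by rewrite ltnn.
by case: hN; exists l => //; apply: leq_trans h1; exact: leq_maxl.
Qed.

(** A formula evaluated at [k] sees the word from [k] on only; this is how it can recognise the
    later stairs, provided that [k] is one. *)
Lemma stair_rel k l : stair k -> k <= l ->
  (stair l <-> pend k l = [::] \/ forall m, clean l m).
Proof.
move=> [h|h] kl.
  by rewrite /stair (pend_restart (leq0n k) kl h).
split=> [[]|[]]; try by [right]; last first.
  move=> hp; right => m i /andP[li im] hr hi.
  apply: (h m i) => //; first by rewrite (leq_trans kl).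
  by rewrite (pend_restart kl li hp).
rewrite (pend_cat (leq0n k) kl (h l)); case: (pend k l) => //; by left.
Qed.

Lemma stair0 : stair 0. Proof. by left. Qed.

End Pending.
Arguments pend {L} kd w k l : simpl never.

(** * Profiles *)

Section Frames.

Variables (L Q G : eqType) (kd : L -> kind) (A : aut L Q G) (w : nat -> L).
Implicit Types (k l m i : nat) (q : Q) (st u : seq G).
Local Notation pend := (pend kd w).
Local Notation clean := (clean kd w).
Local Notation apath := (apath kd A w).

(** Visibility: the height of the stack depends on the word and not on the choices of the run. *)
Lemma apath_size k q l c b : apath k (q, [::]) l c b -> size c.2 = size (pend k l).
Proof.
elim=> [|m c1 c2 b' h IH s]; first by rewrite pend_nil.
move: s; rewrite pendS ?(apath_le h) // /astep; case: (kd (w m)).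
- by move=> [X [-> _]] /=; rewrite IH.
- rewrite size_behead -IH; case: (c1.2) => [|X u] [-> _] //=.
by move=> [-> _].
Qed.

(** On a clean segment the initial stack [st] is never inspected, so it can be removed from a path;
    [apath_frame] puts it back. *)
Lemma apath_unframe k q st l c b : apath k (q, st) l c b -> clean k l ->
  exists2 u, c.2 = u ++ st & apath k (q, [::]) l (c.1, u) b.
Proof.
elim=> [_|m c1 c2 b' h IH s hc]; first by exists [::] => //; exact: PathNil.
have [u e hu] := IH (cleanS hc).
have e2 := apath_size hu.
have := hc m; rewrite (apath_le h) leqnn => /(_ isT) hm.
move: s hm; rewrite /astep; case ek: (kd (w m)); first move=> [X [h1 h2]] _.
- exists (X :: u); first by rewrite h1 e.
  by apply: PathStep hu _; rewrite /astep ek; exists X.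
- rewrite e; case: u e hu e2 => [|X u] e hu /= e2 h1 /(_ erefl).
    by case: (pend k m) e2.
  case: h1 => h1 h2 _; exists u => //.
  by apply: PathStep hu _; rewrite /astep ek.
move=> [h1 h2] _; exists u; first by rewrite h1.
by apply: PathStep hu _; rewrite /astep ek.
Qed.

Lemma apath_frame k q st l c b : apath k (q, [::]) l c b -> clean k l ->
  apath k (q, st) l (c.1, c.2 ++ st) b.
Proof.
elim=> [_|m c1 c2 b' h IH s hc]; first exact: PathNil.
have e2 := apath_size h.
have hm := hc m; rewrite (apath_le h) leqnn in hm; have {}hm := hm isT.
apply: PathStep (IH (cleanS hc)) _.
move: s hm; rewrite /astep; case ek: (kd (w m)) => /=; first move=> [X [h1 h2]] _.
- by exists X; rewrite h1.
- case: (c1.2) e2 => [|X u] /= e2; last by move=> [-> h2].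
  by move=> _ /(_ erefl); case: (pend k m) e2.
by move=> [-> h2] _.
Qed.

Lemma apath_restart q st l m c b : apath l (q, st) m c b ->
  (st = [::] \/ clean l m) -> exists u, apath l (q, [::]) m (c.1, u) b.
Proof.
move=> h [e|/(apath_unframe h) [u _ hu]]; last by exists u.
by exists c.2; move: h; rewrite e; case: c.
Qed.

End Frames.

Section Profiles.

Variables (L Q G : eqType).
Implicit Types A : aut L Q G.

(** [Q] may be infinite; this list contains every state that a run from an initial state can
    visit. *)
Definition states A : seq Q :=
  ini A ++ [seq t.1.1.1 | t <- cal A] ++ [seq t.1.2 | t <- cal A] ++
  [seq t.1.1.1 | t <- ret A] ++ [seq t.2 | t <- ret A] ++
  [seq t.1.1 | t <- loc A] ++ [seq t.2 | t <- loc A].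

(** All profiles are filters of this one list. Profiles with the same members are therefore equal as
    lists, and [subseqs] enumerates all candidates. *)
Definition triples A : seq (Q * bool * Q) :=
  [seq (x, q) | x <- [seq (q, b) | q <- states A, b <- [:: true; false]], q <- states A].

Definition id_profile A := [seq t <- triples A | (t.1.1 == t.2) && ~~ t.1.2].

Definition seq_profile A (R1 R2 : seq (Q * bool * Q)) :=
  [seq t <- triples A | has (fun s => (s.1.1 == t.1.1) && has (fun u =>
     [&& u.1.1 == s.2, u.2 == t.2 & t.1.2 == s.1.2 || u.1.2]) R2) R1].

Definition call_profile A a := [seq t <- triples A | (t.1.2 == (t.1.1 \in fin A)) &&
  has (fun d => d.1 == (t.1.1, a, t.2)) (cal A)].

Definition bot_profile A a := [seq t <- triples A | (t.1.2 == (t.1.1 \in fin A)) &&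
  ((t.1.1, a, None, t.2) \in ret A)].

Definition loc_profile A a := [seq t <- triples A | (t.1.2 == (t.1.1 \in fin A)) &&
  ((t.1.1, a, t.2) \in loc A)].

(** The profile of a call [a], a well-matched segment of profile [R] and the return [b] that matches
    the call. *)
Definition match_profile A a (R : seq (Q * bool * Q)) b := [seq t <- triples A |
  has (fun d => (d.1.1 == (t.1.1, a)) && has (fun s => (s.1.1 == d.1.2) &&
    has (fun d' => [&& d'.1 == (s.2, b, Some d.2), d'.2 == t.2 &
      t.1.2 == ((t.1.1 \in fin A) || s.1.2) || (s.2 \in fin A)]) (ret A)) R) (cal A)].

Lemma mem_triples A q b q' :
  ((q, b, q') \in triples A) = (q \in states A) && (q' \in states A).
Proof.
apply/allpairsP/andP => [[[x y] /= [h1 h2 e]]|[h1 h2]].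
  case: e => ex ey; subst x y.
  by have /flatten_mapP [z hz] := h1; rewrite !inE => /orP[] /eqP [-> _].
exists ((q, b), q'); split=> //; apply/allpairsP; exists (q, b); split=> //.
by case: b.
Qed.

Lemma mem_seq_profile A (R1 R2 : seq (Q * bool * Q)) q b q' : q \in states A ->
  q' \in states A ->
  reflect (exists s b1 b2, [/\ (q, b1, s) \in R1, (s, b2, q') \in R2 & b = b1 || b2])
  ((q, b, q') \in seq_profile A R1 R2).
Proof.
move=> hq hq'; rewrite mem_filter mem_triples hq hq' /= andbT.
apply: (iffP hasP) => [[[[x b1] s] h1 /= /andP[/eqP ex /hasP[[[y b2] z] h2 /=]]]|].
  by move=> /and3P[/eqP ey /eqP ez /eqP eb]; subst; exists s, b1, b2.
move=> [s [b1 [b2 [h1 h2 ->]]]]; exists (q, b1, s) => //=; rewrite eqxx.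
by apply/hasP; exists (s, b2, q') => //=; rewrite !eqxx.
Qed.

Lemma mem_match_profile A (R : seq (Q * bool * Q)) a b q f q' : q \in states A ->
  q' \in states A ->
  reflect (exists X q1 f1 q2, [/\ (q, a, q1, X) \in cal A, (q1, f1, q2) \in R,
     (q2, b, Some X, q') \in ret A & f = ((q \in fin A) || f1) || (q2 \in fin A)])
  ((q, f, q') \in match_profile A a R b).
Proof.
move=> hq hq'; rewrite mem_filter mem_triples hq hq' /= andbT.
apply: (iffP hasP) => [[[[[x a'] q1] X] h1 /= /andP[/eqP [ex ea] /hasP[[[y f1] q2] h2 /=]]]|].
  move=> /andP[/eqP ey /hasP[[[[z b'] oX] q3] h3 /= /and3P[/eqP [ez eb eo] /eqP e3 /eqP ->]]].
  by subst; exists X, q1, f1, q2.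
move=> [X [q1 [f1 [q2 [h1 h2 h3 ->]]]]]; exists (q, a, q1, X) => //=; rewrite eqxx.
apply/hasP; exists (q1, f1, q2) => //=; rewrite eqxx.
by apply/hasP; exists (q2, b, Some X, q') => //=; rewrite !eqxx.
Qed.

Variables (kd : L -> kind) (A : aut L Q G).

Lemma states_ini q : q \in ini A -> q \in states A.
Proof. by rewrite /states mem_cat => ->. Qed.

Lemma states_cal q a q' X : (q, a, q', X) \in cal A ->
  (q \in states A) /\ (q' \in states A).
Proof.
move=> h; rewrite /states !mem_cat.
have -> : q \in [seq t.1.1.1 | t <- cal A] by apply/mapP; exists (q, a, q', X).
have -> : q' \in [seq t.1.2 | t <- cal A] by apply/mapP; exists (q, a, q', X).
by rewrite !orbT.
Qed.

Lemma states_ret q a oX q' : (q, a, oX, q') \in ret A ->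
  (q \in states A) /\ (q' \in states A).
Proof.
move=> h; rewrite /states !mem_cat.
have -> : q \in [seq t.1.1.1 | t <- ret A] by apply/mapP; exists (q, a, oX, q').
have -> : q' \in [seq t.2 | t <- ret A] by apply/mapP; exists (q, a, oX, q').
by rewrite !orbT.
Qed.

Lemma states_loc q a q' : (q, a, q') \in loc A -> (q \in states A) /\ (q' \in states A).
Proof.
move=> h; rewrite /states !mem_cat.
have -> : q \in [seq t.1.1 | t <- loc A] by apply/mapP; exists (q, a, q').
have -> : q' \in [seq t.2 | t <- loc A] by apply/mapP; exists (q, a, q').
by rewrite !orbT.
Qed.

Lemma states_step a c c' : astep kd A a c c' -> (c.1 \in states A) /\ (c'.1 \in states A).
Proof.
rewrite /astep; case: (kd a) => [[X [_ /states_cal]]||[_ /states_loc]] //.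
by case: (c.2) => [|X u] [_ /states_ret].
Qed.

Lemma states_path w k c l c' b : apath kd A w k c l c' b -> c.1 \in states A ->
  c'.1 \in states A.
Proof. by elim=> // m c1 c2 b' h _ /states_step []. Qed.

Variable w : nat -> L.
Local Notation pend := (pend kd w).
Local Notation clean := (clean kd w).
Local Notation apath := (apath kd A w).

Definition profile k l := [seq t <- triples A |
  truth (exists u, apath k (t.1.1, [::]) l (t.2, u) t.1.2)].

Lemma mem_profile k l q b q' :
  reflect (q \in states A /\ exists u, apath k (q, [::]) l (q', u) b)
  ((q, b, q') \in profile k l).
Proof.
rewrite mem_filter mem_triples /=; apply: (iffP andP) => [[/truthP h /andP[h1 _]] //|[hq [u h]]].
split; first by apply/truthP; exists u.
by rewrite hq (states_path h).
Qed.

Lemma eq_profile (p : pred (Q * bool * Q)) k l : (forall q b q', q \in states A ->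
  q' \in states A ->
    (p (q, b, q') <-> exists u, apath k (q, [::]) l (q', u) b)) ->
  profile k l = [seq t <- triples A | p t].
Proof.
move=> h; apply: eq_in_filter => -[[q b] q']; rewrite mem_triples => /andP[h1 h2] /=.
by apply/truthP/idP => /h; exact.
Qed.

Lemma profile_seq k l R1 R2 : (forall q b q', q \in states A -> q' \in states A ->
    ((exists s b1 b2, [/\ (q, b1, s) \in R1, (s, b2, q') \in R2 & b = b1 || b2]) <->
     exists u, apath k (q, [::]) l (q', u) b)) ->
  profile k l = seq_profile A R1 R2.
Proof.
move=> h; apply: eq_profile => q b q' hq hq'; rewrite -(h _ _ _ hq hq').
have := mem_seq_profile R1 R2 b hq hq'; rewrite mem_filter mem_triples hq hq' /= andbT => hr.
by split=> h2; [exact: (elimT hr h2) | exact: (introT hr h2)].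
Qed.

Lemma profile_id k : profile k k = id_profile A.
Proof.
apply: eq_profile => q b q' _ _ /=; split=> [/andP[/eqP <- /negbTE ->]|[u /apath_nilE [[->] _ ->]]].
  by exists [::]; exact: PathNil.
by rewrite eqxx.
Qed.

(** The second segment either starts with the empty stack or never inspects what the first one left;
    in both cases a run on it from the empty stack can be appended. *)
Lemma profile_cat k l m : k <= l -> l <= m -> pend k l = [::] \/ clean l m ->
  profile k m = seq_profile A (profile k l) (profile l m).
Proof.
move=> kl lm hc; apply: profile_seq => q b q' hq hq'; split.
  move=> [s [b1 [b2 [/mem_profile [_ [u1 h1]] /mem_profile [_ [u2 h2]] ->]]]].
  case: hc => [hp|hc].
    have := apath_size h1; rewrite hp => /size0nil /= e; subst u1.
    by exists u2; exact: apath_cat h1 h2.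
  by exists (u2 ++ u1); apply: apath_cat h1 (apath_frame u1 h2 hc).
move=> [u /(@apath_split _ _ _ _ _ _ _ l) [|[s us] [b1 [b2 [h1 h2 ->]]]]]; first by rewrite kl.
exists s, b1, b2; split=> //; apply/mem_profile; split=> //; first by exists us.
  by have := states_path h1; exact.
have [|v hv] := apath_restart h2; last by exists v.
case: hc => [hp|]; last by right.
by left; have := apath_size h1; rewrite hp => /size0nil.
Qed.

End Profiles.

(** * The deterministic profile automaton *)

Fixpoint subseqs T (s : seq T) : seq (seq T) :=
  if s is x :: s' then [seq x :: u | u <- subseqs s'] ++ subseqs s' else [:: [::]].

Lemma filter_subseqs (T : eqType) (p : pred T) s : filter p s \in subseqs s.
Proof.
elim: s => //= x s IH; rewrite mem_cat; case: (p x); last by rewrite IH orbT.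
by rewrite map_f.
Qed.

(* Profile since the last pending call, profile since the beginning of the block,
   and whether no call is pending in the block. *)
Notation dstate Q := (seq (Q * bool * Q) * seq (Q * bool * Q) * bool)%type.

Section Det.

Variables (L Q G : eqType).
Implicit Types (A : aut L Q G) (d : dstate Q).

Definition dinit A : dstate Q := (id_profile A, id_profile A, true).
Definition dcall A d a : dstate Q := (id_profile A, seq_profile A d.1.2 (call_profile A a), false).
Definition dloc A d a : dstate Q := (seq_profile A d.1.1 (loc_profile A a), seq_profile A d.1.2 (loc_profile A a), d.2).
Definition dbot A d a : dstate Q := (seq_profile A d.1.1 (bot_profile A a), seq_profile A d.1.2 (bot_profile A a), true).
(** The popped symbol [g] is the state before the matching call, with the letter of that call. Both
    profiles stored in it are extended by the call, the segment since then and the return. *)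
Definition dret A d (g : dstate Q * L) b : dstate Q :=
  (seq_profile A g.1.1.1 (match_profile A g.2 d.1.1 b), seq_profile A g.1.1.2 (match_profile A g.2 d.1.1 b), g.1.2).

Variables (kd : L -> kind) (A : aut L Q G) (w : nat -> L).
Implicit Types (k l m : nat).
Local Notation pend := (pend kd w).
Local Notation clean := (clean kd w).
Local Notation apath := (apath kd A w).
Local Notation profile := (profile kd A w).

Lemma mem_step (P : pred (Q * bool * Q)) q f q' : q \in states A -> q' \in states A ->
  ((q, f, q') \in [seq t <- triples A | (t.1.2 == (t.1.1 \in fin A)) && P t]) =
  (f == (q \in fin A)) && P (q, f, q').
Proof. by move=> hq hq'; rewrite mem_filter mem_triples hq hq' /= andbT. Qed.

(** The pushed symbol is forgotten. It matters only at the matching return, where [profile_ret]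
    starts again from the profile before the call. *)
Lemma profile_call k l : k <= l -> kd (w l) = Kcall ->
  profile k l.+1 = seq_profile A (profile k l) (call_profile A (w l)).
Proof.
move=> kl ek; apply: profile_seq => q b q' hq hq'; split.
  move=> [s [b1 [b2 [/mem_profile [_ [u h]] h2 ->]]]].
  have hs := states_path h hq.
  move: h2; rewrite mem_step // => /andP[/eqP -> /hasP[[z X] h2 /eqP /= ez]].
  exists (X :: u); apply: PathStep h _; rewrite /astep ek; exists X; split=> //=.
  by rewrite -ez.
move=> [u /apath_stepE [//|[s us] [b1 [h s1 ->]]]].
exists s, b1, (s \in fin A); split=> //; first by apply/mem_profile; split=> //; exists us.
move: s1; rewrite /astep ek => -[X [_ h2]].
rewrite mem_step ?(states_path h hq) // eqxx /=.
by apply/hasP; exists (s, w l, q', X).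
Qed.

Lemma profile_loc k l : k <= l -> kd (w l) = Kloc ->
  profile k l.+1 = seq_profile A (profile k l) (loc_profile A (w l)).
Proof.
move=> kl ek; apply: profile_seq => q b q' hq hq'; split.
  move=> [s [b1 [b2 [/mem_profile [_ [u h]] h2 ->]]]].
  have hs := states_path h hq.
  move: h2; rewrite mem_step // => /andP[/eqP -> h2].
  by exists u; apply: PathStep h _; rewrite /astep ek.
move=> [u /apath_stepE [//|[s us] [b1 [h s1 ->]]]].
exists s, b1, (s \in fin A); split=> //; first by apply/mem_profile; split=> //; exists us.
move: s1; rewrite /astep ek => -[_ h2].
by rewrite mem_step ?(states_path h hq) // eqxx.
Qed.

Lemma profile_bot k l : k <= l -> kd (w l) = Kret -> pend k l = [::] ->
  profile k l.+1 = seq_profile A (profile k l) (bot_profile A (w l)).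
Proof.
move=> kl ek hp; apply: profile_seq => q b q' hq hq'; split.
  move=> [s [b1 [b2 [/mem_profile [_ [u h]] h2 ->]]]].
  have hs := states_path h hq.
  have := apath_size h; rewrite hp => /size0nil /= e; subst u.
  move: h2; rewrite mem_step // => /andP[/eqP -> h2].
  by exists [::]; apply: PathStep h _; rewrite /astep ek.
move=> [u /apath_stepE [//|[s us] [b1 [h s1 ->]]]].
exists s, b1, (s \in fin A); split=> //; first by apply/mem_profile; split=> //; exists us.
have := apath_size h; rewrite hp => /size0nil /= e; subst us.
move: s1; rewrite /astep ek => -[_ h2].
by rewrite mem_step ?(states_path h hq) // eqxx.
Qed.

(** By [pend_cons] the return at [l] matches the call [c], and the segment in between is clean and
    leaves nothing pending. A run thus meets at [l] the very symbol it pushed at [c], over the stack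
    it had before [c]. *)
Lemma profile_ret k l c s : k <= l -> kd (w l) = Kret -> pend k l = c :: s ->
  profile k l.+1 = seq_profile A (profile k c) (match_profile A (w c) (profile c.+1 l) (w l)).
Proof.
move=> kl ek hp; have [/andP[kc cl] ec es hc p0] := pend_cons hp.
apply: profile_seq => q b q' hq hq'; split.
  move=> [s1 [b1 [b2 [/mem_profile [_ [u h]] h2 ->]]]].
  have hs := states_path h hq.
  move/(mem_match_profile _ _ _ _ hs hq'): h2 => [X [q1 [f1 [q2 [h1 /mem_profile [_ [v h2]] h3 ->]]]]].
  have := apath_size h2; rewrite p0 => /size0nil /= e; subst v.
  have h4 := apath_frame (X :: u) h2 hc.
  have h5 : apath k (q, [::]) c.+1 (q1, X :: u) (b1 || (s1 \in fin A)).
    by apply: PathStep h _; rewrite /astep ec; exists X.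
  exists u; rewrite !orbA; apply: (PathStep (apath_cat h5 h4)).
  by rewrite /astep ek.
move=> [u /apath_stepE [//|[q2 v] [b1 [h h3 ->]]]].
have [|[q1 v1] [b2 [b3 [h1 h2 ->]]]] := apath_split h (l := c.+1).
  by rewrite leqW.
have [[s1 us] [b4 [h4 h5 ->]]] := apath_stepE h1 kc.
have hs := states_path h4 hq.
move: h5; rewrite /astep ec /= => -[X [e1 h5]]; subst v1.
have [v2 /= e2 h6] := apath_unframe h2 hc.
have := apath_size h6; rewrite p0 => /size0nil /= e; subst v2 v.
move: h3; rewrite /astep ek /= => -[_ h3].
exists s1, b4, (((s1 \in fin A) || b3) || (q2 \in fin A)); split; last by rewrite !orbA.
  by apply/mem_profile; split=> //; exists us.
apply/(mem_match_profile _ _ _ _ hs hq'); exists X, q1, b3, q2; split=> //.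
apply/mem_profile; split; last by exists [::].
by case: (states_cal h5).
Qed.

Definition base k l := if pend k l is c :: _ then c.+1 else k.
(** What the deterministic automaton started at [k] has to know at [l]. The profile from [base k l]
    is the one that the return matching the last pending call will need. *)
Definition dspec k l : dstate Q := (profile (base k l) l, profile k l, nilp (pend k l)).
Definition dstack k l := [seq (dspec k c, w c) | c <- pend k l].

(** The value [c] for an empty stack with a call pending is a default: [dstack] is nonempty whenever
    the flag of [dspec] is false. *)
Definition dnext a (c : dstate Q * seq (dstate Q * L)) :=
  match kd a with
  | Kcall => (dcall A c.1 a, (c.1, a) :: c.2)
  | Kret => if c.1.2 then (dbot A c.1 a, c.2)
            else if c.2 is g :: u then (dret A c.1 g a, u) else c
  | Kloc => (dloc A c.1 a, c.2)
  end.

Lemma base_le k l : k <= l -> k <= base k l <= l.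
Proof.
rewrite /base; case e: (pend k l) => [|c s]; first by rewrite leqnn.
by have [/andP[kc cl] _ _ _ _] := pend_cons e; rewrite leqW.
Qed.

Lemma base_pend k l : pend (base k l) l = [::].
Proof.
rewrite /base; case e: (pend k l) => [|c s] //.
by have [_ _ _ _ ->] := pend_cons e.
Qed.

Lemma dspec_init k : dspec k k = dinit A.
Proof. by rewrite /dspec /base !pend_nil // profile_id. Qed.

Lemma dstack_init k : dstack k k = [::].
Proof. by rewrite /dstack pend_nil. Qed.

Lemma dnext_spec k l st : k <= l ->
  dnext (w l) (dspec k l, dstack k l ++ st) = (dspec k l.+1, dstack k l.+1 ++ st).
Proof.
move=> kl; have /andP[kb bl] := base_le kl.
rewrite /dnext /dstack; case ek: (kd (w l)).
- rewrite (pendS _ _ kl) ek /= /dcall /dspec /base (pendS _ _ kl) ek /= profile_id.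
  by rewrite profile_call.
- case e: (pend k l) => [|c s].
    have e1 : pend k l.+1 = [::] by rewrite pendS // ek e.
    rewrite e1 /= /dspec /base e e1 /= /dbot /=.
    by rewrite -profile_bot.
  have [/andP[kc cl] ec es hc p0] := pend_cons e.
  have e1 : pend k l.+1 = s by rewrite pendS // ek e.
  rewrite e1 /= {1}/dspec e /= -/(dstack k l); congr pair.
  have /andP[kb' bc] := base_le kc.
  (* The first profile stored at the call [c] starts at [base k c]. From there [c] is the only
     pending call, so [profile_ret] applies to this profile as well as to the one from [k]. *)
  have pb : pend (base k c) l = [:: c].
    by rewrite (pend_cat (leq_trans bc (leqnSn c)) cl hc) p0 pendS // ec base_pend.
  rewrite /dret /dspec /=.
  have -> : base k l.+1 = base k c by rewrite /base e1 es.
  rewrite e1 es; have -> : base k l = c.+1 by rewrite /base e.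
  by rewrite -(profile_ret kl ek e) -(profile_ret (leq_trans bc (ltnW cl)) ek pb).
have e1 : pend k l.+1 = pend k l by rewrite pendS // ek.
rewrite e1 /dspec /= /dloc /=.
have -> : base k l.+1 = base k l by rewrite /base e1.
by rewrite -(profile_loc bl ek) -(profile_loc kl ek) e1.
Qed.

End Det.

(** The acceptance test on a linked pair, as in the theory of omega-semigroups: a path through [s]
    from an initial state, then a loop through [e] that meets a final state. *)
Definition accpair (L Q G : eqType) (A : aut L Q G) (s e : seq (Q * bool * Q)) :=
  has (fun t => (t.1.1 \in ini A) &&
    has (fun u => [&& u.1.1 == t.2, u.1.2 & u.2 == t.2]) e) s.

(** * Factorizations of a word along its stairs *)

Section Factorizations.

Variables (L Q G : eqType) (kd : L -> kind) (A : aut L Q G) (w : nat -> L).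
Local Notation pend := (pend kd w).
Local Notation clean := (clean kd w).
Local Notation stair := (stair kd w).
Local Notation apath := (apath kd A w).
Local Notation profile := (profile kd A w).

Lemma accpairP s e : reflect (exists q0 b q,
   [/\ q0 \in ini A, (q0, b, q) \in s & (q, true, q) \in e]) (accpair A s e).
Proof.
apply: (iffP hasP) => [[[[q0 b] q] h1 /= /andP[h2 /hasP[[[x f] y] h3 /=]]]|].
  by move=> /and3P[/eqP e1 e2 /eqP e3]; subst; exists q0, b, q; rewrite h2 h1; case: f h3 e2.
move=> [q0 [b [q [h1 h2 h3]]]]; exists (q0, b, q) => //=; rewrite h1.
by apply/hasP; exists (q, true, q) => //=; rewrite eqxx.
Qed.

(** The stacks at the cuts are found by dependent choice: at a stair the stack is empty, so that the
    loop applies as it is, or later steps leave it untouched, so that the loop can be framed by it.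
    The prefix [[0, J 0)] becomes block 0 of the glued run, hence [0 < J 0]. *)
Lemma factorization_accept (J : nat -> nat) q0 b q :
  (forall a, J a < J a.+1) -> 0 < J 0 -> (forall a, stair (J a)) -> q0 \in ini A ->
  (q0, b, q) \in profile 0 (J 0) -> (forall a, (q, true, q) \in profile (J a) (J a.+1)) ->
  alang kd A w.
Proof.
move=> hJ J0 hst hq0 /mem_profile [_ [u0 h0]] hl.
have [|a u [f hu]|v [ev hv1 hv2]] := @dep_choice (seq G)
  (fun a u => exists f, apath 0 (q0, [::]) (J a) (q, u) f)
  (fun a u u' => apath (J a) (q, u) (J a.+1) (q, u') true) u0.
- by exists b.
- have /mem_profile [_ [v hv]] := hl a.
  suff [u' hu'] : exists u', apath (J a) (q, u) (J a.+1) (q, u') true.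
    by exists u'; split=> //; exists (f || true); exact: apath_cat hu hu'.
  case: (hst a) => [hp|hc]; last by exists (v ++ u); exact: (apath_frame u hv (hc _)).
  by have := apath_size hu; rewrite hp => /size0nil /= ->; exists v.
exists q0 => //.
pose J' a := if a is a'.+1 then J a' else 0.
pose C a := if a is a'.+1 then (q, v a') else (q0, [::]).
apply: (@apath_glue _ _ _ kd A w J' C (fun a => if a is a'.+1 then true else b)) => //.
- by case.
- by case=> [|a] //=; rewrite ev.
by move=> n; exists n.+1.
Qed.

Lemma profile_subseqs k l : profile k l \in subseqs (triples A).
Proof. exact: filter_subseqs. Qed.

(** A pigeonhole on the prefix profiles comes before Ramsey's theorem, which is then applied to the
    stairs sharing the prefix profile [s]. *)
Lemma factorization_exists : exists s e (J : nat -> nat),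
  [/\ forall a, J a < J a.+1, forall a, 0 < J a /\ stair (J a),
      forall a, profile 0 (J a) = s & forall a b, a < b -> profile (J a) (J b) = e].
Proof.
have hX : unbounded (fun m => 0 < m /\ stair m).
  by move=> n; have [m h1 h2] := unbounded_stair kd w n.+1; exists m;
    [exact: ltnW | split=> //; exact: leq_ltn_trans h1].
have [|s hs] := pigeonhole hX (f := profile 0) (l := subseqs (triples A)).
  by move=> n _; exact: profile_subseqs.
have [|e [J [h1 h2 h3]]] := ramsey hs (f := profile) (l := subseqs (triples A)).
  by move=> i j; exact: profile_subseqs.
by exists s, e, J; split=> // a; case: (h2 a).
Qed.

(** Idempotence puts the run between any two cuts into [e]. Some state recurs at the cuts, and two
    of its occurrences with a final state in between give the loop that [accpair] asks for.
    Cleanness is assumed only up to the next cut, since this is what a run of [compl] guarantees. *)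
Lemma accept_factorization (J : nat -> nat) s e :
  (forall a, J a < J a.+1) ->
  (forall a, pend 0 (J a) = [::] \/ clean (J a) (J a.+1)) ->
  profile 0 (J 0) = s -> (forall a, profile (J a) (J a.+1) = e) ->
  seq_profile A s e = s -> seq_profile A e e = e -> alang kd A w -> accpair A s e.
Proof.
move=> hJ hst hs he es ee [q0 hq0 [r [r0 hr hF]]].
have hsts i : (r i).1 \in states A.
  by case: i => [|i]; [rewrite r0; exact: states_ini | case: (states_step (hr i))].
have h1 a : exists2 f, ((r (J a)).1, f, (r (J a.+1)).1) \in e &
    forall m, J a <= m < J a.+1 -> (r m).1 \in fin A -> f.
  have [f [hf hf2]] := apath_run hr (ltnW (hJ a)); exists f => //.
  rewrite -(he a); apply/mem_profile; split=> //.
  move: hf; rewrite {1}[r (J a)]surjective_pairing => hf.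
  have [|u hu] := apath_restart hf; last by exists u.
  case: (hst a) => [hp|]; last by right.
  have [f2 [hf3 _]] := apath_run hr (leq0n (J a)).
  by left; move: hf3; rewrite r0 => /apath_size; rewrite hp => /size0nil.
have h2 a b : a < b -> exists2 f, ((r (J a)).1, f, (r (J b)).1) \in e &
    forall m, J a <= m < J b -> (r m).1 \in fin A -> f.
  elim: b => // b IH; rewrite ltnS leq_eqVlt => /orP[/eqP <- //|/IH [f hf hf2]].
  have [g hg hg2] := h1 b; exists (f || g).
    by rewrite -ee; apply/mem_seq_profile => //; exists (r (J b)).1, f, g.
  move=> m /andP[am mb] hm; case: (ltnP m (J b)) => dual.
    by rewrite (hf2 m) // am.
  by rewrite (hg2 m) ?orbT // dual.
have h3 a : exists f, (q0, f, (r (J a)).1) \in s.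
  case: a => [|a].
    have [f [hf _]] := apath_run hr (leq0n (J 0)); exists f; rewrite -hs.
    apply/mem_profile; split; first exact: states_ini.
    by exists (r (J 0)).2; rewrite -surjective_pairing -r0.
  have [f [hf _]] := apath_run hr (leq0n (J 0)).
  have [g hg _] := h2 0 a.+1 isT; exists (f || g); rewrite -es.
  apply/mem_seq_profile => //; first exact: states_ini.
  exists (r (J 0)).1, f, g; split=> //; rewrite -hs; apply/mem_profile.
  split; first exact: states_ini.
  by exists (r (J 0)).2; rewrite -surjective_pairing -r0.
have [||q hq] := @pigeonhole _ (states A) (fun a => (r (J a)).1) (fun _ => True).
- by move=> n; exists n.
- by move=> n _; exact: hsts.
have [a _ [_ ea]] := hq 0.
have [n an hn] := hF (J a).
have [b nb [_ eb]] := hq n.+1.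
have ab : a < b.
  by apply: leq_trans nb; rewrite ltnS; apply: leq_trans an; exact: incr_ge.
have [f] := h2 a b ab; rewrite ea eb => hf /(_ n).
have nJ : n < J b by apply: leq_trans nb _; exact: incr_ge.
rewrite an nJ => /(_ isT hn) f1; move: hf; rewrite f1 => hf.
have [g] := h3 a; rewrite ea => hg.
by apply/accpairP; exists q0, g, q.
Qed.

End Factorizations.

Arguments triples : simpl never.
Arguments id_profile : simpl never.
Arguments seq_profile : simpl never.
Arguments call_profile : simpl never.
Arguments loc_profile : simpl never.
Arguments bot_profile : simpl never.
Arguments match_profile : simpl never.
Arguments subseqs : simpl never.

(** * Complementation *)

Section Complement.

Variables (L Q G : eqType).
Implicit Types (A : aut L Q G) (d : dstate Q) (Sg : seq L).

Definition dstates A : seq (dstate Q) :=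
  [seq (x, b) | x <- [seq (s, r) | s <- subseqs (triples A), r <- subseqs (triples A)],
                b <- [:: true; false]].

Definition dsymbols Sg A : seq (dstate Q * L) := [seq (d, a) | d <- dstates A, a <- Sg].

Definition daut_cal Sg A := [seq (x, dcall A x.1 x.2, x) | x <- dsymbols Sg A].
(** With no call pending in the block, only returns on the bottom marker are possible. After a reset
    above a nonempty stack, a return that reaches below the block therefore blocks the run; this is
    how blocks are forced to be clean. *)
Definition daut_ret Sg A :=
  [seq (x, None, dbot A x.1 x.2) | x <- [seq x <- dsymbols Sg A | x.1.2]] ++
  [seq (x, Some g, dret A x.1 g x.2) | x <- [seq x <- dsymbols Sg A | ~~ x.1.2],
                                       g <- dsymbols Sg A].
Definition daut_loc Sg A := [seq (x, dloc A x.1 x.2) | x <- dsymbols Sg A].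

Definition daut Sg A (F : seq (dstate Q)) : aut L (dstate Q) (dstate Q * L) :=
  ([:: dinit A], F, daut_cal Sg A, daut_ret Sg A, daut_loc Sg A).

Definition goals A := [seq (s, e) | s <- subseqs (triples A), e <- subseqs (triples A)].

Notation goal := (seq (Q * bool * Q) * seq (Q * bool * Q))%type.
Notation kstate := (goal * (dstate Q * bool))%type.

(* A state (x, e), (d, f) looks for the end of a block of profile x, followed by
   blocks of profile e; d is the state of the deterministic automaton in the
   current block and f tells that a block has just begun. *)
Definition ksucc A (g : goal) (d : dstate Q) : seq kstate :=
  (g, (d, false)) ::
  (if d.1.2 == g.1 then [:: ((g.2, g.2), (dinit A, true))] else [::]).

Definition ksrc A : seq (goal * bool) :=
  [seq (g, f) | g <- goals A, f <- [:: true; false]].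

Definition resets_cal A (D : aut L (dstate Q) (dstate Q * L)) :=
  flatten [seq [seq ((x.1, (t.1.1.1, x.2)), t.1.1.2, y, t.2) | y <- ksucc A x.1 t.1.2]
     | x <- ksrc A, t <- cal D].
Definition resets_ret A (D : aut L (dstate Q) (dstate Q * L)) :=
  flatten [seq [seq ((x.1, (t.1.1.1, x.2)), t.1.1.2, t.1.2, y) | y <- ksucc A x.1 t.2]
     | x <- ksrc A, t <- ret D].
Definition resets_loc A (D : aut L (dstate Q) (dstate Q * L)) :=
  flatten [seq [seq ((x.1, (t.1.1, x.2)), t.1.2, y) | y <- ksucc A x.1 t.2]
     | x <- ksrc A, t <- loc D].

(** The final states are those in which a block has just begun, so that an accepting run completes
    infinitely many blocks. *)
Definition resets A (D : aut L (dstate Q) (dstate Q * L)) : aut L kstate (dstate Q * L) :=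
  ([seq (g, (dinit A, false)) | g <- [seq g <- goals A |
      [&& ~~ accpair A g.1 g.2, seq_profile A g.2 g.2 == g.2 & seq_profile A g.1 g.2 == g.1]]],
   [seq (g, (dinit A, true)) | g <- goals A],
   resets_cal A D, resets_ret A D, resets_loc A D).

Definition compl Sg A := resets A (daut Sg A [::]).

Arguments ksucc : simpl never.
Arguments daut_cal : simpl never.
Arguments daut_ret : simpl never.
Arguments daut_loc : simpl never.
Arguments resets_cal : simpl never.
Arguments resets_ret : simpl never.
Arguments resets_loc : simpl never.

Variables (kd : L -> kind) (Sg : seq L) (A : aut L Q G).

Lemma dspec_dstates w k l : dspec kd A w k l \in dstates A.
Proof.
rewrite /dspec; apply/allpairsP; exists ((profile kd A w (base kd w k l) l, profile kd A w k l),
  nilp (pend kd w k l)); split=> //; last by case: nilp.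
by apply/allpairsP; exists (profile kd A w (base kd w k l) l, profile kd A w k l);
  split=> //; exact: profile_subseqs.
Qed.

Lemma daut_det F a d st c :
  astep kd (daut Sg A F) a (d, st) c ->
  c = dnext kd A a (d, st) /\
  (kd a = Kret -> if d.2 then st = [::] else st <> [::]).
Proof.
rewrite /astep /dnext; case: c => d' st'; case: (kd a) => /=.
- by move=> [X [-> /mapP[[x b] _ [-> -> -> ->]]]].
- case: st => [|X u] [-> ]; rewrite mem_cat => /orP[/mapP[[x b]]|/allpairsP[[[x b] g] /=]] //.
  + by rewrite mem_filter /= => /andP[xE _] [-> -> ->]; rewrite xE.
  + by case.
  + by rewrite mem_filter /= => -[/andP[/negbTE xE _] _ [-> -> -> ->]]; rewrite xE.
by move=> [-> /mapP[[x b] _ [-> -> ->]]].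
Qed.

Lemma daut_step F a d st : d \in dstates A -> a \in Sg ->
  (kd a = Kret -> if d.2 then st = [::]
     else exists g u, st = g :: u /\ g \in dsymbols Sg A) ->
  astep kd (daut Sg A F) a (d, st) (dnext kd A a (d, st)).
Proof.
move=> hd ha; have hda : (d, a) \in dsymbols Sg A by apply/allpairsP; exists (d, a).
rewrite /astep /dnext; case: (kd a) => /= h.
- by exists (d, a); split=> //; apply/mapP; exists (d, a).
- move: (h erefl); case dE : d.2; [move=> -> | move=> [x [u [-> hx]]]];
    split=> //; rewrite /daut_ret mem_cat; apply/orP.
    by left; apply/mapP; exists (d, a) => //; rewrite mem_filter /= dE.
  right; apply/allpairsP; exists ((d, a), x); split=> //.
  by rewrite mem_filter /= dE.
by split=> //; apply/mapP; exists (d, a).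
Qed.

Lemma resets_stepE (D : aut L (dstate Q) (dstate Q * L)) a g d f st y st' :
  astep kd (resets A D) a ((g, (d, f)), st) (y, st') ->
  exists2 d', astep kd D a (d, st) (d', st') & y \in ksucc A g d'.
Proof.
rewrite /astep; case: (kd a) => /=.
- move=> [X [e /flattenP[s /allpairsP[[[g1 f1] [[[d1 a1] d2] X1]] [h1 h2 ->]]]]].
  by move=> /mapP[y1 hy [? ? ? ? ? ?]]; subst; exists d2 => //; exists X1.
- have E oX : (g, (d, f), a, oX, y) \in ret (resets A D) ->
     exists2 d', (d, a, oX, d') \in ret D & y \in ksucc A g d'.
    move=> /flattenP[s /allpairsP[[[g1 f1] [[[d1 a1] X1] d2]] [h1 h2 ->]]].
    by move=> /mapP[y1 hy [? ? ? ? ? ?]]; subst; exists d2.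
  by case: st => [|X u] [-> /E [d' h1 h2]]; exists d'.
move=> [e /flattenP[s /allpairsP[[[g1 f1] [[d1 a1] d2]] [h1 h2 ->]]]].
by move=> /mapP[y1 hy [? ? ? ? ?]]; subst; exists d2.
Qed.

Lemma resets_stepI (D : aut L (dstate Q) (dstate Q * L)) a g d f st y d' st' :
  g \in goals A -> astep kd D a (d, st) (d', st') -> y \in ksucc A g d' ->
  astep kd (resets A D) a ((g, (d, f)), st) (y, st').
Proof.
move=> hg; have hx : (g, f) \in ksrc A by apply/allpairsP; exists (g, f); case: (f).
rewrite /astep; case: (kd a) => /=.
- move=> [X [e h]] hy; exists X; split=> //; apply/flattenP.
  exists [seq ((g, (d, f)), a, y, X) | y <- ksucc A g d']; last by apply/mapP; exists y.
  by apply/allpairsP; exists ((g, f), (d, a, d', X)).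
- have E oX : (d, a, oX, d') \in ret D -> y \in ksucc A g d' ->
     (g, (d, f), a, oX, y) \in ret (resets A D).
    move=> h hy; apply/flattenP.
    exists [seq ((g, (d, f)), a, oX, y) | y <- ksucc A g d']; last by apply/mapP; exists y.
    by apply/allpairsP; exists ((g, f), (d, a, oX, d')).
  by case: st => [|X u] [-> h] hy; split=> //; apply: E.
move=> [e h] hy; split=> //; apply/flattenP.
exists [seq ((g, (d, f)), a, y) | y <- ksucc A g d']; last by apply/mapP; exists y.
by apply/allpairsP; exists ((g, f), (d, a, d')).
Qed.

Lemma ksuccP g d y : reflect (y = (g, (d, false)) \/
    d.1.2 = g.1 /\ y = ((g.2, g.2), (dinit A, true))) (y \in ksucc A g d).
Proof.
rewrite /ksucc inE; case: (d.1.2 =P g.1) => h; rewrite ?inE ?orbF.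
  by apply: (iffP orP) => [[/eqP ->|/eqP ->]|[->|[_ ->]]]; rewrite ?eqxx; auto.
by apply: (iffP eqP) => [->|[|[]]] //; left.
Qed.

End Complement.

Section ComplementCorrect.

Variables (L Q G : eqType) (kd : L -> kind) (Sg : seq L) (A : aut L Q G) (w : nat -> L).
Local Notation pend := (pend kd w).
Local Notation clean := (clean kd w).
Local Notation stair := (stair kd w).
Local Notation profile := (profile kd A w).
Local Notation dspec := (dspec kd A w).
Local Notation dstack := (dstack kd A w).
Local Notation K := (compl Sg A).

Lemma goalsP g : reflect (g.1 \in subseqs (triples A) /\ g.2 \in subseqs (triples A)) (g \in goals A).
Proof.
apply: (iffP allpairsP) => [[[s e] /= [h1 h2 ->]] //|[h1 h2]].
by exists (g.1, g.2); split=> //; case: g {h1 h2}.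
Qed.

(** Until the next reset the state is [dspec] and the stack [dstack] over the stack [st] of the
    earlier blocks. If [st] is nonempty, the missing return transitions exclude a return below the
    block. *)
Lemma compl_block r k m x e f st : arun kd K w r -> k < m ->
  r k = (((x, e), (dinit A, f)), st) ->
  (forall i, k < i < m -> (r i).1.2.2 = false) -> (r m).1.2.2 = true ->
  [/\ exists st', r m = (((e, e), (dinit A, true)), st'), profile k m = x
    & st = [::] \/ clean k m].
Proof.
move=> hr; case: m => // m; rewrite ltnS => km rank hi hm.
have inv l : k <= l <= m -> (exists f', r l = (((x, e), (dspec k l, f')), dstack k l ++ st))
    /\ (st = [::] \/ clean k l).
  elim: l => [|l IH].
    rewrite leqn0 => /andP[/eqP k0 _]; subst k; split; last by right; exact: clean_kk.
    by exists f; rewrite dspec_init rank /dstack pend_nil.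
  case/andP; rewrite leq_eqVlt => /orP[/eqP <- _|].
    split; last by right; exact: clean_kk.
    by exists f; rewrite dspec_init rank /dstack pend_nil.
  rewrite ltnS => kl lm.
  have [|[f' rl] hc] := IH; first by rewrite kl ltnW.
  have := hr l; rewrite rl; case E: (r l.+1) => [y st'] /resets_stepE [d'].
  move=> /daut_det []; rewrite dnext_spec // => -[-> ->] hret /ksuccP[->|[_ hy]].
    split; first by exists false.
    case: hc => [|hc]; first by left.
    case: (st =P [::]) => [|/eqP ste]; first by left.
    right=> i /andP[ki]; rewrite ltnS leq_eqVlt => /orP[/eqP ->|il]; last by apply: hc; rewrite ki.
    move=> /hret; rewrite /dspec /=; case: (pend k l) => //= e1.
    by move: ste; case: (st) e1 => // ? ? /(congr1 size); rewrite size_cat /= addnS.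
  by have := hi l.+1; rewrite E hy /= !ltnS kl lm => /(_ isT).
have [|[f' rm] hc] := inv m; first by rewrite km leqnn.
move: hm; have := hr m; rewrite rm; case E: (r m.+1) => [y st'] /resets_stepE [d'].
move=> /daut_det []; rewrite dnext_spec // => -[-> ->] hret /ksuccP[-> //|[hx hy]] _.
split; [by exists (dstack k m.+1 ++ st); rewrite hy | exact: hx |].
case: hc => [|hc]; first by left.
case: (st =P [::]) => [|/eqP ste]; first by left.
right=> i /andP[ki]; rewrite ltnS leq_eqVlt => /orP[/eqP ->|il]; last by apply: hc; rewrite ki.
move=> /hret; rewrite /dspec /=; case: (pend k m) => //= e1.
by move: ste; case: (st) e1 => // ? ? /(congr1 size); rewrite size_cat /= addnS.
Qed.

(** The resets of the run cut the word into blocks of profiles [s], [e], [e] and so on. If the word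
    were accepted by [A], [accept_factorization] would make the guessed pair accepting. *)
Lemma compl_sound : alang kd K w -> ~ alang kd A w.
Proof.
move=> [q0 /mapP[[s e]]]; rewrite mem_filter /= => /andP[/and3P[hacc /eqP ee /eqP se] _] ->.
move=> [r [r0 hr hF]].
have hfl n : exists2 m, n < m & (r m).1.2.2.
  have [m nm /mapP[g _ h]] := hF n.+1; exists m => //.
  by rewrite h.
(* The first reset after [n]. *)
pose nx n := ex_minn (let: ex_intro2 m h1 h2 := hfl n in
  ex_intro (fun m => (n < m) && (r m).1.2.2) m (introT andP (conj h1 h2))).
have nxP n : [/\ n < nx n, (r (nx n)).1.2.2 = true &
    forall i, n < i < nx n -> (r i).1.2.2 = false].
  rewrite /nx; case: ex_minnP => m /andP[h1 h2] h3; split=> // i /andP[ni im].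
  apply/negbTE/negP => hi; have := h3 i; rewrite ni hi => /(_ isT).
  by rewrite leqNgt im.
pose J a := iter a nx (nx 0).
have hJ a : J a < J a.+1 by case: (nxP (J a)).
have hb0 : [/\ exists st', r (J 0) = (((e, e), (dinit A, true)), st'), profile 0 (J 0) = s
    & [::] = [::] :> seq (dstate Q * L) \/ clean 0 (J 0)].
  have [h1 h2 h3] := nxP 0.
  exact: (compl_block hr h1 r0 h3 h2).
have hb a : exists st, r (J a) = (((e, e), (dinit A, true)), st).
  elim: a => [|a [st IH]]; first by case: hb0.
  have [h1 h2 h3] := nxP (J a).
  by case: (compl_block hr h1 IH h3 h2).
have hb2 a : profile (J a) (J a.+1) = e /\ (pend 0 (J a) = [::] \/ clean (J a) (J a.+1)).
  have [st hst] := hb a; have [h1 h2 h3] := nxP (J a).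
  have [_ -> hc] := compl_block hr h1 hst h3 h2; split=> //.
  case: hc => [st0|]; last by right.
  have [f [hp _]] := apath_run hr (leq0n (J a)).
  left; apply: size0nil; move: hp; rewrite r0 => /apath_size <-.
  by rewrite hst st0.
move=> hA; move/negP: hacc; apply.
apply: (@accept_factorization _ _ _ kd A w J s e) => //.
- by move=> a; case: (hb2 a).
- by case: hb0.
- by move=> a; case: (hb2 a).
Qed.

Lemma stair_profile k l m : k <= l -> l <= m -> stair k -> stair l ->
  profile k m = seq_profile A (profile k l) (profile l m).
Proof.
move=> kl lm hk hl; apply: profile_cat => //.
by have [h _] := stair_rel hk kl; case: (h hl) => [|hc]; [left | right].
Qed.

(** Profiles compose across the stairs [J 0] and [J 1], and all segments between cuts share one
    profile, as do all prefixes. *)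
Lemma factorization_idem (J : nat -> nat) s e :
  (forall a, J a < J a.+1) -> (forall a, 0 < J a /\ stair (J a)) ->
  (forall a, profile 0 (J a) = s) -> (forall a b, a < b -> profile (J a) (J b) = e) ->
  seq_profile A e e = e /\ seq_profile A s e = s.
Proof.
move=> hJ hst hs he; have hst' a : stair (J a) by case: (hst a).
have hle a : J a <= J a.+1 by exact: ltnW.
split.
  have := stair_profile (hle 0) (hle 1) (hst' 0) (hst' 1).
  by rewrite !he // => <-.
have := stair_profile (leq0n _) (hle 0) (stair0 _ _) (hst' 0).
by rewrite !hs he // => <-.
Qed.

(** The linked pair of the word is rejecting by [factorization_accept]. The run that resets exactly
    at the cuts never blocks because they are stairs: a return with nothing pending in its block can
    occur only if the earlier blocks left an empty stack. *)
Lemma compl_complete : (forall i, w i \in Sg) -> ~ alang kd A w -> alang kd K w.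
Proof.
move=> hSg hA.
have [s [e [J0 [hJ0 hJ1 hs he]]]] := factorization_exists kd A w.
have hst0 a : stair (J0 a) by case: (hJ1 a).
have [ee se] := factorization_idem hJ0 hJ1 hs he.
have hse : [&& ~~ accpair A s e, seq_profile A e e == e & seq_profile A s e == s].
  rewrite ee se !eqxx !andbT; apply/negP => /accpairP [q0 [b [q [h1 h2 h3]]]]; apply: hA.
  apply: (factorization_accept hJ0 _ hst0 h1 (b := b) (q := q)).
  + by case: (hJ1 0).
  + by rewrite hs.
  + by move=> a; rewrite he.
pose J a := if a is a'.+1 then J0 a' else 0.
have hJ a : J a < J a.+1 by case: a => [|a] //=; case: (hJ1 0).
have hst a : stair (J a) by case: a => [|a]; [exact: stair0 | exact: hst0].
pose x b := if b is 0 then s else e.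
have hx b : profile (J b) (J b.+1) = x b by case: b => [|b]; rewrite /= ?hs ?he.
have sS : s \in subseqs (triples A) by rewrite -(hs 0) profile_subseqs.
have eS : e \in subseqs (triples A) by rewrite -(he 0 1 isT) profile_subseqs.
have gS b : (x b, e) \in goals A by apply/goalsP; case: b.
(* What the blocks before block [b] leave on the stack. *)
pose sg := fix sg b := if b is b'.+1 then dstack (J b') (J b) ++ sg b' else [::].
have sgS b : sg b.+1 = dstack (J b) (J b.+1) ++ sg b by [].
have size_sg b : size (sg b) = size (pend 0 (J b)).
  elim: b => [|b IH] //; rewrite [sg _]/= size_cat IH size_map.
  case: (hst b) => [h|h].
    by rewrite h addn0 (pend_restart (leq0n _) (ltnW (hJ b)) h).
  by rewrite (pend_cat (leq0n _) (ltnW (hJ b)) (h _)) size_cat.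
pose bl := block J.
have hb i : J (bl i) <= i < J (bl i).+1 by apply: blockP.
pose r i := (((x (bl i), e), (dspec (J (bl i)) i, (0 < bl i) && (i == J (bl i)))),
             dstack (J (bl i)) i ++ sg (bl i)).
have blJ a : bl (J a) = a by apply: block_uniq; rewrite ?leqnn ?hJ.
exists ((s, e), (dinit A, false)).
  by apply/mapP; exists (s, e) => //; rewrite mem_filter hse; exact: (gS 0).
exists r; split.
- by rewrite /r /bl /= dspec_init.
- move=> i; have /andP[kb bk] := hb i; rewrite /r.
  set b := bl i; set k := J b.
  have hstep : astep kd (daut Sg A [::]) (w i) (dspec k i, dstack k i ++ sg b)
     (dspec k i.+1, dstack k i.+1 ++ sg b).
    rewrite -dnext_spec //; apply: daut_step => //; first exact: dspec_dstates.
    rewrite /dspec /= => hret; case e1: (pend k i) => [|c t] /=.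
      rewrite /dstack e1 /=; apply: size0nil; rewrite size_sg -/k.
      case: (hst b) => [-> //|/(_ i.+1) /(_ i)].
      by rewrite -/k kb ltnSn e1 => /(_ isT hret).
    rewrite /dstack e1 /=; exists (dspec k c, w c), ([seq (dspec k c, w c) | c <- t] ++ sg b).
    split=> //; apply/allpairsP; exists (dspec k c, w c).
    by split; [exact: dspec_dstates | exact: hSg |].
  have hstk : dstack k i.+1 ++ sg b = dstack (J (bl i.+1)) i.+1 ++ sg (bl i.+1).
    have -> : bl i.+1 = if J b.+1 == i.+1 then b.+1 else b by [].
    case: (J b.+1 =P i.+1) => [e1|//].
    by rewrite sgS e1 dstack_init.
  rewrite -hstk; apply: (resets_stepI _ (gS b) hstep).
  have -> : bl i.+1 = if J b.+1 == i.+1 then b.+1 else b by [].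
  case: (J b.+1 =P i.+1) => [e1|_]; apply/ksuccP; last first.
    by left; rewrite -/k (gtn_eqF (leq_ltn_trans kb (ltnSn i))) andbF.
  right; rewrite e1 dspec_init eqxx; split=> //.
  by change (profile k i.+1 = x b); rewrite -e1 hx.
move=> n; exists (J n.+1); first exact: leq_trans (incr_ge hJ n) (ltnW (hJ n)).
rewrite /r blJ eqxx dspec_init; apply/mapP; exists (e, e) => //.
by apply/goalsP.
Qed.

End ComplementCorrect.

(** * Further constructions on automata *)

Lemma acc_sim (L Q G L' Q' G' : eqType) (kd : L -> kind) (kd' : L' -> kind)
    (A : aut L Q G) (A' : aut L' Q' G') w w' (R : Q * seq G -> Q' * seq G' -> Prop) :
  (forall i c d e, R c d -> astep kd A (w i) c e ->
     exists2 f, astep kd' A' (w' i) d f & R e f) ->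
  (forall c d, R c d -> c.1 \in fin A -> d.1 \in fin A') ->
  forall c d, R c d -> acc kd A w c -> acc kd' A' w' d.
Proof.
move=> hs hf c d hcd [r [r0 hr hF]].
have [|i e he|f [f0 h1 h2]] := @dep_choice _ (fun i => R (r i))
  (fun i => astep kd' A' (w' i)) d; first by rewrite r0.
  by have [f h1 h2] := hs i _ _ _ he (hr i); exists f.
exists f; split=> // n; have [m nm /hf h] := hF n; exists m => //; exact: h.
Qed.

(** * Unrolling of a step and tagged unions *)

Section Ops.

Variables (L Q G : eqType) (kd : L -> kind) (A : aut L Q G).

Lemma acc_step w c : acc kd A w c <->
  exists2 d, astep kd A (w 0) c d & acc kd A (fun i => w i.+1) d.
Proof.
split=> [[r [r0 hr hF]]|[d hs [r [r0 hr hF]]]].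
  exists (r 1); first by rewrite -r0.
  exists (fun i => r i.+1); split=> // n.
  by have [[|m]] := hF n.+1; rewrite // ltnS => h1 h2; exists m.
exists (fun i => if i is i'.+1 then r i' else c); split=> //.
  by case=> [|i]; rewrite ?r0.
by move=> n; have [m h1 h2] := hF n; exists m.+1; first exact: leqW.
Qed.

(** Besides keeping the members apart, the tag is the number of an obligation, by which [viol]
    selects initial states. *)
Definition unions (fam : seq (nat * aut L Q G)) : aut L (nat * Q) G :=
  ([seq (p.1, q) | p <- fam, q <- ini p.2],
   [seq (p.1, q) | p <- fam, q <- fin p.2],
   [seq ((p.1, t.1.1.1), t.1.1.2, (p.1, t.1.2), t.2) | p <- fam, t <- cal p.2],
   [seq ((p.1, t.1.1.1), t.1.1.2, t.1.2, (p.1, t.2)) | p <- fam, t <- ret p.2],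
   [seq ((p.1, t.1.1), t.1.2, (p.1, t.2)) | p <- fam, t <- loc p.2]).

Variable fam : seq (nat * aut L Q G).
Hypothesis fam_uniq : forall o B B', (o, B) \in fam -> (o, B') \in fam -> B = B'.

Lemma unions_step o B a q st c : (o, B) \in fam ->
  astep kd (unions fam) a ((o, q), st) c <->
  exists2 q', c.1 = (o, q') & astep kd B a (q, st) (q', c.2).
Proof.
move=> hB; case: c => [[o' q'] st']; rewrite /astep; case: (kd a) => /=.
- split=> [[X [-> /allpairsPdep[[o1 B1] [[[[q1 a1] q2] X1] [h1 h2 [? ? ? ? ? ?]]]]]]|].
    by subst; rewrite (fam_uniq hB h1); exists q2 => //; exists X1.
  move=> [q2 [-> ->] [X [-> h]]]; exists X; split=> //.
  by apply/allpairsPdep; exists (o, B), (q, a, q2, X).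
- have E oX : ((o, q), a, oX, (o', q')) \in ret (unions fam) <->
    o' = o /\ (q, a, oX, q') \in ret B.
    split=> [/allpairsPdep[[o1 B1] [[[[q1 a1] X1] q2] [h1 h2 [? ? ? ? ? ?]]]]|[-> h]].
      by subst; rewrite (fam_uniq hB h1).
    by apply/allpairsPdep; exists (o, B), (q, a, oX, q').
  case: st => [|X u]; split.
  + by move=> [-> /E [-> h]]; exists q'.
  + by move=> [q2 [eo eq] [-> h]]; split=> //; apply/E; rewrite eo eq.
  + by move=> [-> /E [-> h]]; exists q'.
  + by move=> [q2 [eo eq] [-> h]]; split=> //; apply/E; rewrite eo eq.
- split=> [[-> /allpairsPdep[[o1 B1] [[[q1 a1] q2] [h1 h2 [? ? ? ? ?]]]]]|].
    by subst; rewrite (fam_uniq hB h1); exists q2.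
  move=> [q2 [-> ->] [-> h]]; split=> //.
  by apply/allpairsPdep; exists (o, B), (q, a, q2).
Qed.

Lemma unions_fin o B q : (o, B) \in fam -> ((o, q) \in fin (unions fam)) = (q \in fin B).
Proof.
move=> hB; apply/allpairsPdep/idP => [[[o1 B1] [q1 [h1 h2 [? ?]]]]|h].
  by subst; rewrite (fam_uniq hB h1).
by exists (o, B), q.
Qed.

Lemma unions_ini o q : reflect (exists2 B, (o, B) \in fam & q \in ini B)
  ((o, q) \in ini (unions fam)).
Proof.
apply: (iffP allpairsPdep) => [[[o1 B1] [q1 [h1 h2 [? ?]]]]|[B h1 h2]].
  by subst; exists B1.
by exists (o, B), q.
Qed.

Lemma unions_acc w o B q st : (o, B) \in fam ->
  acc kd (unions fam) w ((o, q), st) <-> acc kd B w (q, st).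
Proof.
move=> hB; split.
  apply: (acc_sim (R := fun c d => c.1 = (o, d.1) /\ c.2 = d.2)) => //.
    move=> i [[o1 q1] st1] [q2 st2] e [/= [? ?] ?]; subst.
    by move=> /(unions_step _ _ _ _ hB) [q' he hs]; exists (q', e.2).
  by move=> [[o1 q1] st1] [q2 st2] [/= [? ?] ?]; subst; rewrite (unions_fin _ hB).
apply: (acc_sim (R := fun d c => c.1 = (o, d.1) /\ c.2 = d.2)) => //.
  move=> i [q2 st2] [[o1 q1] st1] [q' st'] [/= [? ?] ?]; subst.
  by move=> h; exists ((o, q'), st') => //; apply/(unions_step _ _ _ _ hB); exists q'.
by move=> [q2 st2] [[o1 q1] st1] [/= [? ?] ?]; subst; rewrite (unions_fin _ hB).
Qed.

Lemma unions_lang w : alang kd (unions fam) w <->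
  exists2 p, p \in fam & alang kd p.2 w.
Proof.
split=> [[[o q] /unions_ini [B hB hq] /(unions_acc _ _ _ hB) h]|[[o B] hB [q hq h]]].
  by exists (o, B) => //; exists q.
by exists (o, q); [apply/unions_ini; exists B | apply/(unions_acc _ _ _ hB)].
Qed.

End Ops.

(** Each construction changes the types of states and stack symbols. Passing to codes keeps the
    automata of all formulas in one type, so that the translation can be a recursion over formulas
    and over trees. *)
Definition collapse (L Q G : Type) {eQ : Enc Q} {eG : Enc G} (A : aut L Q G) :
    aut L tree tree :=
  ([seq code q | q <- ini A], [seq code q | q <- fin A],
   [seq (code t.1.1.1, t.1.1.2, code t.1.2, code t.2) | t <- cal A],
   [seq (code t.1.1.1, t.1.1.2, omap code t.1.2, code t.2) | t <- ret A],
   [seq (code t.1.1, t.1.2, code t.2) | t <- loc A]).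

Section Collapse.

Variables (L Q G : eqType) (eQ : Enc Q) (eG : Enc G) (kd : L -> kind) (A : aut L Q G).

Lemma collapse_step a q st c : astep kd (collapse A) a (code q, map code st) c <->
  exists q' st', c = (code q', map code st') /\ astep kd A a (q, st) (q', st').
Proof.
case: c => q1 st1; rewrite /astep; case: (kd a) => /=.
- split=> [[X [-> /mapP[[[[q0 a0] q2] X0] h [e1 ? ? ?]]]]|].
    by have e := code_inj e1; subst; exists q2, (X0 :: st); split=> //; exists X0.
  move=> [q' [st' [[-> ->] [X [-> h]]]]]; exists (code X); split=> //.
  by apply/mapP; exists (q, a, q', X).
- have E oX q2 : (code q, a, omap code oX, q2) \in ret (collapse A) <->
    exists2 q', q2 = code q' & (q, a, oX, q') \in ret A.
    split=> [/mapP[[[[q0 a0] X0] q3] h [e1 ? eX ?]]|[q' -> h]]; last first.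
      by apply/mapP; exists (q, a, oX, q').
    have e := code_inj e1; subst; exists q3 => //; suff -> : oX = X0 by [].
    by case: X0 oX eX {h} => [X0|] [X|] //= [e2]; rewrite (code_inj e2).
  case: st => [|X u]; split.
  + by move=> [-> /(E None) [q' -> h]]; exists q', [::].
  + by move=> [q' [st' [[-> ->] [-> h]]]]; split=> //; apply/(E None); exists q'.
  + by move=> [-> /(E (Some X)) [q' -> h]]; exists q', u.
  + by move=> [q' [st' [[-> ->] [-> h]]]]; split=> //; apply/(E (Some X)); exists q'.
split=> [[-> /mapP[[[q0 a0] q2] h [e1 ? ?]]]|].
  by have e := code_inj e1; subst; exists q2, st.
by move=> [q' [st' [[-> ->] [-> h]]]]; split=> //; apply/mapP; exists (q, a, q').
Qed.

Lemma collapse_lang w : alang kd (collapse A) w <-> alang kd A w.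
Proof.
split=> [[_ /mapP[q hq ->]]|[q hq]] h.
  exists q => //; move: h.
  apply: (acc_sim (R := fun c d => c = (code d.1, map code d.2))) => //.
    move=> i _ [q1 st1] e -> /collapse_step [q' [st' [-> h]]]; by exists (q', st').
  by move=> _ [q1 st1] -> /=; rewrite mem_map //; exact: code_inj.
exists (code q); first by apply: map_f.
move: h; apply: (acc_sim (R := fun d c => c = (code d.1, map code d.2))) => //.
  move=> i [q1 st1] _ [q' st'] -> h; exists (code q', map code st') => //.
  by apply/collapse_step; exists q', st'.
by move=> [q1 st1] _ -> h; apply: map_f.
Qed.

End Collapse.

(** * Searching for a violated obligation *)

Section Violation.

Variables (L Q G : eqType).
Notation tst := (nat * Q)%type.
Implicit Types (U : aut L tst G) (Sg : seq L) (labs : seq (seq nat)).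

(** Leaving the waiting state already performs the first step of [U], so an initial state with a
    suitable tag contributes its transitions to [None] too. *)
Definition viol_sources U (o : seq nat) (q : tst) : seq (option tst) :=
  Some q :: (if (q \in ini U) && (q.1 \in o) then [:: None] else [::]).

(** The outer [None] is the true bottom marker and [Some None] a symbol pushed while waiting; to [U]
    both look like the bottom. *)
Definition viol_symbols (g : option G) : seq (option (option G)) :=
  if g is Some X then [:: Some (Some X)] else [:: None; Some None].

Definition letters Sg labs : seq (L * seq nat) := [seq (a, o) | a <- Sg, o <- labs].

Definition viol_cal Sg labs U :=
  [seq (None : option tst, x, None : option tst, None : option G) | x <- letters Sg labs] ++
  flatten [seq [seq (s, (t.1.1.2, o), Some t.1.2, Some t.2) | s <- viol_sources U o t.1.1.1]
     | t <- cal U, o <- labs].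
Definition viol_ret Sg labs U :=
  [seq (None : option tst, x, g, None : option tst)
     | x <- letters Sg labs, g <- [:: None : option (option G); Some None]] ++
  flatten [seq [seq (p.1, (t.1.1.2, o), p.2, Some t.2)
      | p <- [seq (s, g) | s <- viol_sources U o t.1.1.1, g <- viol_symbols t.1.2]]
     | t <- ret U, o <- labs].
Definition viol_loc Sg labs U :=
  [seq (None : option tst, x, None : option tst) | x <- letters Sg labs] ++
  flatten [seq [seq (s, (t.1.2, o), Some t.2) | s <- viol_sources U o t.1.1]
     | t <- loc U, o <- labs].

(* Waits in the state None, then runs U from an initial state whose tag is in the
   second component of the current letter. What was pushed before counts as the
   bottom of the stack. *)
Definition viol Sg labs U : aut (L * seq nat) (option tst) (option G) :=
  ([:: None], [seq Some q | q <- fin U],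
   viol_cal Sg labs U, viol_ret Sg labs U, viol_loc Sg labs U).

Arguments viol_sources : simpl never.
Arguments viol_symbols : simpl never.
Arguments letters : simpl never.
Arguments viol_cal : simpl never.
Arguments viol_ret : simpl never.
Arguments viol_loc : simpl never.

Variables (kd : L -> kind) (Sg : seq L) (labs : seq (seq nat)) (U : aut L tst G).
Notation kd' := (fun x : L * seq nat => kd x.1).
Notation N := (viol Sg labs U).

Definition starts (o : seq nat) (s : option tst) (q : tst) :=
  s = Some q \/ [/\ s = None, q \in ini U & q.1 \in o].

Lemma viol_sourcesP o q s : reflect (starts o s q) (s \in viol_sources U o q).
Proof.
rewrite /viol_sources inE; case: ifP => [/andP[h1 h2]|h].
  rewrite inE; apply: (iffP orP) => [[/eqP ->|/eqP ->]|[->|[-> _ _]]]; rewrite ?eqxx;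
    by [left | right | auto].
rewrite orbF; apply: (iffP eqP) => [->|[//|[_ h1 h2]]]; first by left.
by rewrite h1 h2 in h.
Qed.

Lemma mem_letters a o : ((a, o) \in letters Sg labs) = (a \in Sg) && (o \in labs).
Proof.
apply/allpairsP/andP => [[[a' o'] [h1 h2 [-> ->]]] //|[h1 h2]].
by exists (a, o).
Qed.

Lemma viol_calP s x s' X : reflect
  ([/\ s = None, s' = None, X = None & x \in letters Sg labs] \/
   exists q a q' Y, [/\ starts x.2 s q, x.1 = a, s' = Some q', X = Some Y
     & (q, a, q', Y) \in cal U /\ x.2 \in labs])
  ((s, x, s', X) \in viol_cal Sg labs U).
Proof.
rewrite /viol_cal mem_cat; apply: (iffP orP) => [[/mapP[y hy [-> -> -> ->]]|]|].
- by left.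
- move=> /flattenP[t /allpairsP[[[[[q a] q'] Y] o] [h1 h2 ->]]] /mapP[s1 /viol_sourcesP h3 [-> -> -> ->]].
  by right; exists q, a, q', Y.
move=> [[-> -> -> h]|[q [a [q' [Y [h1 <- -> -> [h2 h3]]]]]]].
  by left; apply/mapP; exists x.
right; apply/flattenP; exists [seq (s, (x.1, x.2), Some q', Some Y) | s <- viol_sources U x.2 q].
  by apply/allpairsP; exists ((q, x.1, q', Y), x.2).
by apply/mapP; exists s; [apply/viol_sourcesP | case: (x)].
Qed.

Lemma viol_retP s x g s' : reflect
  ([/\ s = None, s' = None, g = None \/ g = Some None & x \in letters Sg labs] \/
   exists q a q' Y, [/\ starts x.2 s q, x.1 = a, s' = Some q', g \in viol_symbols Y
     & (q, a, Y, q') \in ret U /\ x.2 \in labs])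
  ((s, x, g, s') \in viol_ret Sg labs U).
Proof.
rewrite /viol_ret mem_cat; apply: (iffP orP) => [[|]|].
- move=> /allpairsP[[y g'] /= [hy hg [es ex eg es']]]; subst; left; split=> //.
  by move: hg; rewrite !inE => /orP[] /eqP ->; auto.
- move=> /flattenP[t /allpairsP[[[[[q a] Y] q'] o] [h1 h2 ->]]] /mapP[[s1 g1]].
  move=> /allpairsP[[s2 g2] [/viol_sourcesP h3 h4 [-> ->]]] [-> -> -> ->].
  by right; exists q, a, q', Y.
move=> [[-> -> hg h]|[q [a [q' [Y [h1 <- -> h4 [h2 h3]]]]]]].
  left; apply/allpairsP; exists (x, g); split=> //.
  by case: hg => ->; rewrite !inE.
right; apply/flattenP; exists [seq (p.1, (x.1, x.2), p.2, Some q')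
      | p <- [seq (s, g) | s <- viol_sources U x.2 q, g <- viol_symbols Y]].
  by apply/allpairsP; exists ((q, x.1, Y, q'), x.2).
apply/mapP; exists (s, g); last by case: (x).
by apply/allpairsP; exists (s, g); split=> //; apply/viol_sourcesP.
Qed.

Lemma viol_locP s x s' : reflect
  ([/\ s = None, s' = None & x \in letters Sg labs] \/
   exists q a q', [/\ starts x.2 s q, x.1 = a, s' = Some q'
     & (q, a, q') \in loc U /\ x.2 \in labs])
  ((s, x, s') \in viol_loc Sg labs U).
Proof.
rewrite /viol_loc mem_cat; apply: (iffP orP) => [[/mapP[y hy [-> -> ->]]|]|].
- by left.
- move=> /flattenP[t /allpairsP[[[[q a] q'] o] [h1 h2 ->]]] /mapP[s1 /viol_sourcesP h3 [-> -> ->]].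
  by right; exists q, a, q'.
move=> [[-> -> h]|[q [a [q' [h1 <- -> [h2 h3]]]]]].
  by left; apply/mapP; exists x.
right; apply/flattenP; exists [seq (s, (x.1, x.2), Some q') | s <- viol_sources U x.2 q].
  by apply/allpairsP; exists ((q, x.1, q'), x.2).
by apply/mapP; exists s; [apply/viol_sourcesP | case: (x)].
Qed.

(** The stack of [U], over [n] remaining symbols pushed while waiting. *)
Definition above (st : seq G) n : seq (option G) := map Some st ++ nseq n None.

Lemma viol_step_inv x s v q' v' : astep kd' N x (s, v) (Some q', v') ->
  exists2 q, starts x.2 s q & forall st n, v = above st n ->
  exists st' n', v' = above st' n' /\ astep kd U x.1 (q, st) (q', st').
Proof.
rewrite /astep; case: (kd x.1) => /=.
- move=> [X [-> /viol_calP[[]//|[q [a [q1 [Y [h1 <- [->] -> [h2 _]]]]]]]]].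
  by exists q => // st n ->; exists (Y :: st), n; split=> //; exists Y.
- case: v => [|g u] [-> /viol_retP[[]//|[q [a [q1 [Y [h1 <- [->] hg [h2 _]]]]]]]];
    exists q => // st n; rewrite /above.
    case: st => // /esym; case: n => // _; exists [::], 0; split=> //.
    by case: Y hg h2.
  case: st => [|Z st] /=.
    case: n => // n [eg eu]; subst; exists [::], n; split=> //.
    by case: Y hg h2.
  move=> [e eu]; subst; exists st, n; split=> //.
  by move: hg h2; case: Y => // Y; rewrite inE => /eqP [<-].
move=> [-> /viol_locP[[]//|[q [a [q1 [h1 <- [->] [h2 _]]]]]]].
by exists q => // st n ->; exists st, n.
Qed.

Lemma viol_step_none x v v' q : ~ astep kd' N x (Some q, v) (None, v').
Proof.
rewrite /astep; case: (kd x.1) => /=.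
- by move=> [X [_ /viol_calP[[]//|[q1 [a [q2 [Y []]]]]]]].
- by case: v => [|g u] [_ /viol_retP[[]//|[q1 [a [q2 [Y []]]]]]].
by move=> [_ /viol_locP[[]//|[q1 [a [q2 []]]]]].
Qed.

Lemma viol_step_wait x n v : astep kd' N x (None, nseq n None) (None, v) ->
  exists n', v = nseq n' None.
Proof.
rewrite /astep; case: (kd x.1) => /=.
- move=> [X [-> /viol_calP[[_ _ -> _]|[q1 [a [q2 [Y []]]]]//]]].
  by exists n.+1.
- by case: n => [|n] /= [-> _]; [exists 0 | exists n].
by move=> [-> _]; exists n.
Qed.

Lemma viol_step_intro x s q st n q' st' : astep kd U x.1 (q, st) (q', st') ->
  starts x.2 s q -> x.2 \in labs ->
  exists n', astep kd' N x (s, above st n) (Some q', above st' n').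
Proof.
move=> + hs hx; rewrite /astep; case: (kd x.1) => /=.
- move=> [X [-> h]]; exists n, (Some X); split=> //.
  by apply/viol_calP; right; exists q, x.1, q', X.
- case: st => [|X u] [-> h].
    exists n.-1; case: n => [|n] /=; split=> //; apply/viol_retP; right;
    by exists q, x.1, q', None; split=> //; rewrite !inE.
  exists n; split=> //; apply/viol_retP; right.
  by exists q, x.1, q', (Some X); split=> //; rewrite !inE.
move=> [-> h]; exists n; split=> //.
by apply/viol_locP; right; exists q, x.1, q'.
Qed.

Lemma viol_wait_intro x n : x \in letters Sg labs ->
  exists n', astep kd' N x (None, nseq n None) (None, nseq n' None).
Proof.
move=> hx; rewrite /astep; case: (kd x.1) => /=.
- by exists n.+1, None; split=> //; apply/viol_calP; left.
- case: n => [|n] /=; [exists 0|exists n]; split=> //; apply/viol_retP; left; split=> //;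
  by [left | right].
by exists n; split=> //; apply/viol_locP; left.
Qed.

Lemma viol_acc_inv w q st n : acc kd' N w (Some q, above st n) ->
  acc kd U (fun i => (w i).1) (q, st).
Proof.
apply: (acc_sim (R := fun c d => exists n, c = (Some d.1, above d.2 n))) => //.
- move=> i c [q1 st1] [[q2|] v] [n1 ->] h.
    have [q3 [[<-]|[]] // h2] := viol_step_inv h.
    by have [st' [n' [-> h3]]] := h2 _ _ erefl; exists (q2, st') => //; exists n'.
  by case: (viol_step_none h).
- by move=> c [q1 st1] [n1 ->] /mapP[q2 h [->]].
by exists n.
Qed.

Lemma viol_acc_intro w q st n : (forall i, (w i).2 \in labs) ->
  acc kd U (fun i => (w i).1) (q, st) -> acc kd' N w (Some q, above st n).
Proof.
move=> hw; apply: (acc_sim (R := fun d c => exists n, c = (Some d.1, above d.2 n))).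
- move=> i [q1 st1] c [q2 st2] [n1 ->] h.
  have hs : starts (w i).2 (Some q1) q1 by left.
  have [n' h2] := viol_step_intro (x := w i) n1 h hs (hw i).
  by exists (Some q2, above st2 n') => //; exists n'.
- by move=> [q1 st1] c [n1 ->] /= h; apply: map_f.
by exists n.
Qed.

Definition violated (w : nat -> L * seq nat) := exists m q,
  [/\ q \in ini U, q.1 \in (w m).2 & acc kd U (fun i => (w (m + i)).1) (q, [::])].

Lemma viol_sound w : alang kd' N w -> violated w.
Proof.
move=> [_ /[!inE] /eqP -> [r [r0 hr hF]]].
have [m hm] : exists m, (r m).1 <> None.
  by have [m _ /mapP[q _ e]] := hF 0; exists m; rewrite e.
(* The empty stack is generalised to any number of symbols pushed while waiting, as the induction
   over the waiting time needs. *)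
rewrite -[[::]]/(nseq 0 None) in r0; elim: m w r {2}0 r0 hr hF hm => [|m IH] w r n r0 hr hF hm.
  by rewrite r0 in hm.
case e: (r 1) => [[q'|] v].
  have := hr 0; rewrite r0 e => h; have [q [//|[_ h1 h2] h3]] := viol_step_inv h.
  have [st' [n' [ev h4]]] := h3 [::] n erefl.
  exists 0, q; split=> //; apply/acc_step; exists (q', st') => //.
  apply: (@viol_acc_inv (fun i => w i.+1) q' st' n'); rewrite -ev -e.
  exists (fun i => r i.+1); split=> // k.
  by have [[|i]] := hF k.+1; rewrite // ltnS => i1 i2; exists i.
have := hr 0; rewrite r0 e => /viol_step_wait [n' ev].
have [|//|k|//|m' [q [h1 h2 h3]]] := IH (fun i => w i.+1) (fun i => r i.+1) n'.
- by rewrite e ev.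
- by have [[|i]] := hF k.+1; rewrite // ltnS => i1 i2; exists i.
by exists m'.+1, q.
Qed.

Lemma viol_complete w : (forall i, w i \in letters Sg labs) -> violated w ->
  alang kd' N w.
Proof.
move=> hw [m [q [h1 h2 h3]]]; exists None; first by rewrite inE.
rewrite -[[::]]/(nseq 0 None).
elim: m w {1}0 hw h2 h3 => [|m IH] w n hw h2 h3.
  move/acc_step: h3 => [[q' st'] hs ha].
  have hl i : (w i).2 \in labs by have := hw i; case: (w i) => a o; rewrite mem_letters => /andP[].
  have hst : starts (w 0).2 None q by right.
  have [n' h4] := viol_step_intro (x := w 0) n hs hst (hl 0).
  apply/acc_step; exists (Some q', above st' n') => //.
  apply: (@viol_acc_intro (fun i => w i.+1)) => // i; exact: hl.
have [n' hs] := viol_wait_intro n (hw 0).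
by apply/acc_step; exists (None, nseq n' None) => //; apply: IH.
Qed.

End Violation.

(** * Guessing a run together with its obligations *)

Section Labelling.

Variables (L G : eqType).
Implicit Types (A : aut L nat G) (Sg : seq L).

Definition label_symbols A : seq (option G) := None :: [seq Some t.2 | t <- cal A].
Definition stops Sg A : seq (nat * L) := [seq (q, a) | q <- fin A, a <- Sg].

(** Three sorts of moves: a step of [A], the stop in a final state, and idling in [None]. The stop
    consumes a letter because the test of the last state and the continuation are both due at the
    position where the run ends. *)
Definition label_cal Sg A :=
  [seq (Some t.1.1.1, (t.1.1.2, [:: t.1.1.1.+1]), Some t.1.2, Some t.2) | t <- cal A] ++
  [seq (Some p.1, (p.2, [:: p.1.+1; 0]), None, None) | p <- stops Sg A] ++
  [seq (None, (a, [::]), None, None) | a <- Sg].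
Definition label_ret Sg A :=
  [seq (Some t.1.1.1, (t.1.1.2, [:: t.1.1.1.+1]),
     (if t.1.2 is Some X then Some (Some X) else None), Some t.2) | t <- ret A] ++
  [seq (Some p.1, (p.2, [:: p.1.+1; 0]), g, None)
     | p <- stops Sg A, g <- None :: [seq Some g | g <- label_symbols A]] ++
  [seq (None, (a, [::]), g, None) | a <- Sg, g <- None :: [seq Some g | g <- label_symbols A]].
Definition label_loc Sg A :=
  [seq (Some t.1.1, (t.1.2, [:: t.1.1.+1]), Some t.2) | t <- loc A] ++
  [seq (Some p.1, (p.2, [:: p.1.+1; 0]), None) | p <- stops Sg A] ++
  [seq (None, (a, [::]), None) | a <- Sg].

(* The second component of a letter lists the obligations at a position: q.+1 is
   the test attached to the state q, 0 what must hold where the run stops. *)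
Definition label Sg A : aut (L * seq nat) (option nat) (option G) :=
  ([seq Some q | q <- ini A], [:: None], label_cal Sg A, label_ret Sg A, label_loc Sg A).

Arguments label_cal : simpl never.
Arguments label_ret : simpl never.
Arguments label_loc : simpl never.

(** The finitely many labels of [label]; with the letters they form the alphabet over which [viol]
    is complemented. *)
Definition labels A : seq (seq nat) :=
  [::] :: [seq [:: q.+1] | q <- states A] ++ [seq [:: q.+1; 0] | q <- fin A].

Variables (kd : L -> kind) (Sg : seq L) (A : aut L nat G).
Notation kd' := (fun x : L * seq nat => kd x.1).
Notation B := (label Sg A).

Lemma label_step_inv x y v y' v' : astep kd' B x (y, v) (y', v') ->
  match y with
  | None => x.2 = [::] /\ y' = None
  | Some q =>
    [/\ x.2 = [:: q.+1; 0], q \in fin A & y' = None] \/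
    exists q', [/\ x.2 = [:: q.+1], y' = Some q', q \in states A & forall st, v = map Some st ->
      exists2 st', v' = map Some st' & astep kd A x.1 (q, st) (q', st')]
  end.
Proof.
rewrite /astep; case: (kd x.1) => /=.
- move=> [X [-> ]]; rewrite /label_cal !mem_cat => /or3P[] /mapP.
  + move=> [[[[q a] q'] Z] h [-> -> -> ->]] /=; right; exists q'; split=> //.
      by case: (states_cal h).
    by move=> st ->; exists (Z :: st) => //; exists Z.
  + by move=> [[q a] /allpairsP[[q1 a1] /= [h1 h2 [-> ->]]] [-> -> -> _]] /=; left.
  + by move=> [a _ [-> -> ->]].
- have E g : (y, x, g, y') \in ret B ->
    match y with
    | None => x.2 = [::] /\ y' = None
    | Some q => [/\ x.2 = [:: q.+1; 0], q \in fin A & y' = None] \/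
      exists q' oX, [/\ x.2 = [:: q.+1], y' = Some q', q \in states A,
        g = (if oX is Some X then Some (Some X) else None) & (q, x.1, oX, q') \in ret A]
    end.
    rewrite /= /label_ret !mem_cat => /or3P[].
    + move=> /mapP[[[[q a] oX] q'] h [-> -> -> ->]] /=; right; exists q', oX; split=> //.
      by case: (states_ret h).
    + move=> /allpairsP[[[q a] g'] /= [h1 h2 [-> -> _ ->]]] /=.
      by left; move: h1 => /allpairsP[[q1 a1] /= [h1 _ [-> _]]].
    + by move=> /allpairsP[[a g'] /= [h1 h2 [-> -> _ ->]]].
  case: v => [|Z u] [-> /E]; case: y {E} => // q [[]|[q' [oX [e1 e2 e3 e4 h]]]];
    try (by left); right; exists q'; split=> //.
    by case=> // _; exists [::] => //; case: oX e4 h.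
  case=> // X st [eZ eu]; subst; exists st => //; split=> //.
  by case: oX e4 h => // X' [->].
move=> [-> ]; rewrite /label_loc !mem_cat => /or3P[] /mapP.
- move=> [[[q a] q'] h [-> -> ->]] /=; right; exists q'; split=> //.
    by case: (states_loc h).
  by move=> st ->; exists st.
- by move=> [[q a] /allpairsP[[q1 a1] /= [h1 h2 [-> ->]]] [-> -> ->]] /=; left.
by move=> [a _ [-> -> ->]].
Qed.

Lemma label_step_run a q st q' st' : astep kd A a (q, st) (q', st') ->
  astep kd' B (a, [:: q.+1]) (Some q, map Some st) (Some q', map Some st').
Proof.
rewrite /astep /=; case: (kd a) => /=.
- move=> [X [-> h]]; exists (Some X); split=> //; rewrite /label_cal mem_cat.
  by apply/orP; left; apply/mapP; exists (q, a, q', X).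
- case: st => [|X u] [-> h]; split=> //; rewrite /label_ret mem_cat; apply/orP; left;
    apply/mapP; [by exists (q, a, None, q') | by exists (q, a, Some X, q')].
move=> [-> h]; split=> //; rewrite /label_loc mem_cat.
by apply/orP; left; apply/mapP; exists (q, a, q').
Qed.

Definition label_stack (v : seq (option G)) := {subset v <= label_symbols A}.

Lemma label_step_none a o y v : a \in Sg -> label_stack v ->
  (y = None /\ o = [::]) \/ (exists2 q, q \in fin A & y = Some q /\ o = [:: q.+1; 0]) ->
  exists2 v', label_stack v' & astep kd' B (a, o) (y, v) (None, v').
Proof.
move=> ha hv hy.
have hl : (y, (a, o), None : option nat) \in loc B.
  rewrite /= /label_loc !mem_cat; apply/or3P.
  case: hy => [[-> ->]|[q hq [-> ->]]]; [apply: Or33|apply: Or32]; apply/mapP; first by exists a.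
  by exists (q, a) => //; apply/allpairsP; exists (q, a).
have hc : (y, (a, o), None : option nat, None : option G) \in cal B.
  rewrite /= /label_cal !mem_cat; apply/or3P.
  case: hy => [[-> ->]|[q hq [-> ->]]]; [apply: Or33|apply: Or32]; apply/mapP; first by exists a.
  by exists (q, a) => //; apply/allpairsP; exists (q, a).
have hr g : g \in None :: [seq Some g | g <- label_symbols A] ->
    (y, (a, o), g, None : option nat) \in ret B.
  move=> hg; rewrite /= /label_ret !mem_cat; apply/or3P.
  case: hy => [[-> ->]|[q hq [-> ->]]]; [apply: Or33|apply: Or32]; apply/allpairsP.
    by exists (a, g).
  by exists ((q, a), g); split=> //; apply/allpairsP; exists (q, a).
rewrite /astep /=; case: (kd a).
- exists (None :: v); last by exists None.
  by move=> g; rewrite inE => /orP[/eqP ->|/hv]; rewrite // /label_symbols inE eqxx.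
- case: v hv => [|g u] hv; first by exists [::] => //; split=> //; apply: hr; rewrite inE eqxx.
  exists u; first by move=> g' hg'; apply: hv; rewrite inE hg' orbT.
  by split=> //; apply: hr; rewrite inE; apply/orP; right; apply/map_f/hv; rewrite inE eqxx.
by exists v.
Qed.

End Labelling.

(** * Synchronised product with projection of the labels *)

Section Product.

Variables (L O Q1 G1 Q2 G2 : eqType).

Definition product_cal (B1 : aut (L * O) Q1 G1) (B2 : aut (L * O) Q2 G2) :
     seq ((Q1 * Q2) * L * (Q1 * Q2) * (G1 * G2)) :=
  [seq ((t.1.1.1, u.1.1.1), t.1.1.2.1, (t.1.2, u.1.2), (t.2, u.2))
    | t <- cal B1, u <- [seq u <- cal B2 | u.1.1.2 == t.1.1.2]].
Definition product_ret (B1 : aut (L * O) Q1 G1) (B2 : aut (L * O) Q2 G2) :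
     seq ((Q1 * Q2) * L * option (G1 * G2) * (Q1 * Q2)) :=
  [seq ((t.1.1.1, u.1.1.1), t.1.1.2.1,
      (if t.1.2 is Some X then if u.1.2 is Some Y then Some (X, Y) else None else None),
      (t.2, u.2))
    | t <- ret B1, u <- [seq u <- ret B2 | (u.1.1.2 == t.1.1.2) &&
      (if t.1.2 is Some _ then if u.1.2 is Some _ then true else false
       else if u.1.2 is Some _ then false else true)]].
Definition product_loc (B1 : aut (L * O) Q1 G1) (B2 : aut (L * O) Q2 G2) :
     seq ((Q1 * Q2) * L * (Q1 * Q2)) :=
  [seq ((t.1.1, u.1.1), t.1.2.1, (t.2, u.2))
    | t <- loc B1, u <- [seq u <- loc B2 | u.1.2 == t.1.2]].

(** Labels are projected away: a run of the product amounts to a choice of labels and runs of both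
    automata on the labelled word. Both read letters of the same kind, so their stacks have equal
    height and can be zipped. *)
Definition product (B1 : aut (L * O) Q1 G1) (B2 : aut (L * O) Q2 G2) :
     aut L (Q1 * Q2) (G1 * G2) :=
  ([seq (q1, q2) | q1 <- ini B1, q2 <- ini B2],
   [seq (q1, q2) | q1 <- fin B1, q2 <- fin B2],
   product_cal B1 B2, product_ret B1 B2, product_loc B1 B2).

Arguments product_cal : simpl never.
Arguments product_ret : simpl never.
Arguments product_loc : simpl never.

Variables (kd : L -> kind) (B1 : aut (L * O) Q1 G1) (B2 : aut (L * O) Q2 G2).
Notation kd' := (fun x : L * O => kd x.1).

Lemma product_step a q1 q2 st1 st2 q1' q2' st' : size st1 = size st2 ->
  astep kd (product B1 B2) a ((q1, q2), zip st1 st2) ((q1', q2'), st') <->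
  exists o st1' st2', [/\ st' = zip st1' st2', size st1' = size st2',
    astep kd' B1 (a, o) (q1, st1) (q1', st1') & astep kd' B2 (a, o) (q2, st2) (q2', st2')].
Proof.
move=> hsz; rewrite /astep /=; case: (kd a) => /=.
- split=> [[[X Y] [-> /allpairsPdep[[[[p1 [a1 o]] p1'] X1] [[[[p2 b] p2'] X2] []]]]]|].
    rewrite mem_filter /= => h1 /andP[/eqP eb h2] [? ? ? ? ? ? ?]; subst.
    by exists o, (X1 :: st1), (X2 :: st2); split=> //; [rewrite /= hsz | exists X1 | exists X2].
  move=> [o [s1 [s2 [-> hs [X [-> h1]] [Y [-> h2]]]]]]; exists (X, Y); split=> //.
  apply/allpairsPdep; exists (q1, (a, o), q1', X), (q2, (a, o), q2', Y); split=> //.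
  by rewrite mem_filter /= eqxx.
- case: st1 st2 hsz => [|X1 u1] [|X2 u2] //= hsz; split.
  + move=> [-> /allpairsPdep[[[[p1 [a1 o]] X1] p1'] [[[[p2 b] X2] p2'] []]]].
    rewrite mem_filter /= => h1 /andP[/andP[/eqP eb hx] h2] [? ? ? eX ? ?]; subst.
    exists o, [::], [::]; split=> //; split=> //.
      by case: X1 h1 hx eX => // X1; case: X2 {h2}.
    by case: X1 X2 h1 h2 hx eX => [X1|] [X2|].
  + move=> [o [s1 [s2 [-> hs [-> h1] [-> h2]]]]]; split=> //; apply/allpairsPdep.
    exists (q1, (a, o), None, q1'), (q2, (a, o), None, q2'); split=> //.
    by rewrite mem_filter /= eqxx.
  + move=> [-> /allpairsPdep[[[[p1 [a1 o]] Y1] p1'] [[[[p2 b] Y2] p2'] []]]].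
    rewrite mem_filter /= => h1 /andP[/andP[/eqP eb hx] h2] [? ? ? eX ? ?]; subst.
    exists o, u1, u2; case: hsz => hsz; split=> //; split=> //.
      by case: Y1 Y2 h1 h2 hx eX => [Y1|] [Y2|] // h1 h2 _ [eX eY]; subst.
    by case: Y1 Y2 h1 h2 hx eX => [Y1|] [Y2|] // h1 h2 _ [eX eY]; subst.
  + move=> [o [s1 [s2 [-> hs [-> h1] [-> h2]]]]]; split=> //; apply/allpairsPdep.
    exists (q1, (a, o), Some X1, q1'), (q2, (a, o), Some X2, q2'); split=> //.
    by rewrite mem_filter /= eqxx.
split=> [[-> /allpairsPdep[[[p1 [a1 o]] p1'] [[[p2 b] p2'] []]]]|].
  rewrite mem_filter /= => h1 /andP[/eqP eb h2] [? ? ? ? ?]; subst.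
  by exists o, st1, st2; split.
move=> [o [s1 [s2 [-> hs [-> h1] [-> h2]]]]]; split=> //.
apply/allpairsPdep; exists (q1, (a, o), q1'), (q2, (a, o), q2'); split=> //.
by rewrite mem_filter /= eqxx.
Qed.

Lemma product_inv w : alang kd (product B1 B2) w ->
  exists o : nat -> O, alang kd' B1 (fun i => (w i, o i)) /\ alang kd' B2 (fun i => (w i, o i)).
Proof.
move=> [_ /allpairsP[[q1 q2] /= [hq1 hq2 ->]] [r [r0 hr hF]]].
pose T := (seq G1 * seq G2)%type.
have [||f [f0 hf1 hf2]] := @dep_choice T
  (fun i z => size z.1 = size z.2 /\ (r i).2 = zip z.1 z.2)
  (fun i z z' => exists o, astep kd' B1 (w i, o) ((r i).1.1, z.1) ((r i.+1).1.1, z'.1) /\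
                          astep kd' B2 (w i, o) ((r i).1.2, z.2) ((r i.+1).1.2, z'.2)) ([::], [::]).
- by rewrite r0.
- move=> i [st1 st2] [/= hs e]; have := hr i.
  case: (r i) e => [[p1 p2] st] /= ->; case: (r i.+1) => [[p1' p2'] st'].
  move=> /(product_step _ _ _ _ _ _ hs) [o [s1 [s2 [-> hs' h1 h2]]]].
  by exists (s1, s2); split=> //; exists o.
have [o ho] := choiceP hf2.
exists o; split.
  exists q1 => //; exists (fun i => ((r i).1.1, (f i).1)); split.
  - by rewrite r0 f0.
  - by move=> i; case: (ho i).
  - move=> n; have [m nm /allpairsP[[p1 p2] /= [h1 _ h]]] := hF n; exists m => //.
    by rewrite h.
exists q2 => //; exists (fun i => ((r i).1.2, (f i).2)); split.
- by rewrite r0 f0.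
- by move=> i; case: (ho i).
- move=> n; have [m nm /allpairsP[[p1 p2] /= [_ h1 h]]] := hF n; exists m => //.
  by rewrite h.
Qed.

(** Pairs of final states are met infinitely often because the first run stays in final states from
    [l] on; no alternation between two Büchi conditions has to be tracked. *)
Lemma product_intro w (o : nat -> O) r1 l :
  (r1 0).1 \in ini B1 -> (r1 0).2 = [::] -> arun kd' B1 (fun i => (w i, o i)) r1 ->
  (forall i, l <= i -> (r1 i).1 \in fin B1) -> alang kd' B2 (fun i => (w i, o i)) ->
  alang kd (product B1 B2) w.
Proof.
move=> hq1 s0 h1 hl [q2 hq2 [r2 [r20 h2 hF]]].
exists ((r1 0).1, q2); first by apply/allpairsP; exists ((r1 0).1, q2).
have hs i : size (r1 i).2 = size (r2 i).2.
  elim: i => [|i IH]; first by rewrite s0 r20.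
  have := h1 i; have := h2 i; rewrite /astep /=; case: (kd (w i)).
  - by move=> [X [-> _]] [Y [-> _]] /=; rewrite IH.
  - by case: (r1 i).2 (r2 i).2 IH => [|X u] [|Y v] //= IH [-> _] [-> _] //; case: IH.
  - by move=> [-> _] [-> _].
exists (fun i => (((r1 i).1, (r2 i).1), zip (r1 i).2 (r2 i).2)); split.
- by rewrite s0 r20.
- move=> i; apply/product_step => //; exists (o i), (r1 i.+1).2, (r2 i.+1).2.
  by split=> //; rewrite -!surjective_pairing; [exact: h1 | exact: h2].
move=> n; have [m] := hF (maxn n l); rewrite geq_max => /andP[nm lm] h; exists m => //.
by apply/allpairsP; exists ((r1 m).1, (r2 m).1); split=> //; exact: hl.
Qed.

End Product.

(** * Automata for diamond formulas *)

Section Diamond.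

Variables (L Q G H : eqType).

(** Obligations arise at arbitrarily many positions and each would need a stack of its own, so they
    cannot be run beside the guessed run. The search for one violation needs one stack only; [fam]
    therefore holds automata for the negated obligations, and the search is complemented. *)
Definition diamond (Sg : seq L) (A : aut L nat H) (fam : seq (nat * aut L Q G)) :=
  product (label Sg A)
    (compl (letters Sg (labels A)) (viol Sg (labels A) (unions fam))).

Variables (kd : L -> kind) (Sg : seq L) (A : aut L nat H) (fam : seq (nat * aut L Q G)).
Variables (w : nat -> L) (T : nat -> nat -> Prop).
Hypothesis wSg : forall i, w i \in Sg.
Hypothesis fam_uniq : forall o B B', (o, B) \in fam -> (o, B') \in fam -> B = B'.
Hypothesis famT : forall o, o = 0 \/ (exists2 q, q \in states A & o = q.+1) ->
  exists2 B, (o, B) \in fam & forall m, alang kd B (fun i => w (m + i)) <-> ~ T o m.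

Notation kd' := (fun x : L * seq nat => kd x.1).

Definition accepted_until (r : nat -> nat * seq H) l :=
  [/\ (r 0).1 \in ini A, (r 0).2 = [::],
      forall i, i < l -> astep kd A (w i) (r i) (r i.+1) & (r l).1 \in fin A].

Lemma accepted_sts r l i : accepted_until r l -> i <= l -> (r i).1 \in states A.
Proof.
move=> [h0 _ hs _]; case: i => [_|i il]; first exact: states_ini.
by case: (states_step (hs i il)).
Qed.

Lemma accepted_syms r l i : accepted_until r l -> i <= l ->
  {subset map Some (r i).2 <= label_symbols A}.
Proof.
move=> [_ h0 hs _]; elim: i => [|i IH] il; first by rewrite h0.
have {}IH := IH (ltnW il); have := hs i il; rewrite /astep; case: (kd (w i)).
- move=> [X [-> h]] g; rewrite inE => /orP[/eqP ->|/IH //].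
  by rewrite inE; apply/orP; right; apply/mapP; exists ((r i).1, w i, (r i.+1).1, X).
- case: (r i).2 IH => [|X u] IH [-> _] //.
  by move=> g hg; apply: IH; rewrite inE hg orbT.
by move=> [-> _].
Qed.

Lemma diamond_sound : alang kd (diamond Sg A fam) w ->
  exists l r, accepted_until r l /\ (forall i, i <= l -> T (r i).1.+1 i) /\ T 0 l.
Proof.
move=> /product_inv [o [[_ /mapP[q0 hq0 ->] [r1 [r10 h1 hF]]] /compl_sound hv]].
have hlet i : (w i, o i) \in letters Sg (labels A).
  rewrite mem_letters wSg /=; have := h1 i.
  case: (r1 i) => y v; case: (r1 i.+1) => y' v' /label_step_inv.
  case: y => [q [[/= -> hq _]|[q' [/= -> _ hq _]]]|[/= -> _]]; rewrite /labels inE ?eqxx //= mem_cat.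
    by apply/orP; right; apply/mapP; exists q.
  by apply/orP; left; apply/mapP; exists q.
have hT m ob : ob \in o m -> ob = 0 \/ (exists2 q, q \in states A & ob = q.+1) -> T ob m.
  move=> hob /famT [B hB hTB]; apply: NNPP => /hTB [q hq ha].
  apply: hv; apply: viol_complete => //; exists m, (ob, q); split=> //.
    by apply/unions_ini; exists B.
  by apply/(unions_acc kd fam_uniq _ q [::] hB).
have hN : exists m, (r1 m).1 == None.
  by have [m _ h] := hF 0; exists m; rewrite inE in h.
(* The state is [None] for the first time at [l.+1], so the run of [A] stops at [l]; position 0 is
   excluded because initial states are not [None]. *)
case: (ex_minnP hN) => -[|l] /eqP hl hmin; first by rewrite r10 in hl.
have hsome i : i <= l -> exists q, (r1 i).1 = Some q.
  move=> il; case e: (r1 i).1 => [q|]; first by exists q.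
  by have := hmin i; rewrite e ltnNge il => /(_ isT).
(* The default state and the dropped symbols concern positions after [l] only, where the run has
   stopped. *)
pose r i := (odflt 0 (r1 i).1, pmap id (r1 i).2).
have hst i : i <= l -> (r1 i).2 = map Some (r i).2.
  elim: i => [|i IH] il; first by rewrite /r r10.
  have [q' e'] := hsome i.+1 il; have [q e] := hsome i (ltnW il).
  have := h1 i; rewrite [r1 i]surjective_pairing [r1 i.+1]surjective_pairing e e'.
  move=> /label_step_inv [[_ _ //]|[q2 [_ _ _ h]]].
  have [st' e2 _] := h _ (IH (ltnW il)).
  by rewrite /r /= e2 map_pK.
have hstep i : i < l -> astep kd A (w i) (r i) (r i.+1) /\
    (o i = [:: (r i).1.+1] /\ (r i).1 \in states A).
  move=> il; have [q' e'] := hsome i.+1 il; have [q e] := hsome i (ltnW il).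
  have := h1 i; rewrite [r1 i]surjective_pairing [r1 i.+1]surjective_pairing e e'.
  move=> /label_step_inv [[_ _ //]|[q2 [/= e3 [e4] hq h]]].
  have [st' e2 h2] := h _ (hst i (ltnW il)).
  have -> : r i.+1 = (q2, st') by rewrite /r e' e2 map_pK //= e4.
  by rewrite /r e /=; split; [exact: h2 | split].
have [ql el] := hsome l (leqnn l).
have [hol hql] : o l = [:: (r l).1.+1; 0] /\ (r l).1 \in fin A.
  have := h1 l; rewrite [r1 l]surjective_pairing [r1 l.+1]surjective_pairing el hl.
  by move=> /label_step_inv [[/= e hq _]|[q2 [_ //]]]; rewrite /r el.
have hacc : accepted_until r l.
  split=> //; [by rewrite /r r10 | by rewrite /r r10 | by move=> i /hstep []].
exists l, r; split=> //; split; last by apply: hT; [rewrite hol !inE eqxx orbT | left].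
move=> i il; apply: hT; last by right; exists (r i).1; rewrite ?(accepted_sts hacc).
move: il; rewrite leq_eqVlt => /orP[/eqP ->|/hstep [_ [-> _]]]; last by rewrite inE eqxx.
by rewrite hol inE eqxx.
Qed.

Lemma diamond_complete l r : accepted_until r l ->
  (forall i, i <= l -> T (r i).1.+1 i) -> T 0 l -> alang kd (diamond Sg A fam) w.
Proof.
move=> hacc hT h0; have [hi0 hs0 hs hf] := hacc.
pose o i := if i < l then [:: (r i).1.+1] else if i == l then [:: (r l).1.+1; 0] else [::].
pose C := (option nat * seq (option H))%type.
have [||f [f0 hf1 hf2]] := @dep_choice C
  (fun i c => if i <= l then c = (Some (r i).1, map Some (r i).2)
              else c.1 = None /\ label_stack A c.2)
  (fun i c c' => astep kd' (label Sg A) (w i, o i) c c') (Some (r 0).1, map Some (r 0).2).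
- by rewrite leq0n.
- move=> i c; case: (ltngtP i l) => [il -> |il [e hw]|-> ->].
  + exists (Some (r i.+1).1, map Some (r i.+1).2); split=> //.
    rewrite /o il; apply: label_step_run.
    by rewrite -!surjective_pairing; exact: hs.
  + have [|v' h1 h2] := @label_step_none _ _ kd Sg A (w i) (o i) None c.2 (wSg i) hw.
      by left; split=> //; rewrite /o ltnNge (ltnW il) /= gtn_eqF.
    exists (None, v'); split=> //.
    by move: h2; rewrite -{1}e -surjective_pairing.
  + have [|v' h1 h2] := @label_step_none _ _ kd Sg A (w l) (o l) (Some (r l).1)
        (map Some (r l).2) (wSg l) (accepted_syms hacc (leqnn l)).
      by right; exists (r l).1 => //; split=> //; rewrite /o ltnn eqxx.
    by exists (None, v').
have hob m ob : ob \in o m -> T ob m.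
  rewrite /o; case: (ltngtP m l) => [ml|//|->]; rewrite !inE.
    by move=> /eqP ->; apply: hT; exact: ltnW.
  by move=> /orP[] /eqP -> //; apply: hT.
have hlab i : o i \in labels A.
  rewrite /o /labels; case: (ltngtP i l) => [il|il|_]; rewrite inE ?eqxx //= mem_cat.
    apply/orP; left; apply/mapP; exists (r i).1 => //; apply: (accepted_sts hacc).
    exact: ltnW.
  by apply/orP; right; apply/mapP; exists (r l).1.
apply: (@product_intro _ _ _ _ _ _ kd _ _ w o f l.+1).
- by rewrite f0; apply: map_f.
- by rewrite f0 hs0.
- exact: hf2.
- by move=> i li; have := hf1 i; rewrite leqNgt li => -[-> _]; rewrite inE.
apply: compl_complete => [i|]; first by rewrite mem_letters wSg hlab.
move=> /viol_sound [m [[ob q] [/unions_ini [B hB hq] /= h1 h2]]].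
have hleg : ob = 0 \/ (exists2 q, q \in states A & ob = q.+1).
  move: h1; rewrite /o; case: (ltngtP m l) => [ml|//|_]; rewrite !inE.
    by move=> /eqP ->; right; exists (r m).1 => //; apply: (accepted_sts hacc); exact: ltnW.
  move=> /orP[] /eqP ->; last by left.
  by right; exists (r l).1 => //; apply: (accepted_sts hacc).
have [B' hB' hTB] := famT hleg.
have := hob _ _ h1; suff : ~ T ob m by [].
apply/hTB; rewrite -(fam_uniq hB hB'); exists q => //.
by apply/(unions_acc kd fam_uniq _ q [::] hB).
Qed.

End Diamond.

(** * Conversion from and to the automata of the statement *)

Lemma finite_sim (C D : Type) (s1 : nat -> C -> C -> Prop) (s2 : nat -> D -> D -> Prop)
    (R : C -> D -> Prop) k l r d : k <= l ->
  (forall i c d e, R c d -> s1 i c e -> exists2 f, s2 i d f & R e f) ->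
  R (r k) d -> (forall i, k <= i < l -> s1 i (r i) (r i.+1)) ->
  exists f, [/\ f k = d, forall i, k <= i < l -> s2 i (f i) (f i.+1)
    & forall i, k <= i <= l -> R (r i) (f i)].
Proof.
move=> kl hs hd hr.
have [||g [g0 h1 h2]] := @dep_choice D
  (fun n x => k + n <= l -> R (r (k + n)) x)
  (fun n x y => k + n < l -> s2 (k + n) x y) d.
- by rewrite addn0.
- move=> n x hx; case: (ltnP (k + n) l) => hn.
    have hkn : k <= k + n < l by rewrite leq_addr hn.
    have [f h1 h2] := hs _ _ _ _ (hx (ltnW hn)) (hr _ hkn).
    by exists f; split=> // _; rewrite addnS.
  by exists d; split=> //; rewrite addnS leqNgt ltnS hn.
exists (fun i => g (i - k)); split; first by rewrite subnn.
- by move=> i /andP[ki il]; rewrite subSn //; have := h2 (i - k); rewrite subnKC //; exact.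
- by move=> i /andP[ki il]; have := h1 (i - k); rewrite subnKC //; exact.
Qed.

Lemma infinite_sim (C D : Type) (s1 : nat -> C -> C -> Prop) (s2 : nat -> D -> D -> Prop)
    (R : C -> D -> Prop) r d :
  (forall i c d e, R c d -> s1 i c e -> exists2 f, s2 i d f & R e f) ->
  R (r 0) d -> (forall i, s1 i (r i) (r i.+1)) ->
  exists f, [/\ f 0 = d, forall i, s2 i (f i) (f i.+1) & forall i, R (r i) (f i)].
Proof.
move=> hs hd hr.
have [//|n x hx|f [f0 h1 h2]] := @dep_choice D (fun n x => R (r n) x) s2 d.
  by have [f h1 h2] := hs _ _ _ _ hx (hr n); exists f.
by exists f.
Qed.

Section Conversions.

Variables (P : finType) (S : pushdown_alphabet P).

(** The number that [code_elt] codes; lists over [nat] built with it have the codes of the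
    statement. *)
Definition rank (T : finType) (x : T) : nat := enum_rank x.

Lemma rank_inj (T : finType) : injective (@rank T).
Proof. by move=> x y /ord_inj /enum_rank_inj. Qed.

Definition letter_kind (n : nat) : kind :=
  if n \in [seq rank a | a <- enum (calls S)] then Kcall
  else if n \in [seq rank a | a <- enum (returns S)] then Kret else Kloc.

Definition alphabet : seq nat := [seq rank a | a <- enum {set P}].

Lemma alphabet_rank (a : {set P}) : rank a \in alphabet.
Proof. by rewrite map_f ?mem_enum. Qed.

Variant letter_spec (a : {set P}) : kind -> Prop :=
| LetterCall of a \in calls S : letter_spec a Kcall
| LetterRet of a \in returns S : letter_spec a Kret
| LetterLoc of a \in locals S : letter_spec a Kloc.

Lemma letter_kindP a : letter_spec a (letter_kind (rank a)).
Proof.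
rewrite /letter_kind !(mem_map (@rank_inj _)) !mem_enum.
case: ifP => [|hc]; first by constructor.
case: ifP => [|hr]; constructor => //.
by have := in_setT a; rewrite -(alphabet_cover S) !inE hc hr.
Qed.

Lemma letter_kind_call a : a \in calls S -> letter_kind (rank a) = Kcall.
Proof. by rewrite /letter_kind (mem_map (@rank_inj _)) mem_enum => ->. Qed.

Lemma letter_kind_ret a : a \in returns S -> letter_kind (rank a) = Kret.
Proof.
rewrite /letter_kind !(mem_map (@rank_inj _)) !mem_enum => ha.
by have := disjointFl (calls_returns_disjoint S) ha => ->; rewrite ha.
Qed.

Lemma letter_kind_loc a : a \in locals S -> letter_kind (rank a) = Kloc.
Proof.
rewrite /letter_kind !(mem_map (@rank_inj _)) !mem_enum => ha.
by rewrite (disjointFl (calls_locals_disjoint S) ha)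
  (disjointFl (returns_locals_disjoint S) ha).
Qed.

(** In [step] the letter is an index of the form [val a], which is awkward to invert. Here it is a
    parameter and its membership in a block an argument. *)
Variant step_spec (A : vpa S) (a : {set P}) (c c' : config A) : Prop :=
| StepSpecCall (h : a \in calls S) X of c'.2 = X :: c.2
    & (c.1, exist _ a h, c'.1, X) \in call_trans A
| StepSpecBot (h : a \in returns S) of c.2 = [::] & c'.2 = [::]
    & (c.1, exist _ a h, None, c'.1) \in ret_trans A
| StepSpecRet (h : a \in returns S) X of c.2 = X :: c'.2
    & (c.1, exist _ a h, Some X, c'.1) \in ret_trans A
| StepSpecLoc (h : a \in locals S) of c'.2 = c.2
    & (c.1, exist _ a h, c'.1) \in loc_trans A.

Lemma stepP (A : vpa S) a (c c' : config A) : step a c c' <-> step_spec a c c'.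
Proof.
split.
  case=> [q [b h] q' X w ht|q [b h] q' ht|q [b h] X q' w ht|q [b h] q' w ht] /=.
  - exact: (@StepSpecCall A b _ _ h X).
  - exact: (@StepSpecBot A b _ _ h).
  - exact: (@StepSpecRet A b _ _ h X).
  - exact: (@StepSpecLoc A b _ _ h).
case: c c' => [q w] [q' w'] [h X /= -> ht|h /= -> -> ht|h X /= -> ht|h /= -> ht].
- exact: (StepCall w ht).
- exact: (StepRetBot ht).
- exact: (StepRet w' ht).
- exact: (StepLoc w ht).
Qed.

Section OfVpa.

Variable A : vpa S.

Definition ofvpa : aut nat nat nat :=
  ([seq rank q | q <- enum (init A)], [seq rank q | q <- enum (final A)],
   [seq (rank d.1.1.1, rank (val d.1.1.2), rank d.1.2, rank d.2) | d <- enum (call_trans A)],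
   [seq (rank d.1.1.1, rank (val d.1.1.2), omap (@rank _) d.1.2, rank d.2) | d <- enum (ret_trans A)],
   [seq (rank d.1.1, rank (val d.1.2), rank d.2) | d <- enum (loc_trans A)]).

Definition config_ranks (c : config A) : nat * seq nat := (rank c.1, map (@rank _) c.2).

Lemma ofvpa_step a c e : astep letter_kind ofvpa (rank a) (config_ranks c) e <->
  exists2 f, step a c f & e = config_ranks f.
Proof.
case: c => q st; case: e => q1 st1; rewrite /astep; case: letter_kindP => h /=.
- split=> [[X [-> /mapP[[[[q0 a0] q2] X0]]]]|].
    rewrite mem_enum => ht [/rank_inj eq /rank_inj ea -> ->]; exists (q2, X0 :: st) => //.
    rewrite ea eq; apply/stepP; case: a0 ht {ea} => a0 h0 ht.
    exact: (@StepSpecCall _ _ _ _ h0 X0).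
  move=> [[q2 st2] /stepP hs [-> ->]]; case: hs => h2.
  + move=> X /= -> ht; exists (rank X); split=> //; apply/mapP.
    by exists (q, exist _ a h2, q2, X); rewrite ?mem_enum.
  + by have := disjointFl (calls_returns_disjoint S) h2; rewrite h.
  + by have := disjointFl (calls_returns_disjoint S) h2; rewrite h.
  + by have := disjointFl (calls_locals_disjoint S) h2; rewrite h.
- have E oX q2 : (rank q, rank a, omap (@rank _) oX, q2) \in ret ofvpa <->
     exists h0, exists2 q', q2 = rank q' & (q, exist _ a h0, oX, q') \in ret_trans A.
    split=> [/mapP[[[[q0 [a0 h0]] X0] q3]]|[h0 [q' -> ht]]]; last first.
      by apply/mapP; exists (q, exist _ a h0, oX, q'); rewrite ?mem_enum.
    rewrite mem_enum => ht [/rank_inj eq /rank_inj /= ea eX ->]; subst.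
    have -> : oX = X0 by case: X0 oX eX {ht} => [X0|] [X|] //= [/rank_inj ->].
    by exists h0, q3.
  case: st => [|X u] /=; split.
  + move=> [-> /(E None) [h0 [q' -> ht]]]; exists (q', [::]) => //.
    by apply/stepP; exact: (@StepSpecBot _ _ _ _ h0).
  + move=> [[q2 st2] /stepP hs [-> ->]]; case: hs => h2 //=.
    * by have := disjointFl (calls_returns_disjoint S) h; rewrite h2.
    * by move=> _ -> ht; split=> //; apply/(E None); exists h2, q2.
    * by have := disjointFl (returns_locals_disjoint S) h2; rewrite h.
  + move=> [-> /(E (Some X)) [h0 [q' -> ht]]]; exists (q', u) => //.
    by apply/stepP; exact: (@StepSpecRet _ _ _ _ h0 X).
  + move=> [[q2 st2] /stepP hs [-> ->]]; case: hs => h2 //=.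
    * by have := disjointFl (calls_returns_disjoint S) h; rewrite h2.
    * by move=> Y [-> ->] ht; split=> //; apply/(E (Some Y)); exists h2, q2.
    * by have := disjointFl (returns_locals_disjoint S) h2; rewrite h.
split=> [[-> /mapP[[[q0 a0] q2]]]|].
  rewrite mem_enum => ht [/rank_inj eq /rank_inj ea ->]; exists (q2, st) => //.
  rewrite ea eq; apply/stepP; case: a0 ht {ea} => a0 h0 ht.
  exact: (@StepSpecLoc _ _ _ _ h0).
move=> [[q2 st2] /stepP hs [-> ->]]; case: hs => h2.
- by have := disjointFl (calls_locals_disjoint S) h; rewrite h2.
- by have := disjointFl (returns_locals_disjoint S) h; rewrite h2.
- by have := disjointFl (returns_locals_disjoint S) h; rewrite h2.
move=> /= -> ht; split=> //; apply/mapP.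
by exists (q, exist _ a h2, q2); rewrite ?mem_enum.
Qed.

Variable alpha : omega_word P.
Definition word_from k i := rank (alpha (k + i)).

Lemma word_fromE k i : word_from k i = rank (alpha (k + i)).
Proof. by []. Qed.

Lemma ofvpa_lang : bvpa_lang A alpha <-> alang letter_kind ofvpa (word_from 0).
Proof.
split=> [[r [[h1 h2] hr hF]]|[_ /mapP[q0 hq0 ->] [r [r0 hr hF]]]].
  exists (rank (r 0).1); first by apply: map_f; rewrite mem_enum.
  exists (fun i => config_ranks (r i)); split.
  - by rewrite /config_ranks h2.
  - by move=> i; apply/ofvpa_step; exists (r i.+1).
  - move=> n; have [m nm hm] := hF n; exists m => //=.
    by apply: map_f; rewrite mem_enum.
have [|||f [f0 hf1 hf2]] := @infinite_sim _ _ (fun i => astep letter_kind ofvpa (word_from 0 i))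
   (fun i => @step P S A (alpha i)) (fun c d => c = config_ranks d) r (q0, [::]) => //.
  by move=> i c d e -> /ofvpa_step [f h1 h2]; exists f.
exists f; split=> //.
  by rewrite f0; split=> //; rewrite mem_enum in hq0.
move=> n; have [m nm] := hF n; rewrite hf2 /= => hm; exists m => //.
by move: hm; rewrite (mem_map (@rank_inj _)) mem_enum.
Qed.

Lemma ofvpa_accepted k (test : state A -> nat -> Prop) (psi : nat -> Prop) :
  (exists l, tvpa_rel test alpha k l /\ psi l) <->
  exists l r, accepted_until letter_kind ofvpa (word_from k) r l /\
    (forall i, i <= l -> exists2 q, (r i).1 = rank q & test q (k + i)) /\ psi (k + l).
Proof.
split=> [[l [[kl [r [[h1 h2] hr hF ht]]] hp]]|].
  exists (l - k), (fun i => config_ranks (r (k + i))); split; last first.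
    split; last by rewrite subnKC.
    move=> i hi; exists (r (k + i)).1 => //; apply: ht; rewrite leq_addr /=.
    by rewrite -(subnKC kl) leq_add2l.
  split.
  - by rewrite addn0; apply: map_f; rewrite mem_enum.
  - by rewrite addn0 /config_ranks h2.
  - move=> i hi; apply/ofvpa_step; exists (r (k + i.+1)) => //.
    rewrite addnS; apply: hr; rewrite leq_addr /=.
    by rewrite -(subnKC kl) ltn_add2l.
  by rewrite subnKC //; apply: map_f; rewrite mem_enum.
move=> [l [r [[/mapP[q0 hq0 e0] s0 hr hF] [ht hp]]]]; exists (k + l); split=> //.
have [|||i hi|f [f0 hf1 hf2]] := @finite_sim _ _ (fun i => astep letter_kind ofvpa (word_from k i))
   (fun i => @step P S A (alpha (k + i))) (fun c d => c = config_ranks d) 0 l r (q0, [::]) => //.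
- by move=> i c d e -> /ofvpa_step [f h1 h2]; exists f.
- by rewrite [r 0]surjective_pairing e0 s0.
- exact: hr.
split; first exact: leq_addr.
have ef i : i <= l -> r i = config_ranks (f i) by move=> il; apply: hf2.
exists (fun i => f (i - k)); split.
- by rewrite subnn f0; split=> //; rewrite mem_enum in hq0.
- move=> m /andP[km ml]; rewrite subSn //; have := hf1 (m - k).
  by rewrite subnKC //; apply; rewrite /= ltn_subLR.
- by move: hF; rewrite addKn ef //= (mem_map (@rank_inj _)) mem_enum.
move=> m /andP[km ml]; have ml' : m - k <= l by rewrite leq_subLR.
have [q] := ht (m - k) ml'; rewrite ef // subnKC // => /rank_inj e.
by rewrite /= e.
Qed.

End OfVpa.

End Conversions.

Lemma index_eq (T : eqType) (s : seq T) x y : x \in s -> index x s = index y s -> x = y.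
Proof.
move=> hx e; have hy : y \in s by rewrite -index_mem -e index_mem.
by rewrite -(nth_index x hx) e nth_index.
Qed.

(** * Return to automata over finite types *)

Section ToVpa.

Variables (P : finType) (S : pushdown_alphabet P).

(** The sizes are given as numbers and the transitions as lists, so that the code of the result can
    be computed from these data. *)
Definition mkvpa (n m : nat) (N : aut nat nat nat) : vpa S :=
  @VPA P S 'I_n 'I_m
    [set d | (val d.1.1.1, rank (val d.1.1.2), val d.1.2, val d.2) \in cal N]
    [set d | (val d.1.1.1, rank (val d.1.1.2), omap val d.1.2, val d.2) \in ret N]
    [set d | (val d.1.1, rank (val d.1.2), val d.2) \in loc N]
    [set q | val q \in ini N] [set q | val q \in fin N].

Variables (Q G : eqType).
Implicit Types (B : aut nat Q G).

Definition symbols B : seq G := [seq t.2 | t <- cal B].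
Definition state_index B q := index q (states B).
Definition symbol_index B X := index X (symbols B).

Definition renumber B : aut nat nat nat :=
  ([seq state_index B q | q <- ini B], [seq state_index B q | q <- [seq q <- fin B | q \in states B]],
   [seq (state_index B t.1.1.1, t.1.1.2, state_index B t.1.2, symbol_index B t.2) | t <- cal B],
   [seq (state_index B t.1.1.1, t.1.1.2, omap (symbol_index B) t.1.2, state_index B t.2) | t <- ret B],
   [seq (state_index B t.1.1, t.1.2, state_index B t.2) | t <- loc B]).

Definition tovpa B := mkvpa (size (states B)) (size (symbols B)) (renumber B).

Variable B : aut nat Q G.
Notation kd := (letter_kind S).

Definition represents (c : config (tovpa B)) (d : Q * seq G) :=
  [/\ d.1 \in states B, {subset d.2 <= symbols B}, val (c.1 : 'I__) = state_index B d.1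
    & map val (c.2 : seq 'I__) = map (symbol_index B) d.2].

Lemma symbols_cal q a q' X : (q, a, q', X) \in cal B -> X \in symbols B.
Proof. by move=> h; apply/mapP; exists (q, a, q', X). Qed.

Lemma represents_stepI a c d e : represents c d -> astep kd B (rank a) d e ->
  exists2 f, step a c f & represents f e.
Proof.
case: c => i u; case: d => q st; case: e => q' st' [/= hq hst hi hu] hs.
have [_ /= hq'] := states_step hs.
pose i' : 'I_(size (states B)) := Ordinal (etrans (index_mem q' (states B)) hq').
move: hs; rewrite /astep /=; case: letter_kindP => h.
- move=> [X [-> ht]]; have hX := symbols_cal ht.
  pose x : 'I_(size (symbols B)) := Ordinal (etrans (index_mem X (symbols B)) hX).
  exists (i', x :: u).
    apply/stepP; apply: (@StepSpecCall _ _ (tovpa B) _ _ _ h x) => //=.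
    by rewrite inE /= hi; apply/mapP; exists (q, rank a, q', X).
  split=> //=; last by rewrite hu.
  by move=> Y; rewrite inE => /orP[/eqP ->|/hst].
- case: st hst hu => [|X v] hst; case: u => [|x u] //=.
    move=> _ [-> ht]; exists (i', [::]) => //.
    apply/stepP; apply: (@StepSpecBot _ _ (tovpa B) _ _ _ h) => //=.
    by rewrite inE /= hi; apply/mapP; exists (q, rank a, None, q').
  move=> [hx hu] [-> ht]; exists (i', u).
    apply/stepP; apply: (@StepSpecRet _ _ (tovpa B) _ _ _ h x) => //=.
    by rewrite inE /= hi hx; apply/mapP; exists (q, rank a, Some X, q').
  by split=> // Y hY; apply: hst; rewrite inE hY orbT.
move=> [-> ht]; exists (i', u) => //.
apply/stepP; apply: (@StepSpecLoc _ _ (tovpa B) _ _ _ h) => //=.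
by rewrite inE /= hi; apply/mapP; exists (q, rank a, q').
Qed.

Lemma represents_stepE a c d f : represents c d -> step a c f ->
  exists2 e, astep kd B (rank a) d e & represents f e.
Proof.
case: c => i u; case: d => q st; case: f => i' u' [/= hq hst hi hu] /stepP.
case=> [h X /= -> | h /= e1 -> | h X /= e1 | h /= ->]; rewrite inE /= hi => /mapP.
- move=> [[[[q0 a0] q1] Y] /= ht [eq ea ei' eX]]; subst a0.
  move: ht; rewrite -(index_eq hq eq) => ht.
  have [_ hq1] := states_cal ht; exists (q1, Y :: st).
    by rewrite /astep (letter_kind_call h); exists Y.
  split=> //=; last by rewrite hu eX.
  by move=> Z; rewrite inE => /orP[/eqP ->|/hst //]; exact: symbols_cal ht.
- move=> [[[[q0 a0] oX] q1] /= ht [eq ea eX ei']]; subst a0.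
  move: ht; rewrite -(index_eq hq eq); case: oX eX => // _ ht.
  have [_ hq1] := states_ret ht; exists (q1, [::]); last by split.
  move: hu; rewrite e1; case: (st) => // _.
  by rewrite /astep (letter_kind_ret h).
- move=> [[[[q0 a0] oX] q1] /= ht [eq ea eX ei']]; subst a0.
  move: ht; rewrite -(index_eq hq eq); case: oX eX => // Y [eX] ht.
  have [_ hq1] := states_ret ht.
  move: hu hst; rewrite e1; case: (st) => //= Z v [eZ hu] hst.
  have eY : Z = Y.
    by apply: (@index_eq _ (symbols B)); [apply: hst; rewrite inE eqxx | exact: etrans (esym eZ) eX].
  exists (q1, v); first by rewrite /astep (letter_kind_ret h) /= eY.
  by split=> // W hW; apply: hst; rewrite inE hW orbT.
move=> [[[q0 a0] q1] /= ht [eq ea ei']]; subst a0.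
move: ht; rewrite -(index_eq hq eq) => ht.
have [_ hq1] := states_loc ht; exists (q1, st); last by split.
by rewrite /astep (letter_kind_loc h).
Qed.

Lemma represents_fin c d : represents c d -> (c.1 \in final (tovpa B)) = (d.1 \in fin B).
Proof.
move=> [hq _ hi _]; rewrite inE hi; apply/mapP/idP => [[q]|h].
  by rewrite mem_filter => /andP[hq' h] e; rewrite (index_eq hq e).
by exists d.1 => //; rewrite mem_filter hq.
Qed.

Lemma represents_iniI q : q \in ini B ->
  exists2 c, initial_config c & represents c (q, [::]).
Proof.
move=> hq; have hs := states_ini hq.
exists ((Ordinal (etrans (index_mem q (states B)) hs) : 'I__), [::]); last by split.
by split=> //; rewrite inE /=; apply: map_f.
Qed.

Lemma represents_iniE c : initial_config c ->
  exists2 q, q \in ini B & represents c (q, [::]).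
Proof.
case: c => i u [/=]; rewrite inE => /mapP[q hq hi] ->; exists q => //.
by split=> //; exact: states_ini.
Qed.

Variable alpha : omega_word P.

Lemma tovpa_lang : bvpa_lang (tovpa B) alpha <-> alang kd B (fun i => rank (alpha i)).
Proof.
split=> [[r [h0 hr hF]]|[q hq [r [r0 hr hF]]]].
  have [q hq hrep] := represents_iniE h0.
  have [|f [f0 h1 h2]] := infinite_sim (fun i c d e => @represents_stepE (alpha i) c d e) hrep.
    exact: hr.
  exists q => //; exists f; split=> // n.
  by have [m nm] := hF n; rewrite (represents_fin (h2 m)) => hm; exists m.
have [c hc hrep] := represents_iniI hq; rewrite -r0 in hrep.
have [|f [f0 h1 h2]] := @infinite_sim _ _ (fun i => astep kd B (rank (alpha i)))
   (fun i => @step P S (tovpa B) (alpha i)) (fun d c => represents c d) r c _ hrep hr.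
  by move=> i d c' e hd hs; have [f hf1 hf2] := represents_stepI hd hs; exists f.
exists f; split=> //; first by rewrite f0.
by move=> n; have [m nm hm] := hF n; exists m => //; rewrite (represents_fin (h2 m)).
Qed.

Lemma tovpa_rel (test : 'I_(size (states B)) -> nat -> Prop) k l :
  (forall q m, test q m) ->
  Defs.tvpa_rel (A := tovpa B) test alpha k l <->
  k <= l /\ exists q c b, [/\ q \in ini B,
    apath kd B (fun i => rank (alpha i)) k (q, [::]) l c b & c.1 \in fin B].
Proof.
move=> htest; split=> [[kl [r [h0 hr hF _]]]|[kl [q [c [b [hq hp hF]]]]]].
  split=> //; have [q hq hrep] := represents_iniE h0.
  have [|f [f0 h1 h2]] := finite_sim kl (fun i c d e => @represents_stepE (alpha i) c d e) hrep.
    exact: hr.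
  have [b hb] := run_path kl h1; exists q, (f l), b; split=> //; first by rewrite -f0.
  by rewrite -(represents_fin (h2 l _)) ?kl ?leqnn.
split=> //; have [r [r0 rl hr _]] := path_run hp.
have [c0 hc hrep] := represents_iniI hq; rewrite -r0 in hrep.
have [|f [f0 h1 h2]] := @finite_sim _ _ (fun i => astep kd B (rank (alpha i)))
   (fun i => @step P S (tovpa B) (alpha i)) (fun d c => represents c d) k l r c0 kl _ hrep hr.
  by move=> i d c' e hd hs; have [f hf1 hf2] := represents_stepI hd hs; exists f.
exists f; split=> //; first by rewrite f0.
by rewrite (represents_fin (h2 l _)) ?kl ?leqnn // rl.
Qed.

End ToVpa.

(** * From formulas to automata *)

Lemma alang_ext (L Q G : eqType) (kd : L -> kind) (A : aut L Q G) w w' :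
  w =1 w' -> alang kd A w -> alang kd A w'.
Proof.
move=> e [q hq [r [r0 hr hF]]]; exists q => //; exists r; split=> // i.
by rewrite -e.
Qed.

Section Translation.

Variables (P : finType) (S : pushdown_alphabet P).
Notation autT := (aut nat tree tree).
Notation kd := (letter_kind S).
Notation Sg := (alphabet P).

Definition moves (ls : seq nat) : seq (bool * nat) :=
  [seq (false, a) | a <- ls] ++ [seq (true, a) | a <- Sg].

Definition first_letter_ret (ls : seq nat) :=
  [seq (x, g, true) | x <- moves ls, g <- [:: None; Some tt]].

Definition first_letter (ls : seq nat) : aut nat bool unit :=
  ([:: false], [:: true], [seq (x, true, tt) | x <- moves ls],
   first_letter_ret ls,
   [seq (x, true) | x <- moves ls]).

Arguments first_letter_ret : simpl never.

Lemma first_letter_lang ls w : (forall i, w i \in Sg) ->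
  alang kd (first_letter ls) w <-> w 0 \in ls.
Proof.
move=> hw; split=> [[_ /[!inE] /eqP -> [r [r0 hr _]]]|h0].
  have hm b a : (b, a) \in moves ls -> b = false -> a \in ls.
    by rewrite mem_cat => /orP[] /mapP[x hx [-> ->]].
  have := hr 0; rewrite /astep r0 /=; case: (kd (w 0)).
  - by move=> [X [_ /mapP[[b a] h [eb ea _ _]]]]; rewrite ea; apply: hm h _.
  - by move=> [_ /allpairsP[[[b a] g] /= [h _ [eb ea _ _]]]]; rewrite ea; apply: hm h _.
  - by move=> [_ /mapP[[b a] h [eb ea _]]]; rewrite ea; apply: hm h _.
have hmv i : (0 < i, w i) \in moves ls.
  rewrite mem_cat; case: i => [|i]; apply/orP; [left | right]; exact: map_f.
have [r hr] : exists r : nat -> bool * seq unit, r 0 = (false, [::]) /\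
    forall i, astep kd (first_letter ls) (w i) (r i) (r i.+1) /\ (r i).1 = (0 < i).
  have [||f [f0 h1 h2]] := @dep_choice (bool * seq unit)%type (fun i c => c.1 = (0 < i))
     (fun i c d => astep kd (first_letter ls) (w i) c d) (false, [::]) => //; last by exists f.
  move=> i [b st] /= ->; rewrite /astep /=; have hmi := hmv i.
  have hg g : g \in [:: None; Some tt] ->
      ((0 < i), w i, g, true) \in first_letter_ret ls.
    by move=> hg; apply/allpairsP; exists ((0 < i, w i), g); split.
  case: (kd (w i)).
  - by exists (true, tt :: st); split=> //; exists tt; split=> //; apply/mapP; exists (0 < i, w i).
  - case: st => [|[] st]; first by exists (true, [::]); split=> //; split=> //; apply: hg.
    by exists (true, st); split=> //; split=> //; apply: hg.
  - by exists (true, st); split=> //; split=> //; apply/mapP; exists (0 < i, w i).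
exists false => //; exists r; split; first by case: hr.
  by move=> i; case: (hr.2 i).
by move=> n; exists n.+1 => //; rewrite (hr.2 n.+1).2 inE.
Qed.

Definition tree_complement (B : autT) : autT := collapse (compl Sg B).

Definition tree_union (B C : autT) : autT := collapse (unions [:: (0, B); (1, C)]).

(** Tag [0] stands for the continuation and [i.+1] for the test of the state of rank [i]; both are
    complemented because [diamond] searches for violations. *)
Definition family (l : seq autT) (B : autT) : seq (nat * autT) :=
  (0, tree_complement B) :: [seq (i.+1, tree_complement (nth B l i)) | i <- iota 0 (size l)].

Definition tree_diamond (A : aut nat nat nat) (l : seq autT) (B : autT) : autT :=
  collapse (diamond Sg A (family l B)).

Definition atom_letters : seq (seq nat) :=
  [seq [seq rank a | a <- [seq a : {set P} <- enum {set P} | p \in a]] | p <- enum P].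

(** De Morgan and duality reduce everything to atoms, union, complement and diamond, the
    constructions whose computability is shown. *)
Fixpoint translation (phi : vldl S) : autT :=
  match phi with
  | Atom p => collapse (first_letter (nth [::] atom_letters (rank p)))
  | Not x => tree_complement (translation x)
  | And x y => tree_complement (tree_union (tree_complement (translation x)) (tree_complement (translation y)))
  | Or x y => tree_union (translation x) (translation y)
  | @Dia _ _ A t x => tree_diamond (ofvpa A) [seq translation (t q) | q <- enum (state A)] (translation x)
  | @Box _ _ A t x =>
      tree_complement (tree_diamond (ofvpa A) [seq translation (t q) | q <- enum (state A)] (tree_complement (translation x)))
  end.

Lemma tree_complement_lang B w : (forall i, w i \in Sg) ->
  alang kd (tree_complement B) w <-> ~ alang kd B w.
Proof.
move=> hw; rewrite /tree_complement collapse_lang; split; first exact: compl_sound.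
exact: compl_complete.
Qed.

Lemma tree_union_lang B C w :
  alang kd (tree_union B C) w <-> alang kd B w \/ alang kd C w.
Proof.
rewrite /tree_union collapse_lang unions_lang; last first.
  by move=> o D D'; rewrite !inE => /orP[] /eqP [-> ->] /orP[] /eqP [].
split=> [[p]|[h|h]].
- by rewrite !inE => /orP[] /eqP -> /=; [left | right].
- by exists (0, B); rewrite ?inE ?eqxx.
- by exists (1, C); rewrite ?inE ?eqxx ?orbT.
Qed.

Lemma family_uniq l B o C C' : (o, C) \in family l B -> (o, C') \in family l B -> C = C'.
Proof.
rewrite !inE => /orP[/eqP [-> ->]|/mapP[i hi [-> ->]]] /orP[/eqP [//]|/mapP[j hj]].
  by case.
by move=> [-> ->].
Qed.

Lemma ofvpa_sts (A : vpa S) n : n \in states (ofvpa A) -> exists q : state A, n = rank q.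
Proof.
rewrite /states /= -!map_comp !mem_cat.
by do ![case/orP] => /mapP[x hx ->] /=; eexists.
Qed.

Variable alpha : omega_word P.
Notation word_from := (word_from alpha).

Lemma word_from_alphabet k i : word_from k i \in Sg.
Proof. exact: alphabet_rank. Qed.

Lemma word_from_add k m : (fun i => word_from k (m + i)) =1 word_from (k + m).
Proof. by move=> i; rewrite !word_fromE addnA. Qed.

Lemma tree_diamond_lang (A : vpa S) (t : state A -> autT) B (test : state A -> nat ->
  Prop)
    (psi : nat -> Prop) k :
  (forall q k, alang kd (t q) (word_from k) <-> test q k) ->
  (forall k, alang kd B (word_from k) <-> psi k) ->
  alang kd (tree_diamond (ofvpa A) [seq t q | q <- enum (state A)] B) (word_from k) <->
  exists l, tvpa_rel test alpha k l /\ psi l.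
Proof.
move=> ht hB; rewrite /tree_diamond collapse_lang ofvpa_accepted.
set fam := family _ _.
pose T o m := if o is n.+1 then exists2 q, n = rank q & test q (k + m) else psi (k + m).
have hT o : o = 0 \/ (exists2 q, q \in states (ofvpa A) & o = q.+1) ->
    exists2 C, (o, C) \in fam & forall m, alang kd C (fun i => word_from k (m + i)) <-> ~ T o m.
  have hw m i : word_from k (m + i) \in Sg by apply: alphabet_rank.
  case=> [->|[n /ofvpa_sts [q ->] ->]].
    exists (tree_complement B); first by rewrite inE eqxx.
    move=> m; rewrite tree_complement_lang // /T -hB.
    by split=> h h'; apply: h; apply: alang_ext h' => i; rewrite word_from_add.
  exists (tree_complement (t q)).
    rewrite inE; apply/orP; right; apply/mapP; exists (rank q).
      by rewrite mem_iota /= add0n size_map -cardE ltn_ord.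
    by rewrite (nth_map q) -?cardE ?ltn_ord // nth_enum_rank.
  move=> m; rewrite tree_complement_lang // /T; split=> h h'; apply: h.
    case: h' => q' /rank_inj <-; rewrite -ht.
    by apply: alang_ext => i; rewrite word_from_add.
  by exists q => //; rewrite -ht; apply: alang_ext h' => i; rewrite word_from_add.
split.
  move=> /(diamond_sound (word_from_alphabet k) (@family_uniq _ _) hT) [l [r [h1 [h2 h3]]]].
  by exists l, r.
move=> [l [r [h1 [h2 h3]]]].
exact: (diamond_complete (word_from_alphabet k) (@family_uniq _ _) hT h1 h2 h3).
Qed.

Lemma translation_sat phi k :
  alang kd (translation phi) (word_from k) <-> sat phi alpha k.
Proof.
elim: phi k => [p|x IH|x IHx y IHy|x IHx y IHy|A t IHt x IH|A t IHt x IH] k /=.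
- rewrite collapse_lang first_letter_lang; last exact: word_from_alphabet.
  rewrite /atom_letters (nth_map p) -?cardE ?ltn_ord // nth_enum_rank word_fromE addn0.
  rewrite mem_map; last exact: rank_inj.
  by rewrite mem_filter mem_enum andbT.
- by rewrite tree_complement_lang ?IH //; exact: word_from_alphabet.
- rewrite tree_complement_lang; last exact: word_from_alphabet.
  rewrite tree_union_lang !tree_complement_lang; try exact: word_from_alphabet.
  rewrite IHx IHy; split=> [h|[h1 h2] []] //.
  by split; apply: NNPP => h'; apply: h; [left | right].
- by rewrite tree_union_lang IHx IHy.
- exact: tree_diamond_lang.
rewrite tree_complement_lang; last exact: word_from_alphabet.
rewrite (tree_diamond_lang (test := fun q => sat (t q) alpha) (psi := fun l => ~ sat x alpha l)) //.
  split=> [h l hl|h [l [h1 h2]]]; last by apply: h2; exact: h.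
  by apply: NNPP => h'; apply: h; exists l.
by move=> j; rewrite tree_complement_lang ?IH //; exact: word_from_alphabet.
Qed.

End Translation.

(** * Computability of the constructions *)

Lemma comp_app2 {E} {eE : Enc E} X {eX : Enc X} Y {eY : Enc Y} Z {eZ : Enc Z}
    (f : X -> Y -> Z) (a : E -> X) (b : E -> Y) :
  computable (fun z : X * Y => f z.1 z.2) -> computable a -> computable b ->
  computable (fun e => f (a e) (b e)).
Proof.
by move=> hf ha hb; apply: (comp_comp hf (g := fun e => (a e, b e))); exact: comp_pair.
Qed.

Lemma comp_app3 {E} {eE : Enc E} X {eX : Enc X} Y {eY : Enc Y} Z {eZ : Enc Z}
    T {eT : Enc T} (f : X -> Y -> Z -> T) (a : E -> X) (b : E -> Y) (c : E -> Z) :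
  computable (fun z : X * Y * Z => f z.1.1 z.1.2 z.2) -> computable a -> computable b -> computable c ->
  computable (fun e => f (a e) (b e) (c e)).
Proof.
move=> hf ha hb hc; apply: (comp_comp hf (g := fun e => (a e, b e, c e))).
by do 2![apply: comp_pair => //].
Qed.

Lemma comp_app4 {E} {eE : Enc E} X {eX : Enc X} Y {eY : Enc Y} Z {eZ : Enc Z}
    T {eT : Enc T} U {eU : Enc U} (f : X -> Y -> Z -> T -> U)
    (a : E -> X) (b : E -> Y) (c : E -> Z) (d : E -> T) :
  computable (fun z : X * Y * Z * T => f z.1.1.1 z.1.1.2 z.1.2 z.2) ->
  computable a -> computable b -> computable c -> computable d ->
  computable (fun e => f (a e) (b e) (c e) (d e)).
Proof.
move=> hf ha hb hc hd; apply: (comp_comp hf (g := fun e => (a e, b e, c e, d e))).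
by do 3![apply: comp_pair => //].
Qed.

Section CompAut.

Context {L Q G : eqType} {eL : Enc L} {eQ : Enc Q} {eG : Enc G}.
Notation autA := (aut L Q G).
Notation tri := (Q * bool * Q)%type.

Lemma comp_states : computable (fun A : autA => states A).
Proof. by rewrite /states; comp_tac. Qed.

Ltac profile_step := match goal with
  |- computable (fun e => states (@?a e)) => apply: (comp_comp comp_states) end.
Ltac profile_tac := repeat first [profile_step | comp_step].

Lemma comp_triples : computable (fun A : autA => triples A).
Proof. by rewrite /triples; profile_tac. Qed.

Ltac profile_step ::= match goal with
  |- computable (fun e => states (@?a e)) => apply: (comp_comp comp_states)
| |- computable (fun e => triples (@?a e)) => apply: (comp_comp comp_triples) end.

Lemma comp_id_profile : computable (fun A : autA => id_profile A).
Proof. by rewrite /id_profile; profile_tac. Qed.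

Lemma comp_seq_profile : computable (fun z :
  autA * seq tri * seq tri => seq_profile z.1.1 z.1.2 z.2).
Proof. by rewrite /seq_profile; profile_tac. Qed.

Lemma comp_call_profile : computable (fun z : autA * L => call_profile z.1 z.2).
Proof. by rewrite /call_profile; profile_tac. Qed.

Lemma comp_bot_profile : computable (fun z : autA * L => bot_profile z.1 z.2).
Proof. by rewrite /bot_profile; profile_tac. Qed.

Lemma comp_loc_profile : computable (fun z : autA * L => loc_profile z.1 z.2).
Proof. by rewrite /loc_profile; profile_tac. Qed.

Lemma comp_match_profile : computable (fun z :
  autA * L * seq tri * L => match_profile z.1.1.1 z.1.1.2 z.1.2 z.2).
Proof. by rewrite /match_profile; profile_tac. Qed.

Lemma comp_subseqs X {eX : Enc X} : computable (fun s : seq X => subseqs s).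
Proof.
apply: (comp_ext (f := fun s =>
  foldr (fun x acc => [seq x :: u | u <- acc] ++ acc) [:: [::]] s)) => [s|].
  by elim: s => //= x s ->.
by profile_tac.
Qed.

End CompAut.

Ltac comp_profile := match goal with
  | |- computable (fun e => states (@?a e)) => apply: (comp_comp comp_states)
  | |- computable (fun e => triples (@?a e)) => apply: (comp_comp comp_triples)
  | |- computable (fun e => id_profile (@?a e)) => apply: (comp_comp comp_id_profile)
  | |- computable (fun e => seq_profile (@?a e) (@?b e) (@?c e)) => apply: (comp_app3 comp_seq_profile)
  | |- computable (fun e => call_profile (@?a e) (@?b e)) => apply: (comp_app2 comp_call_profile)
  | |- computable (fun e => bot_profile (@?a e) (@?b e)) => apply: (comp_app2 comp_bot_profile)
  | |- computable (fun e => loc_profile (@?a e) (@?b e)) => apply: (comp_app2 comp_loc_profile)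
  | |- computable (fun e => match_profile (@?a e) (@?b e) (@?c e) (@?d e)) => apply: (comp_app4 comp_match_profile)
  | |- computable (fun e => subseqs (@?a e)) => apply: (comp_comp comp_subseqs)
  end.

Ltac comp_aut := fail.
Ltac comp_auto := repeat first [comp_aut | comp_profile | comp_step].

Section CompAut.

Context {L Q G : eqType} {eL : Enc L} {eQ : Enc Q} {eG : Enc G}.
Notation autA := (aut L Q G).
Notation tri := (Q * bool * Q)%type.

Lemma comp_daut : computable (fun z :
  seq L * autA * seq (dstate Q) => daut z.1.1 z.1.2 z.2).
Proof.
rewrite /daut /daut_cal /daut_ret /daut_loc /dsymbols /dstates /dinit /dcall /dret /dloc /dbot.
by comp_auto.
Qed.

Lemma comp_accpair :
  computable (fun z : autA * seq tri * seq tri => accpair z.1.1 z.1.2 z.2).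
Proof. by rewrite /accpair; comp_auto. Qed.

Ltac comp_aut ::= match goal with
  | |- computable (fun e => accpair (@?a e) (@?b e) (@?c e)) => apply: (comp_app3 comp_accpair)
  | |- computable (fun e => daut (@?a e) (@?b e) (@?c e)) => apply: (comp_app3 comp_daut)
  end.

Lemma comp_resets : computable (fun z :
  autA * aut L (dstate Q) (dstate Q * L) => resets z.1 z.2).
Proof.
rewrite /resets /resets_cal /resets_ret /resets_loc /ksrc /ksucc /goals /dinit.
by comp_auto.
Qed.

Lemma comp_compl : computable (fun z : seq L * autA => compl z.1 z.2).
Proof. by rewrite /compl; apply: (comp_app2 comp_resets); comp_auto. Qed.

Lemma comp_unions : computable (fun fam : seq (nat * autA) => unions fam).
Proof. by rewrite /unions; comp_auto. Qed.

Lemma comp_collapse : computable (fun A : autA => collapse A).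
Proof.
rewrite /collapse /omap /obind /oapp.
by repeat first [progress comp_auto | apply: comp_code].
Qed.

End CompAut.

Section CompViolation.

Context {L Q G : eqType} {eL : Enc L} {eQ : Enc Q} {eG : Enc G}.
Notation autA := (aut L (nat * Q)%type G).

Lemma comp_letters : computable (fun z : seq L * seq (seq nat) => letters z.1 z.2).
Proof. by rewrite /letters; comp_auto. Qed.

Ltac comp_aut ::= match goal with
  | |- computable (fun e => letters (@?a e) (@?b e)) => apply: (comp_app2 comp_letters)
  end.

Lemma comp_viol :
  computable (fun z : seq L * seq (seq nat) * autA => viol z.1.1 z.1.2 z.2).
Proof. by rewrite /viol /viol_cal /viol_ret /viol_loc /viol_sources /viol_symbols; comp_auto. Qed.

End CompViolation.

Section CompLabel.

Context {L G : eqType} {eL : Enc L} {eG : Enc G}.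
Notation autA := (aut L nat G).

Lemma comp_label : computable (fun z : seq L * autA => label z.1 z.2).
Proof.
by rewrite /label /label_cal /label_ret /label_loc /stops /label_symbols; comp_auto.
Qed.

Lemma comp_labels : computable (fun A : autA => labels A).
Proof. by rewrite /labels; comp_auto. Qed.

End CompLabel.

Section CompProduct.

Context {L O Q1 G1 Q2 G2 : eqType}.
Context {eL : Enc L} {eO : Enc O} {eQ1 : Enc Q1} {eG1 : Enc G1} {eQ2 : Enc Q2} {eG2 : Enc G2}.

Lemma comp_product : computable (fun z : aut (L * O) Q1 G1 * aut (L * O) Q2 G2 =>
  product z.1 z.2).
Proof. by rewrite /product /product_cal /product_ret /product_loc; comp_auto. Qed.

End CompProduct.

Section CompDiamond.

Context {L Q G H : eqType} {eL : Enc L} {eQ : Enc Q} {eG : Enc G} {eH : Enc H}.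

Lemma comp_diamond :
  computable (fun z : seq L * aut L nat H * seq (nat * aut L Q G) => diamond z.1.1 z.1.2 z.2).
Proof.
rewrite /diamond; apply: (comp_app2 comp_product).
  by apply: (comp_app2 comp_label); comp_auto.
apply: (comp_app2 comp_compl).
  by apply: (comp_app2 comp_letters); [comp_auto | apply: (comp_comp comp_labels); comp_auto].
apply: (comp_app3 comp_viol); [by comp_auto | |].
  by apply: (comp_comp comp_labels); comp_auto.
by apply: (comp_comp comp_unions); comp_auto.
Qed.

End CompDiamond.

(** * Computability of the translation of formulas *)

Section CompTrans.

Variables (P : finType) (S : pushdown_alphabet P).
Notation autT := (aut nat tree tree).

(** A nested pair ending in [unit] has the code of a list whose members may differ in type, which is
    the shape of [code_vpa]. *)
Notation rawvpa := (nat * (nat * (seq (nat * (nat * (nat * (nat * unit)))) *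
  (seq (nat * (nat * (option nat * (nat * unit)))) *
  (seq (nat * (nat * (nat * unit))) * (seq nat * (seq nat * unit)))))))%type.

Definition rawof (A : vpa S) : rawvpa :=
  (#|state A|, (#|Gam A|,
  ([seq (rank d.1.1.1, (rank (val d.1.1.2), (rank d.1.2, (rank d.2, tt)))) | d <- enum (call_trans A)],
  ([seq (rank d.1.1.1, (rank (val d.1.1.2), (omap (@rank _) d.1.2, (rank d.2, tt))))
     | d <- enum (ret_trans A)],
  ([seq (rank d.1.1, (rank (val d.1.2), (rank d.2, tt))) | d <- enum (loc_trans A)],
  ([seq rank q | q <- enum (init A)], ([seq rank q | q <- enum (final A)], tt))))))).

Lemma code_rawof A : code (rawof A) = code_vpa A.
Proof.
have e1 : [seq let: (q, a, q', X) := d in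
    code_list [:: code_elt q; code_elt (val a); code_elt q'; code_elt X]
    | d <- enum (call_trans A)] = map code (rawof A).2.2.1.
  by rewrite -map_comp; apply: eq_map => -[[[q a] q'] X].
have e2 : [seq let: (q, a, X, q') := d in
    code_list [:: code_elt q; code_elt (val a); code_opt X; code_elt q']
    | d <- enum (ret_trans A)] = map code (rawof A).2.2.2.1.
  by rewrite -map_comp; apply: eq_map => -[[[q a] [X|]] q'].
have e3 : [seq let: (q, a, q') := d in
    code_list [:: code_elt q; code_elt (val a); code_elt q']
    | d <- enum (loc_trans A)] = map code (rawof A).2.2.2.2.1.
  by rewrite -map_comp; apply: eq_map => -[[q a] q'].
have e4 (s : {set state A}) : [seq code_elt q | q <- enum s] = map code [seq rank q | q <- enum s].
  by rewrite -map_comp.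
by rewrite /code_vpa e1 e2 e3 !e4.
Qed.

Definition autof (r : rawvpa) : aut nat nat nat :=
  (r.2.2.2.2.2.1, r.2.2.2.2.2.2.1,
   [seq (x.1, x.2.1, x.2.2.1, x.2.2.2.1) | x <- r.2.2.1],
   [seq (x.1, x.2.1, x.2.2.1, x.2.2.2.1) | x <- r.2.2.2.1],
   [seq (x.1, x.2.1, x.2.2.1) | x <- r.2.2.2.2.1]).

Lemma autof_rawof A : autof (rawof A) = ofvpa A.
Proof. by rewrite /autof /ofvpa /= -!map_comp. Qed.

Lemma comp_autof : computable autof.
Proof. by rewrite /autof; comp_auto. Qed.

Lemma comp_first_letter : computable (fun ls : seq nat => first_letter P ls).
Proof. by rewrite /first_letter /first_letter_ret /moves; comp_auto. Qed.

Lemma comp_tree_complement : computable (fun B : autT => tree_complement P B).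
Proof.
rewrite /tree_complement; apply: (comp_comp comp_collapse).
by apply: (comp_app2 comp_compl); comp_auto.
Qed.

Ltac comp_aut ::= match goal with
  | |- computable (fun e => tree_complement _ (@?a e)) => apply: (comp_comp comp_tree_complement)
  | |- computable (fun e => autof (@?a e)) => apply: (comp_comp comp_autof)
  | |- computable (fun e => first_letter _ (@?a e)) => apply: (comp_comp comp_first_letter)
  | |- computable (fun e => collapse (@?a e)) => apply: (comp_comp comp_collapse)
  | |- computable (fun e => unions (@?a e)) => apply: (comp_comp comp_unions)
  end.

Lemma comp_tree_union : computable (fun z : autT * autT => tree_union z.1 z.2).
Proof.
rewrite /tree_union; apply: (comp_comp comp_collapse).
by apply: (comp_comp comp_unions); comp_auto.
Qed.

Ltac comp_aut ::= match goal with
  | |- computable (fun e => tree_complement _ (@?a e)) => apply: (comp_comp comp_tree_complement)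
  | |- computable (fun e => tree_union (@?a e) (@?b e)) => apply: (comp_app2 comp_tree_union)
  | |- computable (fun e => autof (@?a e)) => apply: (comp_comp comp_autof)
  | |- computable (fun e => first_letter _ (@?a e)) => apply: (comp_comp comp_first_letter)
  | |- computable (fun e => collapse (@?a e)) => apply: (comp_comp comp_collapse)
  | |- computable (fun e => unions (@?a e)) => apply: (comp_comp comp_unions)
  end.

Lemma comp_tree_diamond : computable (fun z :
  aut nat nat nat * seq autT * autT => tree_diamond P z.1.1 z.1.2 z.2).
Proof.
rewrite /tree_diamond; apply: (comp_comp comp_collapse).
apply: (comp_app3 comp_diamond); [by comp_auto | by comp_auto |].
by rewrite /family; comp_auto.
Qed.

Definition selector (a c0 c1 c2 c3 c4 c5 : tree) :=
  tree_case a (tree_case (ttl a) (tree_case (ttl (ttl a)) (tree_case (ttl (ttl (ttl a)))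
    (tree_case (ttl (ttl (ttl (ttl a)))) c5 c4) c3) c2) c1) c0.

(* The value of the tree recursion at t consists of the translation of t read as
   a formula, the list of the translations of the members of t read as a list of
   formulas, and the values at both children. *)
Lemma comp_translation : exists2 F, tree_computable F & forall phi : vldl S,
  F (code_vldl phi) = code (translation phi).
Proof.
have [FA hFA eA] : computable (fun n : nat => collapse (first_letter P (nth [::] (atom_letters P) n))).
  by comp_auto.
have [FN hFN eN] := comp_tree_complement.
have [FO hFO eO] := comp_tree_union.
have [FC hFC eC] : computable (fun z : autT * autT => tree_complement P (tree_union (tree_complement P z.1) (tree_complement P z.2))).
  by comp_auto.
have [FD hFD eD] : computable (fun z : rawvpa * seq autT * autT => tree_diamond P (autof z.1.1) z.1.2 z.2).
  by apply: (comp_app3 comp_tree_diamond); comp_auto.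
have [FB hFB eB] : computable (fun z : rawvpa * seq autT * autT =>
    tree_complement P (tree_diamond P (autof z.1.1) z.1.2 (tree_complement P z.2))).
  by apply: (comp_comp comp_tree_complement); apply: (comp_app3 comp_tree_diamond); comp_auto.
(* [form] and [lst] read the two results stored for a node; [arg1] and [rest] are the values stored
   for its left and right child. *)
pose arg1 r := thd (ttl (ttl r)); pose rest r := ttl (ttl (ttl r)).
pose form r := thd r; pose lst r := thd (ttl r).
pose tg z := thd (thd z); pose args z := ttl (thd z).
pose ra z := thd (ttl z); pose rb z := ttl (ttl z).
pose f1 z := form (arg1 (rb z)); pose f2 z := form (arg1 (rest (rb z))).
pose f3 z := form (arg1 (rest (rest (rb z)))); pose l2 z := lst (arg1 (rest (rb z))).
(* An atom and an automaton enter as subtrees, immediate subformulas and lists of tests through the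
   values of the recursion. *)
pose g z := selector (tg z) (FA (thd (args z))) (FN (f1 z)) (FC (Node (f1 z) (f2 z)))
  (FO (Node (f1 z) (f2 z))) (FD (Node (Node (thd (args z)) (l2 z)) (f3 z)))
  (FB (Node (Node (thd (args z)) (l2 z)) (f3 z))).
pose G z := Node (g z) (Node (Node (form (ra z)) (lst (rb z))) (Node (ra z) (rb z))).
have hG : tree_computable G.
  rewrite /G /g /selector /f1 /f2 /f3 /l2 /ra /rb /tg /args /form /lst /arg1 /rest.
  repeat first [ exact: tcomp_const | exact: tcomp_id | apply: tcomp_node
    | apply: tcomp_hd | apply: tcomp_tl | apply: tcomp_case
    | apply: (tcomp_comp hFA) | apply: (tcomp_comp hFN) | apply: (tcomp_comp hFC)
    | apply: (tcomp_comp hFO) | apply: (tcomp_comp hFD) | apply: (tcomp_comp hFB) ].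
pose R := tree_fold Nil G.
have lstE s : lst (R (code_list s)) = code_list [seq form (R x) | x <- s].
  by elim: s => //= x s IH; rewrite /lst /= -IH.
exists (fun t => form (R t)); first exact/tcomp_hd/tcomp_tree_fold.
have tE A (t : state A -> vldl S) : (forall q, form (R (code_vldl (t q))) = code (translation (t q))) ->
    lst (R (code_list [seq code_vldl (t q) | q <- enum (state A)])) =
    code [seq translation (t q) | q <- enum (state A)].
  move=> h; rewrite lstE /= -!map_comp; congr code_list.
  by apply: eq_map => q; rewrite /= h.
have RE a b : R (Node a b) = G (Node (Node a b) (Node (R a) (R b))) by [].
have R0 x : form (R (code_list [:: code_nat 0; x])) = FA x by [].
have R1 x : form (R (code_list [:: code_nat 1; x])) = FN (form (R x)) by [].
have R2 x y : form (R (code_list [:: code_nat 2; x; y])) =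
  FC (Node (form (R x)) (form (R y))) by [].
have R3 x y : form (R (code_list [:: code_nat 3; x; y])) =
  FO (Node (form (R x)) (form (R y))) by [].
have R4 x s y : form (R (code_list [:: code_nat 4; x; s; y])) =
  FD (Node (Node x (lst (R s))) (form (R y))) by [].
have R5 x s y : form (R (code_list [:: code_nat 5; x; s; y])) =
  FB (Node (Node x (lst (R s))) (form (R y))) by [].
elim=> [p|x IH|x IHx y IHy|x IHx y IHy|A t IHt x IH|A t IHt x IH].
- by apply: etrans (R0 _) _; exact: (eA (rank p)).
- by apply: etrans (R1 _) _; rewrite IH eN.
- by apply: etrans (R2 _ _) _; rewrite IHx IHy; exact: (eC (_, _)).
- by apply: etrans (R3 _ _) _; rewrite IHx IHy; exact: (eO (_, _)).
- apply: etrans (R4 _ _ _) _; rewrite IH tE // -code_rawof.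
  by apply: etrans (eD (rawof A, _, _)) _; rewrite autof_rawof.
apply: etrans (R5 _ _ _) _; rewrite IH tE // -code_rawof.
by apply: etrans (eB (rawof A, _, _)) _; rewrite autof_rawof.
Qed.

End CompTrans.

(** * Computing the code of a [vpa] *)

Lemma enum_setE (T : finType) (p : pred T) : enum [set x | p x] = filter p (enum T).
Proof. by rewrite enumT; apply: eq_filter => x; rewrite /= inE. Qed.

Lemma enum_prodE (T1 T2 : finType) :
  enum {: T1 * T2} = [seq (x, y) | x <- enum T1, y <- enum T2].
Proof. by rewrite [LHS]enumT [in LHS]unlock. Qed.

Lemma enum_optionE (T : finType) : enum {: option T} = None :: map Some (enum T).
Proof. by rewrite [LHS]enumT [in LHS]unlock /= /option_enum -enumT. Qed.

Lemma map_enum_prod (T1 T2 : finType) U1 U2 (f : T1 -> U1) (g : T2 -> U2) :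
  [seq (f d.1, g d.2) | d <- enum {: T1 * T2}] =
  [seq (x, y) | x <- map f (enum T1), y <- map g (enum T2)].
Proof. by rewrite enum_prodE map_allpairs allpairs_mapl allpairs_mapr. Qed.

Lemma map_enum_option m :
  map (omap val) (enum {: option 'I_m}) = None :: map Some (iota 0 m).
Proof.
by rewrite enum_optionE -(val_enum_ord m) map_cons -(map_comp Some val)
  -(map_comp (omap val) Some).
Qed.

Lemma rank_ord n (i : 'I_n) : rank i = val i.
Proof. by rewrite /rank enum_rank_ord. Qed.

Section CodeVpa.

Variables (P : finType) (S : pushdown_alphabet P).

(** The alphabet is fixed, so this list is a constant of the program. *)
Definition block_letters (X : {set {set P}}) : seq nat :=
  [seq rank (val a) | a <- enum {: {a | a \in X}}].

Definition cal_tuples n m : seq (nat * nat * nat * nat) :=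
  [seq (x, z) | x <- [seq (x, j) | x <- [seq (i, a) | i <- iota 0 n,
     a <- block_letters (calls S)], j <- iota 0 n], z <- iota 0 m].
Definition ret_tuples n m : seq (nat * nat * option nat * nat) :=
  [seq (x, j) | x <- [seq (x, z) | x <- [seq (i, a) | i <- iota 0 n,
     a <- block_letters (returns S)], z <- None :: map Some (iota 0 m)], j <- iota 0 n].
Definition loc_tuples n : seq (nat * nat * nat) :=
  [seq (x, j) | x <- [seq (i, a) | i <- iota 0 n, a <- block_letters (locals S)],
     j <- iota 0 n].

(** [code_vpa] lists a transition set in the order of [enum]. On a product type this is the
    lexicographic order, so the program filters the lexicographic list of all tuples instead of
    using the list of transitions at hand. *)
Definition code_mkvpa (n m : nat) (N : aut nat nat nat) : tree :=
  Node (code n) (Node (code m)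
   (Node (code [seq [:: x.1.1.1; x.1.1.2; x.1.2; x.2] | x <- cal_tuples n m & x \in cal N])
   (Node (code [seq [:: code x.1.1.1; code x.1.1.2; code x.1.2; code x.2]
      | x <- ret_tuples n m & x \in ret N])
   (Node (code [seq [:: x.1.1; x.1.2; x.2] | x <- loc_tuples n & x \in loc N])
   (Node (code [seq i <- iota 0 n | i \in ini N])
   (Node (code [seq i <- iota 0 n | i \in fin N]) Nil)))))).

Lemma comp_code_mkvpa : computable (fun z : nat * nat * aut nat nat nat =>
  code_mkvpa z.1.1 z.1.2 z.2).
Proof.
rewrite /code_mkvpa /cal_tuples /ret_tuples /loc_tuples.
by repeat first [progress comp_auto | apply: comp_code].
Qed.

Lemma code_mkvpaE n m N : code_vpa (mkvpa S n m N) = code_mkvpa n m N.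
Proof.
have e1 : [seq (val d.1.1.1, rank (val d.1.1.2), val d.1.2, val d.2)
    | d <- enum {: 'I_n * {a | a \in calls S} * 'I_n * 'I_m}] = cal_tuples n m.
  by rewrite (@map_enum_prod _ _ _ _
    (fun d => (val d.1.1, rank (val d.1.2), val d.2)) val)
    (@map_enum_prod _ _ _ _ (fun d => (val d.1, rank (val d.2))) val)
    (@map_enum_prod _ _ _ _ val (fun a => rank (val a))) !val_enum_ord.
have e2 : [seq (val d.1.1.1, rank (val d.1.1.2), omap val d.1.2, val d.2)
    | d <- enum {: 'I_n * {a | a \in returns S} * option 'I_m * 'I_n}] = ret_tuples n m.
  by rewrite (@map_enum_prod _ _ _ _
    (fun d => (val d.1.1, rank (val d.1.2), omap val d.2)) val)
    (@map_enum_prod _ _ _ _ (fun d => (val d.1, rank (val d.2))) (omap val))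
    (@map_enum_prod _ _ _ _ val (fun a => rank (val a))) !val_enum_ord map_enum_option.
have e3 : [seq (val d.1.1, rank (val d.1.2), val d.2)
    | d <- enum {: 'I_n * {a | a \in locals S} * 'I_n}] = loc_tuples n.
  by rewrite (@map_enum_prod _ _ _ _ (fun d => (val d.1, rank (val d.2))) val)
    (@map_enum_prod _ _ _ _ val (fun a => rank (val a))) !val_enum_ord.
have e4 (p : pred nat) : [seq code_elt q | q <- enum [set q : 'I_n | p (val q)]] =
    [seq code i | i <- [seq i <- iota 0 n | p i]].
  rewrite -(val_enum_ord n) filter_map -map_comp enum_setE; apply: eq_map => i.
  by rewrite /= /code_elt -/(rank i) rank_ord.
have ek k (i : 'I_k) : code_elt i = code_nat i by rewrite /code_elt -/(rank i) rank_ord.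
have f1 : [seq let: (q, a, q', X) := d in
    code_list [:: code_elt q; code_elt (val a); code_elt q'; code_elt X]
    | d <- enum (call_trans (mkvpa S n m N))] =
    map code [seq [:: x.1.1.1; x.1.1.2; x.1.2; x.2] | x <- cal_tuples n m & x \in cal N].
  rewrite -e1 filter_map -!map_comp enum_setE.
  by apply: eq_map => -[[[i a] j] x] /=; rewrite !ek.
have f2 : [seq let: (q, a, X, q') := d in
    code_list [:: code_elt q; code_elt (val a); code_opt X; code_elt q']
    | d <- enum (ret_trans (mkvpa S n m N))] =
    map code [seq [:: code x.1.1.1; code x.1.1.2; code x.1.2; code x.2]
      | x <- ret_tuples n m & x \in ret N].
  rewrite -e2 filter_map -!map_comp enum_setE.
  by apply: eq_map => -[[[i a] [x|]] j] /=; rewrite !ek.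
have f3 : [seq let: (q, a, q') := d in
    code_list [:: code_elt q; code_elt (val a); code_elt q']
    | d <- enum (loc_trans (mkvpa S n m N))] =
    map code [seq [:: x.1.1; x.1.2; x.2] | x <- loc_tuples n & x \in loc N].
  rewrite -e3 filter_map -!map_comp enum_setE.
  by apply: eq_map => -[[i a] j] /=; rewrite !ek.
by rewrite /code_vpa f1 f2 f3 !card_ord !e4.
Qed.

Section CompTovpa.

Context {Q G : eqType} {eQ : Enc Q} {eG : Enc G}.

Lemma comp_index : computable (fun z : Q * seq Q => index z.1 z.2).
Proof.
apply: (comp_ext (f := fun z =>
  foldr (fun y n => if y == z.1 then 0 else n.+1) 0 z.2)) => [[x s] /=|].
  by elim: s => //= y s ->.
by comp_auto.
Qed.

Lemma comp_symbols : computable (fun B : aut nat Q G => symbols B).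
Proof. by rewrite /symbols; comp_auto. Qed.

End CompTovpa.

Section CompNum.

Context {Q G : eqType} {eQ : Enc Q} {eG : Enc G}.

Ltac comp_aut ::= match goal with
  | |- computable (fun e => index (@?a e) (@?b e)) => apply: (comp_app2 comp_index)
  | |- computable (fun e => symbols (@?a e)) => apply: (comp_comp comp_symbols)
  end.

Lemma comp_renumber : computable (fun B : aut nat Q G => renumber B).
Proof. by rewrite /renumber /state_index /symbol_index /omap /obind /oapp; comp_auto. Qed.

Definition code_tovpa (B : aut nat Q G) : tree :=
  code_mkvpa (size (states B)) (size (symbols B)) (renumber B).

Lemma code_tovpaE (B : aut nat Q G) : code_vpa (tovpa S B) = code_tovpa B.
Proof. exact: code_mkvpaE. Qed.

Lemma comp_code_tovpa : computable code_tovpa.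
Proof.
rewrite /code_tovpa; apply: (comp_app3 comp_code_mkvpa); [by comp_auto | by comp_auto |].
exact: comp_renumber.
Qed.

End CompNum.

End CodeVpa.

(** * From automata to formulas *)

Section DetPaths.

Variables (L Q G : eqType) (kd : L -> kind) (Sg : seq L) (A : aut L Q G).
Variables (F : seq (dstate Q)) (w : nat -> L).

Lemma daut_path_det k l c b :
  apath kd (daut Sg A F) w k (dinit A, [::]) l c b -> c = (dspec kd A w k l, dstack kd A w k l).
Proof.
elim=> [|m c1 c2 b' h e s]; first by rewrite dspec_init /dstack pend_nil.
move: s; rewrite e => /daut_det [-> _].
by have := dnext_spec kd A w [::] (apath_le h); rewrite !cats0.
Qed.

Lemma daut_path_exists k l : (forall i, w i \in Sg) -> k <= l ->
  exists b, apath kd (daut Sg A F) w k (dinit A, [::]) l (dspec kd A w k l, dstack kd A w k l) b.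
Proof.
move=> hw; elim: l => [|l IH].
  rewrite leqn0 => /eqP ->; exists false; rewrite dspec_init /dstack pend_nil //.
  exact: PathNil.
rewrite leq_eqVlt => /orP[/eqP <-|].
  by exists false; rewrite dspec_init /dstack pend_nil //; exact: PathNil.
rewrite ltnS => kl; have [b h] := IH kl.
exists (b || ((dspec kd A w k l, dstack kd A w k l).1 \in F)); apply: (PathStep h).
have := dnext_spec kd A w [::] kl; rewrite !cats0 => <-.
apply: daut_step => //; first exact: dspec_dstates.
move=> _; rewrite /dspec /= /dstack; case: (pend kd w k l) => [|c s] //=.
exists (dspec kd A w k c, w c), [seq (dspec kd A w k c, w c) | c <- s]; split=> //.
by apply/allpairsP; exists (dspec kd A w k c, w c); split; [exact: dspec_dstates | exact: hw |].
Qed.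

(** Started with the empty stack, a run meets the bottom marker exactly at a return that reaches
    below the starting position; it then stops in [true]. *)
Definition pending_return : aut L bool unit :=
  ([:: false], [:: true], [seq (false, a, false, tt) | a <- Sg],
   [seq (false, a, Some tt, false) | a <- Sg] ++ [seq (false, a, None, true) | a <- Sg],
   [seq (false, a, false) | a <- Sg]).

Lemma pending_return_step a c c' : astep kd pending_return a c c' ->
  c.1 = false /\ (c'.1 = (if kd a is Kret then nilp c.2 else false)).
Proof.
rewrite /astep; case: (kd a) => /=.
- by move=> [X [_ /mapP[b _ [-> _ -> _]]]].
- case: (c.2) => [|X u] [_]; rewrite mem_cat => /orP[] /mapP[b _] //.
    by move=> [-> _ ->].
  by move=> [-> _ _ ->].
by move=> [_ /mapP[b _ [-> _ ->]]].
Qed.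

Lemma pending_return_path k l : (forall i, w i \in Sg) -> k <= l -> clean kd w k l ->
  exists u b, apath kd pending_return w k (false, [::]) l (false, u) b.
Proof.
move=> hw; elim: l => [|l IH].
  by rewrite leqn0 => /eqP ->; exists [::], false; exact: PathNil.
rewrite leq_eqVlt => /orP[/eqP <- _|]; first by exists [::], false; exact: PathNil.
rewrite ltnS => kl hc; have [u [b h]] := IH kl (cleanS hc).
have hsz := apath_size h.
have [u' hs] : exists u', astep kd pending_return (w l) (false, u) (false, u').
  have := hc l; rewrite kl ltnSn /astep /= => /(_ isT); case: (kd (w l)) => hret.
  - by exists (tt :: u), tt; split=> //; apply: map_f.
  - have := hret erefl; case: (u) hsz => [|[] v] /=; first by case: (pend kd w k l).
    by exists v; split=> //; rewrite mem_cat; apply/orP; left; apply: map_f.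
  - by exists u; split=> //; apply: map_f.
by exists u', (b || ((false, u).1 \in [:: true])); apply: (PathStep h).
Qed.

Lemma pending_returnP k : (forall i, w i \in Sg) ->
  (exists l c b, apath kd pending_return w k (false, [::]) l c b /\ c.1 = true) <->
  ~ forall m, clean kd w k m.
Proof.
move=> hw; split=> [[l [c [b [h e]]]] hc|].
  case: h e => // m c1 c2 b' h s e.
  have [e1 e2] := pending_return_step s; have := hc m.+1 m.
  rewrite (apath_le h) ltnSn => /(_ isT); move: e2; rewrite e.
  case: (kd (w m)) => // /esym; have := apath_size h.
  by case: (c1.2) => // /esym /size0nil -> _ /(_ erefl).
move=> hn; apply: NNPP => hno; apply: hn; elim=> [|m IH] i; first by rewrite ltn0 andbF.
move=> /andP[ki]; rewrite ltnS leq_eqVlt => /orP[/eqP ei|im]; last by apply: IH; rewrite ki.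
subst i => er ep.
have [u [b h]] := pending_return_path hw ki IH.
apply: hno; exists m.+1, (true, [::]), (b || ((false, u).1 \in [:: true])); split=> //.
apply: (PathStep h); have := apath_size h; rewrite ep => /size0nil /= ->.
rewrite /astep er; split=> //=; rewrite mem_cat; apply/orP; right; exact: map_f.
Qed.

End DetPaths.

(** * The formula over abstract connectives *)

Section Formula.

Variables (T R : Type) (tt : R) (neg : R -> R) (conj disj : R -> R -> R).
Variables (dm : T -> R -> R).

Definition big_or (s : seq R) := foldr disj (neg tt) s.
Definition big_and (s : seq R) := foldr conj tt s.
Definition dual x f := neg (dm x (neg f)).

End Formula.

Section BuchiFormula.

Variables (R : Type) (tt : R) (neg : R -> R) (conj disj : R -> R -> R).
Variables (dm : seq (nat * bool * nat) -> R -> R) (A : aut nat nat nat).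
Notation bor := (big_or tt neg disj).
Notation band := (big_and tt conj).

(* The letters p = (s, e), x, z, y stand for the profiles of [0, i), [i, k), [k, l)
   and [l, m) in the characterisation of acceptance; e y = y says that [i, m) and
   [l, m) have the same profile. *)
Definition buchi_formula : R :=
  bor [seq dm p.1 (band [seq dual neg dm x
          (bor [seq dm z (bor [seq dm y tt | y <- [seq y <- subseqs (triples A) | seq_profile A p.2 y == y]])
            | z <- [seq z <- subseqs (triples A) | seq_profile A x z == p.2]])
        | x <- subseqs (triples A)])
    | p <- [seq p <- goals A | accpair A p.1 p.2]].

End BuchiFormula.

(** Used for [code_vldl]: the code of the formula is the same expression over trees. A program can
    evaluate it, while formulas contain finite types and are not data. *)
Lemma buchi_formula_morph (R R' : Type) (h : R ->
  R') tt neg conj disj dm tt' neg' conj' disj' dm' A :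
  h tt = tt' -> (forall x, h (neg x) = neg' (h x)) ->
  (forall x y, h (conj x y) = conj' (h x) (h y)) ->
  (forall x y, h (disj x y) = disj' (h x) (h y)) ->
  (forall x f, h (dm x f) = dm' x (h f)) ->
  h (buchi_formula tt neg conj disj dm A) = buchi_formula tt' neg' conj' disj' dm' A.
Proof.
move=> ht hn hc hd hdm.
have hor s : h (big_or tt neg disj s) = big_or tt' neg' disj' (map h s).
  by elim: s => [|x s IH] /=; rewrite ?hn ?ht // hd IH.
have hand s : h (big_and tt conj s) = big_and tt' conj' (map h s).
  by elim: s => [|x s IH] //=; rewrite hc IH.
rewrite /buchi_formula hor -map_comp; congr big_or; apply: eq_map => p /=.
rewrite hdm hand -map_comp; congr (dm' _ (big_and _ _ _)); apply: eq_map => x /=.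
rewrite /dual hn hdm hn hor -map_comp.
congr (neg' (dm' _ (neg' (big_or _ _ _ _)))); apply: eq_map => z /=.
rewrite hdm hor -map_comp; congr (dm' _ (big_or _ _ _ _)); apply: eq_map => y /=.
by rewrite hdm ht.
Qed.

(** * The formula of an automaton and its semantics *)

Section BuchiToVldl.

Variables (P : finType) (S : pushdown_alphabet P) (p0 : P).
Notation Sg := (alphabet P).
Notation kd := (letter_kind S).

(** Formulas bottom out in atoms, so a tautology takes an atom [p0]; this is where [P] has to be
    nonempty. *)
Definition vldl_true : vldl S := Or (Atom S p0) (Not (Atom S p0)).
Definition vldl_dia (Q G : eqType) (B : aut nat Q G) (f : vldl S) : vldl S :=
  @Dia P S (tovpa S B) (fun _ => vldl_true) f.
Definition vldl_clean : vldl S := Not (vldl_dia (pending_return Sg) vldl_true).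
Definition ends (A : aut nat nat nat) x b : seq (dstate nat) :=
  [seq d <- dstates A | (d.1.2 == x) && (b ==> d.2)].
(** The two disjuncts are the two cases of [stair_rel] for the end of the segment: no call is
    pending there, or no later return reaches below it. *)
Definition vldl_profile (A : aut nat nat nat) x (f : vldl S) : vldl S :=
  Or (vldl_dia (daut Sg A (ends A x true)) f)
     (vldl_dia (daut Sg A (ends A x false)) (And vldl_clean f)).
Definition vldl_buchi (A : aut nat nat nat) : vldl S :=
  buchi_formula vldl_true (@Not P S) (@And P S) (@Or P S) (vldl_profile A) A.

Variables (A : aut nat nat nat) (alpha : omega_word P).
Notation w := (fun i => rank (alpha i)).
Notation stair := (stair kd w).
Notation profile := (profile kd A w).
Implicit Types k l m : nat.

Lemma word_alphabet i : w i \in Sg.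
Proof. exact: alphabet_rank. Qed.

Lemma sat_vldl_true k : sat vldl_true alpha k.
Proof. exact: classic. Qed.

Lemma sat_vldl_dia (Q G : eqType) (B : aut nat Q G) f k : sat (vldl_dia B f) alpha k <->
  exists l, (k <= l /\ exists q c b, [/\ q \in ini B,
    apath kd B w k (q, [::]) l c b & c.1 \in fin B]) /\ sat f alpha l.
Proof.
split=> [[l [h hf]]|[l [h hf]]]; exists l; split=> //.
  exact: (iffLR (@tovpa_rel _ _ _ _ B alpha _ k l (fun _ m => sat_vldl_true m)) h).
exact: (iffRL (@tovpa_rel _ _ _ _ B alpha _ k l (fun _ m => sat_vldl_true m)) h).
Qed.

Lemma sat_vldl_clean k : sat vldl_clean alpha k <-> forall m, clean kd w k m.
Proof.
have hp := @pending_returnP _ kd Sg w k word_alphabet.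
split=> [h|h].
  apply: NNPP => /hp [l [c [b [h1 h2]]]]; apply: h; apply: (iffRL (sat_vldl_dia (pending_return Sg) vldl_true k)); exists l.
  split; last exact: sat_vldl_true.
  split; first exact: apath_le h1.
  by exists false, c, b; rewrite !inE h2.
move=> /(sat_vldl_dia (pending_return Sg) vldl_true k) [l [[_ [q [c [b [/[!inE] /eqP -> h1 /eqP h2]]]]] _]].
by have [h3 _] := hp; apply: h3 => //; exists l, c, b.
Qed.

Lemma sat_daut x b f k : sat (vldl_dia (daut Sg A (ends A x b)) f) alpha k <->
  exists l, [/\ k <= l, profile k l = x, b -> pend kd w k l = [::] & sat f alpha l].
Proof.
rewrite sat_vldl_dia; split=> [[l [[kl [q [c [f' [/[!inE] /eqP -> /daut_path_det -> h]]]]] hf]]|].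
  exists l; move: h; rewrite mem_filter /dspec /= => /andP[/andP[/eqP h1 h2] _].
  by split=> // hb; move: h2; rewrite hb /= => /nilP.
move=> [l [kl hx hb hf]]; exists l; split=> //; split=> //.
have [b' h] := daut_path_exists kd A (ends A x b) word_alphabet kl.
exists (dinit A), (dspec kd A w k l, dstack kd A w k l), b'; split=> //; first by rewrite inE.
rewrite mem_filter dspec_dstates /dspec /= hx eqxx andbT /=.
by apply/implyP => /hb ->.
Qed.

Lemma sat_vldl_profile x f k : stair k -> sat (vldl_profile A x f) alpha k <->
  exists l, [/\ k <= l, stair l, profile k l = x & sat f alpha l].
Proof.
move=> hk; split.
  move=> [/(sat_daut x true f k) [l [kl hx hb hf]]|
      /(sat_daut x false (And vldl_clean f) k) [l [kl hx _ [/(sat_vldl_clean l) hc hf]]]];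
    exists l; split=> //; apply/(stair_rel hk kl); [left; exact: hb | by right].
move=> [l [kl /(stair_rel hk kl) hl hx hf]]; case: hl => hl.
  by left; apply/(sat_daut x true f k); exists l.
right; apply/(sat_daut x false (And vldl_clean f) k); exists l; split=> //.
by split=> //; apply/(sat_vldl_clean l).
Qed.

Lemma sat_dual x f k : stair k -> sat (dual (@Not P S) (vldl_profile A) x f) alpha k <->
  forall l, k <= l -> stair l -> profile k l = x -> sat f alpha l.
Proof.
move=> hk; change (~ sat (vldl_profile A x (Not f)) alpha k <->
  forall l, k <= l -> stair l -> profile k l = x -> sat f alpha l).
rewrite sat_vldl_profile //; split=> [h l kl hl hx|h [l [kl hl hx]]]; last by apply; exact: h.
by apply: NNPP => hf; apply: h; exists l.
Qed.

Lemma sat_big_or (T : eqType) (F : T -> vldl S) s k :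
  sat (big_or vldl_true (@Not P S) (@Or P S) [seq F x | x <- s]) alpha k <->
  exists2 x, x \in s & sat (F x) alpha k.
Proof.
elim: s => [|x s IH]; first by split=> [h|[]] //; case: h; exact: sat_vldl_true.
split=> [[h|/IH [y hy h]]|[y]].
- by exists x; rewrite ?inE ?eqxx.
- by exists y; rewrite ?inE ?hy ?orbT.
rewrite inE => /orP[/eqP -> h|hy h]; first by left.
by right; apply/IH; exists y.
Qed.

Lemma sat_big_and (T : eqType) (F : T -> vldl S) s k :
  sat (big_and vldl_true (@And P S) [seq F x | x <- s]) alpha k <->
  forall x, x \in s -> sat (F x) alpha k.
Proof.
elim: s => [|x s IH]; first by split=> // _; exact: sat_vldl_true.
split=> [[h1 /IH h2] y|h]; first by rewrite inE => /orP[/eqP ->|/h2].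
split; first by apply: h; rewrite inE eqxx.
by apply/IH => y hy; apply: h; rewrite inE hy orbT.
Qed.

(** A formula evaluated at [k] no longer sees [i]; it remembers only the profile of [[i, k)], so the
    profile of [[i, l)] appears as a product. Letting [k] range over all later stairs expresses that
    there are infinitely many such [l]. *)
Definition recurrent i e := forall k, i <= k -> stair k ->
  exists l, [/\ k <= l, stair l, seq_profile A (profile i k) (profile k l) = e &
    exists m, [/\ l <= m, stair m & seq_profile A e (profile l m) = profile l m]].

Lemma sat_vldl_buchi : sat (vldl_buchi A) alpha 0 <->
  exists s e i, [/\ accpair A s e, stair i, profile 0 i = s & recurrent i e].
Proof.
have st0 := stair0 kd w.
rewrite /vldl_buchi /buchi_formula sat_big_or; split.
  move=> [[s e] hse h0].
  have hacc : accpair A s e by move: hse; rewrite mem_filter => /andP[].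
  have [i [_ hi hs /sat_big_and h]] := iffLR (sat_vldl_profile s _ st0) h0.
  exists s, e, i; split=> // k ik hk.
  have /sat_dual := h _ (profile_subseqs kd A w i k); move=> /(_ hi k ik hk erefl).
  move=> /sat_big_or [z]; rewrite mem_filter => /andP[/eqP hz _].
  move=> /(sat_vldl_profile _ _ hk) [l [kl hl ez]] /sat_big_or [y].
  rewrite mem_filter => /andP[/eqP hy _] /(sat_vldl_profile _ _ hl) [m [lm hm ey _]].
  by exists l; split=> //; [rewrite ez | exists m; split=> //; rewrite ey].
move=> [s [e [i [hacc hi hs h]]]]; exists (s, e).
  rewrite mem_filter /= hacc; apply/goalsP; split=> /=; first by rewrite -hs profile_subseqs.
  by have [l [_ _ <- _]] := h i (leqnn i) hi; exact: filter_subseqs.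
apply/(sat_vldl_profile _ _ st0); exists i; split=> //; apply/sat_big_and => x _.
apply/sat_dual => // k ik hk hx.
have [l [kl hl hz [m [lm hm hy]]]] := h k ik hk.
apply/sat_big_or; exists (profile k l); first by rewrite mem_filter profile_subseqs -hx hz eqxx.
apply/(sat_vldl_profile _ _ hk); exists l; split=> //.
apply/sat_big_or; exists (profile l m); first by rewrite mem_filter profile_subseqs hy eqxx.
by apply/(sat_vldl_profile _ _ hl); exists m; split=> //; exact: sat_vldl_true.
Qed.

(** Given [l] with its [m], take the next cut [l'] beyond [m]. In the profile of [[l, l')] the part
    [[l, m)] can be replaced by [[i, m)], which gives the profile of [[i, l')], namely [e].
    Iterating this produces the factorization. *)
Lemma recurrent_sound s e i : accpair A s e -> stair i -> profile 0 i = s ->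
  recurrent i e -> alang kd A w.
Proof.
move=> /accpairP [q0 [b [q [hq0 hs he]]]] hi es h.
pose X l := [/\ i <= l, stair l, profile i l = e &
  exists m, [/\ l <= m, stair m & seq_profile A e (profile l m) = profile l m]].
have hX n : exists2 l, n <= l & X l.
  have [k nk hk] := unbounded_stair kd w (maxn i n).
  move: nk; rewrite geq_max => /andP[ik nk].
  have [l [kl hl hz hm]] := h k ik hk; exists l; first exact: leq_trans nk kl.
  split=> //; first exact: leq_trans ik kl.
  by rewrite (stair_profile A ik kl hi hk).
have [l0 i0 hl0] := hX i.+1.
have [//|n l|J [J0 hJ1 hJ2]] := @dep_choice nat (fun _ => X)
  (fun _ l l' => l < l' /\ profile l l' = e) l0.
  move=> [il hl el [m [lm hm hy]]].
  have [l' ml hl'] := hX m.+1; exists l'; split=> //; split; first exact: leq_ltn_trans ml.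
  have [il' sl' el' _] := hl'.
  have ml' := ltnW ml; have im := leq_trans il lm.
  rewrite (stair_profile A lm ml' hl hm) -hy -el -(stair_profile A il lm hi hl).
  by rewrite -(stair_profile A im ml' hi hm) el'.
have hJ a : stair (J a) by case: (hJ1 a).
have hinc a : J a < J a.+1 by case: (hJ2 a).
have [iJ _ eJ _] := hJ1 0.
have hq : q \in states A.
  by move: he; rewrite -eJ => /mem_profile [].
(* The prefix [[0, J 0)] consists of [[0, i)] with profile [s] and [[i, J 0)] with profile [e],
   whence the flag [b || true]. *)
apply: (factorization_accept hinc _ hJ hq0 (b := b || true) (q := q)).
- by rewrite J0; exact: leq_ltn_trans i0.
- rewrite (stair_profile A (leq0n i) iJ (stair0 _ _) hi) es eJ.
  by apply/mem_seq_profile => //; [exact: states_ini | exists q, b, true].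
by move=> a; have [_ ->] := hJ2 a.
Qed.

Lemma recurrent_complete : alang kd A w ->
  exists s e i, [/\ accpair A s e, stair i, profile 0 i = s & recurrent i e].
Proof.
move=> hA; have [s [e [J [hJ hst hs he]]]] := factorization_exists kd A w.
have [ee se] := factorization_idem hJ hst hs he.
have hst' a : stair (J a) by case: (hst a).
exists s, e, (J 0); split=> //.
  apply: (accept_factorization (J := J)) hA => // [a|a]; last exact: he.
  have [h _] := stair_rel (stair0 kd w) (leq0n (J a)).
  by case: (h (hst' a)) => [|hc]; [left | right].
(* The witnesses are the cuts [J k.+1] and [J k.+2]. The index [k.+1] is positive, so
   [[J 0, J k.+1)] has profile [e], and the merging condition is the idempotence of [e]. *)
move=> k k0 hk; have kJ : k <= J k.+1 by apply: leq_trans (incr_ge hJ k.+1).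
exists (J k.+1); split=> //.
  by rewrite -(stair_profile A k0 kJ) // he.
by exists (J k.+2); split=> //; [exact: ltnW | rewrite he].
Qed.

Lemma vldl_buchi_lang : vldl_lang (vldl_buchi A) alpha <-> alang kd A w.
Proof.
rewrite /vldl_lang sat_vldl_buchi; split; last exact: recurrent_complete.
by move=> [s [e [i [h1 h2 h3 h4]]]]; exact: recurrent_sound h1 h2 h3 h4.
Qed.

End BuchiToVldl.

(** * Computability of the formula *)

Section CodeFormula.

Variables (P : finType) (S : pushdown_alphabet P) (p0 : P).
Notation Sg := (alphabet P).

Definition code_true : tree := code_vldl (vldl_true S p0).
Definition code_not (x : tree) : tree := Node (code 1) (Node x Nil).
Definition code_and (x y : tree) : tree := Node (code 2) (Node x (Node y Nil)).
Definition code_or (x y : tree) : tree := Node (code 3) (Node x (Node y Nil)).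
(** Every state carries the tautology as its test, so the list of tests is one constant repeated. *)
Definition code_dia (Q G : eqType) {eQ : Enc Q} {eG : Enc G} (B : aut nat Q G) (f : tree) : tree :=
  Node (code 4) (Node (code_tovpa S B)
    (Node (code [seq code_true | _ <- iota 0 (size (states B))]) (Node f Nil))).
Definition code_profile (A : aut nat nat nat) x (f : tree) : tree :=
  code_or (code_dia (daut Sg A (ends A x true)) f)
      (code_dia (daut Sg A (ends A x false)) (code_and (code_vldl (vldl_clean S p0)) f)).

Lemma code_vldl_dia (Q G : eqType) {eQ : Enc Q} {eG : Enc G} (B : aut nat Q G) (f :
  vldl S) :
  code_vldl (vldl_dia p0 B f) = code_dia B (code_vldl f).
Proof.
have h n : [seq code_true | _ <- enum 'I_n] = [seq code x | x <- [seq code_true | _ <- iota 0 n]].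
  by rewrite -(val_enum_ord n) -!map_comp.
rewrite /code_dia -code_tovpaE.
by rewrite -[code [seq _ | _ <- _]]/(code_list (map code _)) -h.
Qed.

Lemma code_vldl_buchi A :
  code_vldl (vldl_buchi S p0 A) = buchi_formula code_true code_not code_and code_or (code_profile A) A.
Proof.
apply: buchi_formula_morph => // x f; rewrite /code_profile -!code_vldl_dia.
by rewrite -[code_and _ _]/(code_vldl (And (vldl_clean S p0) f)) -code_vldl_dia.
Qed.

End CodeFormula.

Section CompFormula.

Variables (P : finType) (S : pushdown_alphabet P) (p0 : P).

Ltac comp_aut ::= match goal with
  | |- computable (fun e => code_tovpa _ (@?a e)) => apply: (comp_comp (comp_code_tovpa _))
  end.

Lemma comp_code_dia (Q G : eqType) {eQ : Enc Q} {eG : Enc G} :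
  computable (fun z : aut nat Q G * tree => code_dia S p0 z.1 z.2).
Proof. by rewrite /code_dia; repeat first [progress comp_auto | apply: comp_code]. Qed.

Lemma comp_ends b : computable (fun z :
  aut nat nat nat * seq (nat * bool * nat) => ends z.1 z.2 b).
Proof. by rewrite /ends /dstates; case: b; comp_auto. Qed.

Ltac comp_aut ::= match goal with
  | |- computable (fun e => code_dia _ _ (@?a e) (@?b e)) => apply: (comp_app2 comp_code_dia)
  | |- computable (fun e => ends (@?a e) (@?b e) _) => apply: (comp_app2 (comp_ends _))
  | |- computable (fun e => daut (@?a e) (@?b e) (@?c e)) => apply: (comp_app3 comp_daut)
  end.

Lemma comp_code_profile :
  computable (fun z : aut nat nat nat * seq (nat * bool * nat) * tree => code_profile S p0 z.1.1 z.1.2 z.2).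
Proof. by rewrite /code_profile /code_or /code_and; comp_auto. Qed.

Ltac comp_aut ::= match goal with
  | |- computable (fun e => code_profile _ _ (@?a e) (@?b e) (@?c e)) => apply: (comp_app3 comp_code_profile)
  | |- computable (fun e => accpair (@?a e) (@?b e) (@?c e)) => apply: (comp_app3 comp_accpair)
  | |- computable (fun e => autof (@?a e)) => apply: (comp_comp comp_autof)
  end.

Lemma comp_code_buchi : computable (fun A : aut nat nat nat =>
  buchi_formula (code_true S p0) code_not code_and code_or (code_profile S p0 A) A).
Proof.
rewrite /buchi_formula /big_or /big_and /dual /goals /code_not /code_or /code_and.
by comp_auto.
Qed.

End CompFormula.

(** * The two effective translations *)

Lemma tcomp_effective (X Y : Type) (cX : X -> tree) (cY : Y -> tree) (R : X -> Y -> Prop)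
    F (f : X -> Y) :
  tree_computable F -> (forall x, F (cX x) = cY (f x)) -> (forall x, R x (f x)) ->
  effective_translation cX cY R.
Proof.
move=> [p hp] hF hR; exists p => x; exists (f x) => //.
by rewrite -hF; exact: hp.
Qed.

Lemma bvpa_to_vldl (P : finType) (S : pushdown_alphabet P) : 0 < #|P| ->
  effective_translation (@code_vpa P S) (@code_vldl P S)
    (fun (A : vpa S) (phi : vldl S) =>
       forall alpha, vldl_lang phi alpha <-> bvpa_lang A alpha).
Proof.
move=> /card_gt0P [p0 _].
have [F hF eF] := comp_comp (comp_code_buchi S p0) comp_autof.
apply: (@tcomp_effective _ _ _ _ _ F (fun A => vldl_buchi S p0 (ofvpa A))) => // A.
  by rewrite -code_rawof eF autof_rawof code_vldl_buchi.
by move=> alpha; rewrite vldl_buchi_lang ofvpa_lang.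
Qed.

Lemma vldl_to_bvpa (P : finType) (S : pushdown_alphabet P) :
  effective_translation (@code_vldl P S) (@code_vpa P S)
    (fun (phi : vldl S) (A : vpa S) =>
       forall alpha, bvpa_lang A alpha <-> vldl_lang phi alpha).
Proof.
have [F hF eF] := comp_translation S.
have [H hH eH] := comp_code_tovpa S (Q := tree) (G := tree).
apply: (@tcomp_effective _ _ _ _ _ (fun t => H (F t)) (fun phi => tovpa S (translation phi))).
- exact: tcomp_comp.
- by move=> phi; rewrite eF eH -code_tovpaE.
move=> phi alpha; rewrite tovpa_lang /vldl_lang.
exact: (translation_sat alpha phi 0).
Qed.

Theorem theorem1 (P : finType) (S : pushdown_alphabet P) (P_nonempty : 0 < #|P|) :
  (forall L : omega_word P -> Prop,
     (exists A : vpa S, forall alpha, bvpa_lang A alpha <-> L alpha) <->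
     (exists phi : vldl S, forall alpha, vldl_lang phi alpha <-> L alpha)) /\
  effective_translation (@code_vpa P S) (@code_vldl P S)
    (fun (A : vpa S) (phi : vldl S) =>
       forall alpha, vldl_lang phi alpha <-> bvpa_lang A alpha) /\
  effective_translation (@code_vldl P S) (@code_vpa P S)
    (fun (phi : vldl S) (A : vpa S) =>
       forall alpha, bvpa_lang A alpha <-> vldl_lang phi alpha).
Proof.
have h1 := bvpa_to_vldl S P_nonempty; have h2 := vldl_to_bvpa S.
split=> // L; split.
  move=> [A hA]; have [p hp] := h1; have [phi _ h] := hp A.
  by exists phi => alpha; rewrite h.
move=> [phi hphi]; have [p hp] := h2; have [A _ h] := hp phi.
by exists A => alpha; rewrite h.
Qed.
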